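(* Let $N \ge 1$ and let $u_0 \in BUC(\mathbb{R}^N)$ be given. For $h \ge 0$ let $M_2^h \colon BUC(\mathbb{R}^N) \to BUC(\mathbb{R}^N)$ be the linear operator $$(M_2^h \varphi)(x) := \frac{1}{|\partial B(x,\sqrt{2h})|}\int_{\partial B(x,\sqrt{2h})} \varphi \, ds, \qquad x \in \mathbb{R}^N .$$ Then the function $u \colon [0,\infty) \to BUC(\mathbb{R}^N)$ defined by $$u(t) := \lim_{n\to\infty} \left(M_2^{t/n}\right)^n u_0$$ is the unique bounded, continuous solution of the Cauchy problem $$u_t - \frac{1}{N}\,\Delta u = 0 \quad \text{for } x \in \mathbb{R}^N,\ t>0, \qquad u(x,0) = u_0(x) \quad \text{for } x \in \mathbb{R}^N .$$ In particular, the limit defining $u(t)$ exists for every $t \ge 0$.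
   Context: $BUC(\mathbb{R}^N)$ is the space of bounded, uniformly continuous real-valued functions on $\mathbb{R}^N$, with the supremum norm; the limit is taken in this space. $B(x,r)$ is the open Euclidean ball with center $x$ and radius $r \ge 0$, $\partial B(x,r)$ is the sphere bounding it, $ds$ is surface measure (counting measure on the two-point set $\{x-r,x+r\}$ when $N=1$), and $|\partial B(x,r)|$ is the total surface measure. For $h=0$ the sphere is the point $\{x\}$ and $M_2^0$ is the identity. $(M_2^{h})^n$ denotes the $n$-fold composition. A function $u\colon[0,\infty)\to BUC(\mathbb{R}^N)$ is identified with the function $u(x,t) := u(t)(x)$ on $\mathbb{R}^N\times[0,\infty)$; ''bounded, continuous'' refers to $u$ as a function on $\mathbb{R}^N\times[0,\infty)$. Solutions are understood in the viscosity sense for $t>0$, with the initial condition attained pointwise. *)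

(* Defs.v *)
From HB Require Import structures.
From mathcomp Require Import all_boot all_order all_algebra.
From mathcomp Require Import all_classical all_reals all_analysis.

Set Implicit Arguments.
Unset Strict Implicit.
Unset Printing Implicit Defensive.

Import Order.TTheory GRing.Theory Num.Theory.
Import numFieldNormedType.Exports.

Local Open Scope classical_set_scope.
Local Open Scope ring_scope.

(* The library norm on ['rV[R]_N] is the sup norm: it gives the usual topology
   and uniformity, but spheres and diameters need the Euclidean norm. *)
Definition enorm (R : realType) (N : nat) (x : 'rV[R]_N) : R :=
  Num.sqrt (\sum_(i < N) x ord0 i ^+ 2).

Definition sphere (R : realType) (N : nat) (x : 'rV[R]_N) (r : R) :
    set 'rV[R]_N :=
  [set y | enorm (y - x) = r].

Section surface_measure.
Local Open Scope ereal_scope.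
Variables (R : realType) (N : nat).
Implicit Types (A : set 'rV[R]_N) (s : nat) (delta : R).

(* [-oo] when [A] is empty *)
Definition ediam A : \bar R :=
  ereal_sup [set (enorm (p.1 - p.2)%R)%:E | p in A `*` A].

(* The empty set has weight 0 also for [s = 0], where [x ^+ 0 = 1]; hence the
   0-dimensional measure is the counting measure. *)
Definition hausdorff_weight s A : \bar R :=
  if A == set0 then 0 else ediam A ^+ s.

Definition hausdorff_content s delta A : \bar R :=
  ereal_inf [set \sum_(0 <= k <oo) hausdorff_weight s (F k) |
    F in [set F : nat -> set 'rV[R]_N |
      A `<=` \bigcup_k F k /\ forall k, ediam (F k) <= delta%:E]].

Definition hausdorff s A : \bar R :=
  ereal_sup [set hausdorff_content s delta A | delta in [set d : R | (0 < d)%R]].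

(* Lebesgue volume of the Euclidean unit ball of R^n *)
Fixpoint unit_ball_volume (n : nat) : R :=
  match n with
  | 0 => 1%R
  | 1 => 2%R
  | (m.+1 as k).+1 => (2 * pi / k.+1%:R * unit_ball_volume m)%R
  end.

(* (N-1)-dimensional Hausdorff measure, normalized to agree with the Euclidean
   surface area on hypersurfaces; the counting measure if [N = 1] *)
Definition surface_measure A : \bar R :=
  (unit_ball_volume N.-1 / 2 ^+ N.-1)%:E * hausdorff N.-1 A.

End surface_measure.

(* R^N with its Borel sigma-algebra *)
Definition borel_rV (R : realType) (N : nat) :=
  g_sigma_algebraType (@open 'rV[R]_N).

Definition sphere_mean (R : realType) (N : nat) (phi : 'rV[R]_N -> R)
    (x : 'rV[R]_N) (r : R) : R :=
  fine (\int[@surface_measure R N : set (borel_rV R N) -> \bar R]_(y in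
          sphere x r) (phi y)%:E)%E
  / fine (surface_measure (sphere x r)).

(* For [h = 0] the sphere is a point, of surface measure 0 if [N > 1]. *)
Definition M2 (R : realType) (N : nat) (h : R) (phi : 'rV[R]_N -> R) :
    'rV[R]_N -> R :=
  if h == 0 then phi else fun x => sphere_mean phi x (Num.sqrt (2 * h)).

Definition BUC (R : realType) (N : nat) (phi : 'rV[R]_N -> R) : Prop :=
  bounded_fun phi /\ unif_continuous phi.

(* [sup] is meaningful only for bounded [phi], e.g. for [BUC phi]. *)
Definition sup_norm (R : realType) (N : nat) (phi : 'rV[R]_N -> R) : R :=
  sup [set `|phi x| | x in [set: 'rV[R]_N]].

Definition BUC_cvg (R : realType) (N : nat)
    (f : nat -> 'rV[R]_N -> R) (g : 'rV[R]_N -> R) : Prop :=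
  [/\ forall n, BUC (f n), BUC g &
      (fun n => sup_norm (fun x => f n x - g x)) @ \oo --> (0 : R)].

Section heat_equation.
Variables (R : realType) (N : nat).

(* Space-time functions are functions of [p = (x, t)]. *)
Implicit Types (phi u : 'rV[R]_N * R -> R) (p : 'rV[R]_N * R).

Definition edir (i : 'I_N) : 'rV[R]_N * R := (delta_mx ord0 i, 0).
Definition tdir : 'rV[R]_N * R := (0, 1).

Definition dx (i : 'I_N) phi : 'rV[R]_N * R -> R := fun p => 'D_(edir i) phi p.
Definition dt phi : 'rV[R]_N * R -> R := fun p => 'D_tdir phi p.
Definition laplacian phi p : R := \sum_(i < N) dx i (dx i phi) p.

Definition C1_test phi p : Prop :=
  [/\ {for p, continuous phi},
      derivable phi p tdir, {for p, continuous (dt phi)} &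
      forall i, derivable phi p (edir i) /\ {for p, continuous (dx i phi)}].

(* phi is C^2 in x and C^1 in t on R^N x (0, oo) *)
Definition C21 phi : Prop :=
  forall p, 0 < p.2 ->
    C1_test phi p /\
    forall i j, derivable (dx i phi) p (edir j) /\
                {for p, continuous (dx j (dx i phi))}.

(* In the next two definitions [c] is the coefficient in u_t - c Delta u = 0.
   As [0 < p.2], a neighborhood of [p] may be taken within R^N x (0, oo). *)
Definition visc_subsolution (c : R) u : Prop :=
  forall phi p, C21 phi -> 0 < p.2 ->
    (\forall q \near p, u q - phi q <= u p - phi p) ->
    dt phi p - c * laplacian phi p <= 0.

Definition visc_supersolution (c : R) u : Prop :=
  forall phi p, C21 phi -> 0 < p.2 ->
    (\forall q \near p, u p - phi p <= u q - phi q) ->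
    0 <= dt phi p - c * laplacian phi p.

(* [u] is only considered on R^N x [0, oo). *)
Definition bounded_continuous_solution (u0 : 'rV[R]_N -> R) u : Prop :=
  [/\ [bounded u p | p in [set p : 'rV[R]_N * R | 0 <= p.2]],
      {within [set p : 'rV[R]_N * R | 0 <= p.2], continuous u},
      visc_subsolution N%:R^-1 u,
      visc_supersolution N%:R^-1 u &
      forall x, u (x, 0) = u0 x].

End heat_equation.

(* Main.v *)
(* The operator M2 h is linear and positive, preserves constants and commutes with
   translations; so it contracts the sup norm and commutes with derivatives. The
   symmetries of the sphere give M2 h f = f + (h/N) Delta f + O(h^(3/2)) when f has
   bounded derivatives. Telescoping powers of contractions then bounds the distance
   between n steps of length t/n and nm steps of length t/(nm) by C t sqrt(t/n): the
   iterates are uniformly Cauchy, and by density they are so for all data in BUC. The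
   same telescoping applied to two times t, s differentiates the limit in time, which
   is therefore a classical solution for smooth data and, by stability of viscosity
   solutions, a viscosity solution for all data. A bounded viscosity solution lies
   between the classical solutions with slightly larger and slightly smaller smooth
   data, by the maximum principle with the penalty |x|^2 + (2N c + 1) t (c = 1/N), whence
   uniqueness. That spherical means exist at all requires the (N-1)-dimensional
   Hausdorff measure to be a Borel measure (Caratheodory), positive and finite on
   spheres. *)
From HB Require Import structures.
Require Import Defs.
From mathcomp Require Import all_boot all_order all_algebra.
From mathcomp Require Import all_classical all_reals all_analysis.
From mathcomp Require Import ring lra perm.
Import Order.TTheory GRing.Theory Num.Theory.
Import numFieldNormedType.Exports.
Local Open Scope classical_set_scope.
Local Open Scope ring_scope.

Set Implicit Arguments.
Unset Strict Implicit.
Unset Printing Implicit Defensive.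

(** * Hausdorff and surface measure *)

(** Spherical integrals are evaluated by symmetry alone. Reflecting one coordinate removes the odd
    terms of an expansion, and swapping coordinates identifies the second moments, whose sum is
    known on the sphere. The measure theory is therefore directed at invariance under isometries and
    at the bounds [0 < area < oo], both obtained by counting on grids. Smooth data are functions
    with one common bound [K] on all derivatives up to a given order. A mean operator preserves this
    class with the same [K], so nothing is lost over [n] iterations. The expansion of one step uses
    three derivatives. Comparing several steps with one also moves the Laplacian of the data by such
    steps, so it must have three derivatives itself: hence the order five. The derivative in time
    comes from comparing [n] steps of length [t / n] with [n] steps of length [s / n], which differ
    by [(t - s) / (n * N)] times a Laplacian at each step. In the uniqueness argument one of the two
    functions compared is always smooth, so that it serves, after adding the penalty, as the test
    function. *)

Lemma le_expe {R : realType} (x y : \bar R) n :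
  (0 <= x -> x <= y -> x ^+ n <= y ^+ n)%E.
Proof.
move=> x0 xy; elim: n => [|n IHn]; first by rewrite !expe0.
by rewrite !expeS lee_pmul// expe_ge0.
Qed.

Section hausdorff_outer_measure.
Context {R : realType} {N : nat}.
Local Open Scope ereal_scope.
Implicit Types (A B X : set 'rV[R]_N) (s : nat) (d : R).

Lemma enorm_ge0 (x : 'rV[R]_N) : (0 <= enorm x)%R.
Proof. exact: sqrtr_ge0. Qed.

Lemma enorm0 : enorm (0 : 'rV[R]_N) = 0%R.
Proof.
by rewrite /enorm big1 ?sqrtr0// => i _; rewrite mxE expr0n.
Qed.

Lemma sqr_enorm (x : 'rV[R]_N) : (enorm x ^+ 2 = \sum_(i < N) x ord0 i ^+ 2)%R.
Proof. by rewrite sqr_sqrtr// sumr_ge0// => i _; exact: sqr_ge0. Qed.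

Lemma coord_le_enorm (x : 'rV[R]_N) i : (`|x ord0 i| <= enorm x)%R.
Proof.
rewrite -(ler_pXn2r (n := 2)) ?nnegrE ?enorm_ge0// sqr_enorm real_normK ?num_real//.
by rewrite (bigD1 i)//= lerDl sumr_ge0// => j _; exact: sqr_ge0.
Qed.

Lemma norm_le_enorm (x : 'rV[R]_N) : (`|x| <= enorm x)%R.
Proof.
rewrite [leLHS]/Num.norm /= mx_normrE.
by apply/bigmax_leP; split => [|[i j] _]; rewrite ?enorm_ge0// ord1 coord_le_enorm.
Qed.

Lemma coord_le_norm (x : 'rV[R]_N) i : (`|x ord0 i| <= `|x|)%R.
Proof.
rewrite [leRHS]/Num.norm /= mx_normrE.
by apply/bigmax_geP; right; exists (ord0, i).
Qed.

Lemma enorm_le_sum (x : 'rV[R]_N) : (enorm x <= \sum_(i < N) `|x ord0 i|)%R.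
Proof.
have S0 : (0 <= \sum_(i < N) `|x ord0 i|)%R by rewrite sumr_ge0.
rewrite -(ler_pXn2r (n := 2)) ?nnegrE ?enorm_ge0// sqr_enorm expr2 mulr_suml.
apply: ler_sum => i _; rewrite -real_normK ?num_real// expr2 ler_wpM2l//.
by rewrite (bigD1 i)//= lerDl sumr_ge0.
Qed.

Lemma ediam_ge0 A : A !=set0 -> 0 <= ediam A.
Proof.
move=> [x Ax]; apply: ereal_sup_ubound; exists (x, x) => //=.
by rewrite subrr enorm0.
Qed.

Lemma hausdorff_weight0 s : hausdorff_weight s (set0 : set 'rV[R]_N) = 0.
Proof. by rewrite /hausdorff_weight eqxx. Qed.

Lemma hausdorff_weight_ge0 s A : 0 <= hausdorff_weight s A.
Proof.
rewrite /hausdorff_weight; case: ifPn => // /set0P A0.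
exact/expe_ge0/ediam_ge0.
Qed.

Let disc := g_sigma_algebraType [set: set 'rV[R]_N].

Let premeasure s d A : \bar R :=
  if `[< ediam A <= d%:E >] then hausdorff_weight s A else +oo.

Let premeasure_ge0 s d A : 0 <= premeasure s d A.
Proof. by rewrite /premeasure; case: ifPn => // _; exact: hausdorff_weight_ge0. Qed.

Let ediam_set0 : ediam (set0 : set 'rV[R]_N) = -oo.
Proof.
rewrite /ediam (_ : [set _ | _ in _] = set0) ?ereal_sup0//.
by rewrite -subset0 => _ [p [/= ? _] _].
Qed.

Let premeasure0 s d : premeasure s d set0 = 0.
Proof. by rewrite /premeasure ediam_set0 leNye asboolT// hausdorff_weight0. Qed.

Lemma hausdorff_contentE s d A :
  hausdorff_content s d A = mu_ext (premeasure s d : set disc -> \bar R) A.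
Proof.
apply/eqP; rewrite eq_le; apply/andP; split.
- apply: le_ereal_inf_tmp => _ [F [_ AF] <-].
  have [[k kd]|nF] := pselect (exists k, ~ ediam (F k) <= d%:E).
    suff -> : \sum_(0 <= k <oo) premeasure s d (F k) = +oo by rewrite leey.
    apply: (@eseries_pinfty _ _ xpredT k) => //.
      by move=> n _; rewrite gt_eqF// (lt_le_trans _ (premeasure_ge0 _ _ _)).
    by rewrite /premeasure asboolF.
  have Fd k : ediam (F k) <= d%:E by apply: contrapT => /= kd; apply: nF; exists k.
  apply: ereal_inf_lbound; exists F => //.
  by apply: eq_eseriesr => k _; rewrite /premeasure asboolT.
- apply: le_ereal_inf => _ [F [AF Fd] <-]; exists F.
    by split => // i; exact: sub_sigma_algebra.
  by apply: eq_eseriesr => k _; rewrite /premeasure asboolT.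
Qed.

Lemma hausdorff_content_ge0 s d A : 0 <= hausdorff_content s d A.
Proof. by rewrite hausdorff_contentE; exact: mu_ext_ge0. Qed.

Lemma le_hausdorff_contentl s A d d' : (d <= d')%R ->
  hausdorff_content s d' A <= hausdorff_content s d A.
Proof.
move=> dd'; apply: le_ereal_inf => _ [F [AF Fd] <-]; exists F => //; split => // k.
by rewrite (le_trans (Fd k))// lee_fin.
Qed.

Lemma hausdorff_content_le s d A : (0 < d)%R ->
  hausdorff_content s d A <= hausdorff s A.
Proof. by move=> d0; apply: ereal_sup_ubound; exists d. Qed.

Lemma hausdorff_ge0 s A : 0 <= hausdorff s A.
Proof.
exact: le_trans (hausdorff_content_ge0 s 1 A) (hausdorff_content_le s A ltr01).
Qed.

Lemma hausdorff0 s : hausdorff s (set0 : set 'rV[R]_N) = 0.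
Proof.
apply/eqP; rewrite eq_le hausdorff_ge0 andbT.
apply: ge_ereal_sup => _ [d d0 <-].
by rewrite hausdorff_contentE mu_ext0.
Qed.

Lemma le_hausdorff s : {homo (hausdorff s : set 'rV[R]_N -> \bar R) : A B / A `<=` B >-> A <= B}.
Proof.
move=> A B AB; apply: ge_ereal_sup => _ [d d0 <-].
apply: le_trans (hausdorff_content_le s B d0).
by rewrite !hausdorff_contentE; exact: le_mu_ext.
Qed.

Lemma hausdorff_sigma_subadditive s :
  sigma_subadditive (hausdorff s : set 'rV[R]_N -> \bar R).
Proof.
move=> F; apply: ge_ereal_sup => _ [d d0 <-].
rewrite hausdorff_contentE.
have := @mu_ext_sigma_subadditive _ disc R (premeasure s d) (premeasure_ge0 s d) F.
move/le_trans; apply.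
apply: lee_nneseries => [i _ _|i _].
  by rewrite -hausdorff_contentE hausdorff_content_ge0.
by rewrite -hausdorff_contentE hausdorff_content_le.
Qed.

HB.instance Definition _ s := isOuterMeasure.Build R 'rV[R]_N (hausdorff s)
  (hausdorff0 s) (hausdorff_ge0 s) (@le_hausdorff s)
  (@hausdorff_sigma_subadditive s).

(** A set of diameter at most [d < e] cannot meet both [A] and [B]. The members of a cover of the
    union that meet [A] and those that meet [B] thus have distinct indices, and each family covers
    its set. *)
Lemma hausdorff_content_separated s A B (d e : R) : (d < e)%R ->
  (forall a b, A a -> B b -> (e <= enorm (a - b))%R) ->
  hausdorff_content s d A + hausdorff_content s d B
    <= hausdorff_content s d (A `|` B).
Proof.
move=> de AB; apply: le_ereal_inf_tmp => _ [F [ABF Fd] <-].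
pose G C k := if `[< (F k `&` C) !=set0 >] then F k else set0.
have GE C : hausdorff_content s d C <= \sum_(0 <= k <oo) hausdorff_weight s (G C k) \/
    ~ (C `<=` A `|` B).
  have [CAB|] := pselect (C `<=` A `|` B); [left|by right].
  apply: ereal_inf_lbound; exists (G C) => //; split.
    move=> x Cx; have [k _ Fkx] := ABF _ (CAB _ Cx); exists k => //.
    by rewrite /G asboolT//; exists x.
  move=> k; rewrite /G; case: asboolP => _; first exact: Fd.
  by rewrite ediam_set0 leNye.
have [GA|[]] := GE A; last by move=> x; left.
have [GB|[]] := GE B; last by move=> x; right.
apply: (le_trans (leeD GA GB)).
rewrite -nneseriesD; [|by move=> *; exact: hausdorff_weight_ge0..].
apply: lee_nneseries => [i _ _|k _]; first by rewrite adde_ge0// hausdorff_weight_ge0.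
rewrite /G; case: ifPn => [/asboolP[a [Fa Aa]]|_]; last first.
  by rewrite hausdorff_weight0 add0e; case: ifPn => // _; rewrite hausdorff_weight0 hausdorff_weight_ge0.
case: ifPn => [/asboolP[b [Fb Bb]]|_]; last by rewrite hausdorff_weight0 adde0.
have /= := AB _ _ Aa Bb; rewrite leNgt => /negP[].
apply: le_lt_trans de; rewrite -lee_fin.
apply: le_trans (Fd k); apply: ereal_sup_ubound.
by exists (a, b).
Qed.

(** Contents increase as the scale shrinks, so two scales may be replaced by their minimum with
    [e / 2], where the contents are superadditive. The suprema over the two scales are then taken
    one after the other. *)
Lemma hausdorff_separated s A B (e : R) : (0 < e)%R ->
  (forall a b, A a -> B b -> (e <= enorm (a - b))%R) ->
  hausdorff s A + hausdorff s B <= hausdorff s (A `|` B).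
Proof.
move=> e0 AB; set c := hausdorff s (A `|` B).
have [->|cfin] := eqVneq c +oo; first by rewrite leey.
have {}cfin : c \is a fin_num.
  by rewrite ge0_fin_numE ?ltey// hausdorff_ge0.
have fin X : X `<=` A `|` B -> hausdorff s X \is a fin_num.
  move=> XAB; rewrite ge0_fin_numE ?hausdorff_ge0//.
  by rewrite (le_lt_trans (le_hausdorff s XAB))// ltey_eq cfin.
have key d d' : (0 < d)%R -> (0 < d')%R ->
    hausdorff_content s d A + hausdorff_content s d' B <= c.
  move=> d0 d'0; pose m := (Num.min (e / 2) (Num.min d d'))%R.
  have m0 : (0 < m)%R by rewrite !lt_min divr_gt0//= d0.
  apply: le_trans (hausdorff_content_le s _ m0).
  apply: le_trans (hausdorff_content_separated s (d := m) _ AB); last first.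
    by rewrite gt_min ltr_pdivrMr// mulrDr mulr1 ltrDl e0.
  by apply: leeD; apply: le_hausdorff_contentl; rewrite !ge_min lexx !orbT.
rewrite -leeBrDr; last by apply: fin; right.
apply: ge_ereal_sup => _ [d d0 <-].
rewrite leeBrDr; last by apply: fin; right.
rewrite addeC -leeBrDr; last first.
  rewrite ge0_fin_numE ?hausdorff_content_ge0//.
  rewrite (le_lt_trans (hausdorff_content_le s A d0))// ltey_eq fin//.
apply: ge_ereal_sup => _ [d' d'0 <-].
rewrite leeBrDr; last first.
  rewrite ge0_fin_numE ?hausdorff_content_ge0//.
  rewrite (le_lt_trans (hausdorff_content_le s A d0))// ltey_eq fin//.
by rewrite addeC key.
Qed.

End hausdorff_outer_measure.

(** * Caratheodory's criterion for metric outer measures *)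

Section caratheodory_criterion.
Context {R : realType} {N : nat}.
Variables (s : nat) (f : 'rV[R]_N -> R).
Hypothesis f_lip : forall x y, f x - f y <= enorm (x - y).
Local Open Scope ereal_scope.
Notation H := (hausdorff s : set 'rV[R]_N -> \bar R).

Let level k : R := (k.+1%:R^-1)%R.

Let levelS k : (level k.+1 < level k)%R.
Proof. by rewrite ltf_pV2 ?posrE// ltr_nat. Qed.

Let separated (a b : R) (A B : set 'rV[R]_N) : (b < a)%R ->
  (forall x, A x -> (a <= f x)%R) -> (forall x, B x -> (f x <= b)%R) ->
  H A + H B <= H (A `|` B).
Proof.
move=> ba Aa Bb; apply: (@hausdorff_separated _ _ _ _ _ (a - b)); rewrite ?subr_gt0//.
move=> x y Ax By; apply: le_trans (f_lip x y).
by rewrite lerB// ?Aa// Bb.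
Qed.

(** The part [A n] of [X] where [f] is at least [level n] lies at a positive distance from [C], so
    [H] is superadditive on it and on the part of [X] inside [C]. The rest of [X] splits into layers
    of finite total measure, whose tails vanish in the limit. *)
Lemma caratheodory_lipschitz_sublevel :
  caratheodory_measurable H [set x | (f x <= 0)%R].
Proof.
set C := [set x | _].
suff key X : H (X `&` C) + H (X `&` ~` C) <= H X.
  exact: le_caratheodory_measurable.
have [->|Xfin] := eqVneq (H X) +oo; first by rewrite leey.
have {}Xfin : H X \is a fin_num by rewrite ge0_fin_numE ?ltey// hausdorff_ge0.
pose A n := X `&` [set x | (level n <= f x)%R].
pose D k := X `&` [set x | (level k.+2 <= f x < level k.+1)%R].
have AC n : H (X `&` C) + H (A n) <= H X.
  rewrite addeC; apply: le_trans (le_hausdorff s (_ : (A n `|` X `&` C) `<=` X)).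
    apply: (@separated (level n) 0%R); rewrite ?invr_gt0//.
    - by move=> x [].
    - by move=> x [].
  by move=> x [][].
(* [D k] and [D k.+2] lie at a positive distance from each other, so [H] is
   superadditive over the even layers and over the odd layers. *)
have alt e m : \sum_(k < m) H (D (k.*2 + e)%N) <= H (A (m.*2 + e)%N).
  elim: m => [|m IHm]; first by rewrite big_ord0 hausdorff_ge0.
  rewrite big_ord_recr/=; apply: (le_trans (leeD2r _ IHm)).
  rewrite doubleS !addSn.
  apply: (le_trans (separated (levelS (m.*2 + e)) _ _)).
  - by move=> x [].
  - by move=> x [_ /= /andP[_ /ltW]].
  apply: le_hausdorff => x [[Xx /= h]|[Xx /= /andP[h _]]]; split => //=.
  by apply: le_trans h; rewrite ltW// (lt_trans (levelS _)).
have Ale n : H (A n) <= H X by apply: le_hausdorff => x [].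
have Dsum m : \sum_(k < m.*2) H (D k) <= H X + H X.
  have -> : \sum_(k < m.*2) H (D k) =
      \sum_(k < m) H (D (k.*2 + 0)%N) + \sum_(k < m) H (D (k.*2 + 1)%N).
    elim: m => [|m IHm]; first by rewrite !big_ord0 adde0.
    rewrite doubleS !big_ord_recr/= IHm addn0 addn1 -!addeA; congr (_ + _).
    by rewrite addeCA.
  by apply: leeD; apply: le_trans (alt _ _) (Ale _).
have Dfin : \sum_(0 <= k <oo) H (D k) < +oo.
  apply: (@le_lt_trans _ _ (H X + H X)); last by rewrite ltey_eq fin_numD Xfin.
  apply: lime_le; first by apply: is_cvg_nneseries => *; exact: hausdorff_ge0.
  near=> m; rewrite big_mkord; apply: le_trans (Dsum m).
  apply: (lee_sum_nneg_ord (fun k => H (D k)) xpredT) => [i _|].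
    exact: hausdorff_ge0.
  by rewrite -addnn leq_addr.
have tail := nneseries_tail_cvg Dfin (fun k _ => hausdorff_ge0 s (D k)).
have XC n : H (X `&` ~` C) <= H (A n.+1) + \sum_(n <= k <oo) H (D k).
  have sub : X `&` ~` C `<=` A n.+1 `|` \bigcup_(k in ~` `I_n) D k.
    move=> x [Xx /= /negP]; rewrite -ltNge => fx.
    have [fn|fn] := leP (level n.+1) (f x); [by left|right].
    have ex : exists k, (level k <= f x)%R.
      exists (Num.truncn (f x)^-1).
      rewrite -[leRHS]invrK lef_pV2 ?posrE ?invr_gt0//.
      by rewrite ltW// truncnS_gt.
    case: (ex_minnP ex) => k kf kmin.
    (* [k] is the first index with [level k <= f x]. Once it exceeds [n.+1] it is at least 2, and
       [x] lies in the layer of index [k - 2], which is at least [n]. *)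
    have nk : (n.+1 < k)%N.
      rewrite ltnNge; apply/negP => kn; move: fn; rewrite ltNge => /negP; apply.
      by apply: le_trans kf; rewrite lef_pV2 ?posrE// ler_nat.
    case: k nk kf kmin => [//|[//|k]] nk kf kmin; exists k => /=.
      by apply/negP; rewrite -leqNgt.
    split => //=; rewrite kf ltNge; apply/negP => /kmin.
    by rewrite ltnn.
  apply: (le_trans (le_hausdorff s sub)).
  apply: (le_trans (outer_measureU2 _ _ _)); apply: leeD2l.
  exact: outer_measure_sigma_subadditive_tail.
have bound n : H (X `&` C) + H (X `&` ~` C) <= H X + \sum_(n <= k <oo) H (D k).
  apply: (le_trans (leeD2l _ (XC n))); rewrite addeA; apply: leeD2r; exact: AC.
have cv : (H X + \sum_(n <= k <oo) H (D k)) @[n --> \oo] --> H X + 0.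
  by apply: cvgeD => //; [exact: fin_num_adde_defr|exact: cvg_cst].
rewrite -[leRHS]adde0 -(cvg_lim _ cv)//; apply: lime_ge.
  by apply/cvg_ex; exists (H X + 0).
exact: nearW.
Unshelve. all: by end_near. Qed.

End caratheodory_criterion.

Section borel_surface_measure.
Context {R : realType} {N : nat}.
Local Open Scope ereal_scope.
Implicit Types (A B C D : set 'rV[R]_N) (s : nat).

(** A closed set is the sublevel at 0 of its distance function. The sup-norm distance is taken,
    which matches the topology and is 1-Lipschitz also for the larger Euclidean norm. *)
Lemma hausdorff_closed_caratheodory s C :
  closed C -> caratheodory_measurable (hausdorff s) C.
Proof.
move=> clC; have [->|/set0P[c0 Cc0]] := eqVneq C set0.
  exact: (caratheodory_measurable_set0 (hausdorff s)).
pose dist x := inf [set (`|x - c|)%R | c in C].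
have lbd x : has_lbound [set (`|x - c|)%R | c in C] by exists 0%R => _ [c _ <-].
have CE : C = [set x | (dist x <= 0)%R].
  apply/seteqP; split => x /= => [Cx|].
    by apply: ge_inf => //; exists x => //; rewrite subrr normr0.
  apply: contraPP => nCx; apply/negP; rewrite -ltNge.
  have := open_nbhs_nbhs (conj (closed_openC clC) nCx).
  move=> /nbhs_normP[e /= e0 eC].
  apply: (@lt_le_trans _ _ e) => //.
  apply: lb_le_inf; first by exists (`|x - c0|)%R; exists c0.
  move=> _ [c Cc <-]; rewrite leNgt; apply/negP => xc.
  by apply: (eC c).
rewrite CE; apply: caratheodory_lipschitz_sublevel => x y.
apply: le_trans (norm_le_enorm _).
rewrite lerBlDr -lerBlDl.
apply: lb_le_inf; first by exists (`|y - c0|)%R; exists c0.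
move=> _ [c Cc <-]; rewrite lerBlDl.
apply: (@le_trans _ _ `|x - c|%R); first by apply: ge_inf => //; exists c.
by rewrite (le_trans _ (ler_normD _ _))// addrA subrK.
Qed.

Lemma hausdorff_borel_caratheodory s (A : set (borel_rV R N)) :
  measurable A -> caratheodory_measurable (hausdorff s) A.
Proof.
apply: smallest_sub => [|U oU]; last first.
  rewrite -(setCK U).
  apply: (caratheodory_measurable_setC (mu := hausdorff s)).
  exact/hausdorff_closed_caratheodory/open_closedC.
exact: (@sigma_algebra_measurable _ (caratheodory_type (hausdorff s))).
Qed.

Lemma unit_ball_volume_gt0 n : (0 < unit_ball_volume R n)%R.
Proof.
suff [] : (0 < unit_ball_volume R n)%R /\ (0 < unit_ball_volume R n.+1)%R by [].
elim: n => [|n [IH1 IH2]]; first by [].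
by split => //=; rewrite mulr_gt0// divr_gt0// mulr_gt0// pi_gt0.
Qed.

Let c : R := (unit_ball_volume R N.-1 / 2 ^+ N.-1)%R.

Let c_gt0 : (0 < c)%R.
Proof. by rewrite divr_gt0 ?unit_ball_volume_gt0// exprn_gt0. Qed.

Let surface_measureE A : surface_measure A = c%:E * hausdorff N.-1 A.
Proof. by []. Qed.

Let sm : set (borel_rV R N) -> \bar R := @surface_measure R N.

Let surface_measure0 : sm set0 = 0.
Proof. by rewrite /sm surface_measureE hausdorff0 mule0. Qed.

Let surface_measure_ge0 A : 0 <= sm A.
Proof. by rewrite /sm surface_measureE mule_ge0 ?hausdorff_ge0// lee_fin ltW. Qed.

Let surface_measure_sigma_additive : semi_sigma_additive sm.
Proof.
move=> F mF tF mUF; rewrite /sm.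
rewrite (_ : (fun n => _) =
    (fun n => c%:E * \sum_(0 <= i < n) hausdorff N.-1 (F i))); last first.
  by apply/funext => n; rewrite ge0_sume_distrr// => *; exact: hausdorff_ge0.
apply: cvgeZl => //.
apply: (caratheodory_measure_sigma_additive (mu := hausdorff N.-1)) => //.
  by move=> i; exact: hausdorff_borel_caratheodory.
exact: hausdorff_borel_caratheodory.
Qed.

HB.instance Definition _ := isMeasure.Build _ (borel_rV R N) R
  (@surface_measure R N : set (borel_rV R N) -> \bar R)
  surface_measure0 surface_measure_ge0 surface_measure_sigma_additive.

Lemma hausdorff_weight_image s (g : 'rV[R]_N -> 'rV[R]_N) A :
  (forall x y, enorm (g x - g y) <= enorm (x - y))%R ->
  hausdorff_weight s (g @` A) <= hausdorff_weight s A /\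
  ediam (g @` A) <= ediam A.
Proof.
move=> g1; have dgA : ediam (g @` A) <= ediam A.
  apply: ge_ereal_sup => _ [[_ _] [[a Aa <-] [b Ab <-]] <-].
  apply: (@le_trans _ _ (enorm (a - b))%:E); first by rewrite lee_fin.
  by apply: ereal_sup_ubound; exists (a, b).
split => //; rewrite /hausdorff_weight.
have [->|/set0P[a Aa]] := eqVneq A set0; first by rewrite image_set0 eqxx.
have gA0 : g @` A !=set0 by exists (g a); exists a.
have dA0 := ediam_ge0 gA0; move/set0P/negbTE : gA0 => -> {Aa}.
exact: le_expe.
Qed.

Lemma hausdorff_image_le s (g : 'rV[R]_N -> 'rV[R]_N) A :
  (forall x y, enorm (g x - g y) <= enorm (x - y))%R ->
  hausdorff s (g @` A) <= hausdorff s A.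
Proof.
move=> g1; apply: ge_ereal_sup => _ [d d0 <-].
apply: le_trans (hausdorff_content_le s A d0).
apply: le_ereal_inf_tmp => _ [F [AF Fd] <-].
apply: (@le_trans _ _ (\sum_(0 <= k <oo) hausdorff_weight s (g @` F k))); last first.
  apply: lee_nneseries => [*|k _]; first exact: hausdorff_weight_ge0.
  by have [] := hausdorff_weight_image s (F k) g1.
apply: ereal_inf_lbound; exists (fun k => g @` F k) => //; split.
  by move=> _ [a Aa <-]; have [k _ Fka] := AF _ Aa; exists k => //; exists a.
move=> k; apply: le_trans (Fd k).
by have [] := hausdorff_weight_image s (F k) g1.
Qed.

(** Carrying the inverse makes each preimage under [g] an image under [g']; invariance of the
    measure then follows from the bound for images under nonexpansive maps, applied in both
    directions. *)
Definition isometry_inv (g g' : 'rV[R]_N -> 'rV[R]_N) :=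
  [/\ cancel g g', cancel g' g &
      forall x y, (enorm (g x - g y) = enorm (x - y))%R].

Lemma isometry_inv_continuous (g g' : 'rV[R]_N -> 'rV[R]_N) :
  isometry_inv g g' -> continuous g.
Proof.
move=> [_ _ g1] x; apply/(@cvgrPdist_lt _ _ _ _ (nbhs_filter x)) => e e0.
have : nbhs x [set y | `|x - y| < e / N.+1%:R]%R.
  have : (0 < e / N.+1%:R)%R by rewrite divr_gt0.
  by move/(nbhsx_ballx x); rewrite -ball_normE.
apply: (@filterS _ _ (nbhs_filter x)) => y /= xy.
apply: le_lt_trans (norm_le_enorm _) _; rewrite g1.
apply: le_lt_trans (enorm_le_sum _) _.
apply: (@le_lt_trans _ _ (\sum_(i < N) `|x - y|)%R).
  by apply: ler_sum => i _; exact: coord_le_norm.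
rewrite sumr_const card_ord -[ltLHS]mulr_natr.
apply: (@le_lt_trans _ _ (`|x - y| * N.+1%:R)%R).
  by rewrite ler_wpM2l// ler_nat.
by rewrite -ltr_pdivlMr.
Qed.

Lemma surface_measure_preimage (g g' : 'rV[R]_N -> 'rV[R]_N) A :
  isometry_inv g g' -> surface_measure (g @^-1` A) = surface_measure A.
Proof.
move=> [gK g'K g1]; congr (_ * _).
have g'1 x y : enorm (g' x - g' y) = enorm (x - y) by rewrite -g1 !g'K.
apply/eqP; rewrite eq_le; apply/andP; split.
  rewrite (_ : g @^-1` A = g' @` A); last first.
    apply/seteqP; split => x /=; first by move=> Agx; exists (g x).
    by move=> [y Ay <-]; rewrite g'K.
  by apply: hausdorff_image_le => x y; rewrite g'1.
rewrite [in leLHS](_ : A = g @` (g @^-1` A)); last first.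
  apply/seteqP; split => x /=; last by move=> [y Ay <-].
  by move=> Ax; exists (g' x); rewrite /= g'K.
by apply: hausdorff_image_le => x y; rewrite g1.
Qed.

Lemma continuous_borel_measurable (f : 'rV[R]_N -> R) :
  continuous f -> measurable_fun setT (f : borel_rV R N -> R).
Proof.
move=> /continuousP cf.
apply: (measurability _ (measurable_realfun.RGenOpens.measurableE R)).
move=> _ [_ [a [b ->]] <-]; rewrite setTI.
by apply: sub_sigma_algebra; apply: cf; apply: interval_open.
Qed.

Lemma continuous_borel_measurable_rV (g : 'rV[R]_N -> 'rV[R]_N) :
  continuous g -> measurable_fun setT (g : borel_rV R N -> borel_rV R N).
Proof.
move=> /continuousP cg.
apply: (@measurability _ _ (borel_rV R N) (borel_rV R N) setT g (@open 'rV[R]_N)) => // _ [U oU <-].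
by rewrite setTI; apply: sub_sigma_algebra; apply: cg.
Qed.

Lemma closed_borel_measurable C :
  closed C -> measurable (C : set (borel_rV R N)).
Proof.
move=> clC; rewrite -(setCK C); apply: measurableC.
by apply: sub_sigma_algebra; exact: closed_openC.
Qed.

End borel_surface_measure.

(** * The measure of spheres *)

Lemma hausdorff_content_fin_cover {R : realType} {N : nat} (I : finType) s (d : R)
    (A : set 'rV[R]_N) (F : I -> set 'rV[R]_N) :
  A `<=` \bigcup_i F i -> (forall i, (ediam (F i) <= d%:E)%E) ->
  (hausdorff_content s d A <= \sum_i hausdorff_weight s (F i))%E.
Proof.
move=> AF Fd.
pose G k := if insub k is Some k' then F (enum_val (k' : 'I_#|I|)) else set0.
apply: (@le_trans _ _ (\sum_(0 <= k <oo) hausdorff_weight s (G k))%E).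
  apply: ereal_inf_lbound; exists G => //; split.
    move=> x /AF[i _ Fix]; exists (enum_rank i) => //.
    by rewrite /G valK enum_rankK.
  move=> k; rewrite /G; case: insubP => [k' _ _|_]; first exact: Fd.
  apply: (@le_trans _ _ (-oo)%E); last exact: leNye.
  by apply: ge_ereal_sup => x [p [/= ? _] _].
rewrite (nneseries_split 0 #|I|); last by move=> *; exact: hausdorff_weight_ge0.
rewrite add0n big_mkord [X in (_ + X)%E]eseries0 ?adde0; last first.
  by move=> k Ik _; rewrite /G insubN -?leqNgt// hausdorff_weight0.
rewrite (reindex (@enum_val I predT))/=; last exact/onW_bij/enum_val_bij.
by apply: lee_sum => k _; rewrite /G valK.
Qed.

(** * Finite measure of spheres: a covering by Lipschitz graphs *)

Section sphere_hausdorff_lty.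
Context {R : realType}.
Variables (s : nat) (r : R).
Hypothesis r0 : 0 < r.
Notation n := (s.+1%:R : R).

(* On a cell, the coordinate [c.1.1] has a fixed sign and absolute value at least
   [r / s.+1], so that the sphere is there a Lipschitz graph over the remaining
   coordinates, which the cell localizes in a grid of mesh [r / m]. *)
Let cell m (c : 'I_s.+1 * bool * {ffun 'I_s -> 'I_(2 * m).+1}) : set 'rV[R]_s.+1 :=
  [set y | [/\ enorm y = r, r / n <= (-1) ^+ c.1.2 * y ord0 c.1.1 &
    forall j, Num.truncn ((y ord0 (lift c.1.1 j) + r) * m%:R / r) = c.2 j]].

Let coord_sphere (y : 'rV[R]_s.+1) i : enorm y = r -> `|y ord0 i| <= r.
Proof. by move=> <-; exact: coord_le_enorm. Qed.

Let sphere_sqr (y : 'rV[R]_s.+1) i : enorm y = r ->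
  y ord0 i ^+ 2 = r ^+ 2 - \sum_j y ord0 (lift i j) ^+ 2.
Proof.
by move=> <-; rewrite sqr_enorm (bigD1_ord i)//= addrK.
Qed.

Let cell_off m c y z j : (0 < m)%N -> @cell m c y -> @cell m c z ->
  `|y ord0 (lift c.1.1 j) - z ord0 (lift c.1.1 j)| <= r / m%:R.
Proof.
move=> m0 [yr _ /(_ j) yj] [zr _ /(_ j) zj].
have mR : 0 < m%:R :> R by rewrite ltr0n.
have pos (w : 'rV[R]_s.+1) : enorm w = r ->
    0 <= (w ord0 (lift c.1.1 j) + r) * m%:R / r.
  move=> /(coord_sphere (lift c.1.1 j)); rewrite ler_norml => /andP[+ _].
  by move=> wr; rewrite divr_ge0 ?mulr_ge0 ?(ltW r0)//; lra.
have /andP[y1 y2] := truncn_itv (pos _ yr).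
have /andP[z1 z2] := truncn_itv (pos _ zr).
rewrite yj in y1 y2; rewrite zj in z1 z2.
rewrite -(ler_pM2r (x := m%:R / r)) ?divr_gt0//.
rewrite [leRHS](_ : _ = 1); last by field; rewrite !gt_eqF.
rewrite -[X in _ * X]gtr0_norm ?divr_gt0// -normrM mulrBl.
have eqw (w : R) : w * (m%:R / r) = (w + r) * m%:R / r - m%:R.
  by field; rewrite gt_eqF.
rewrite !eqw ler_norml; move: y1 y2 z1 z2; rewrite -(natr1 (c.2 j)).
by move=> *; lra.
Qed.

(** On the sphere the squares of the main coordinates differ by a sum over the other [s]
    coordinates, each term being at most [r / m * (2 * r)]. The common sign bounds the sum of the
    two main coordinates below by [2 * (r / n)] in absolute value, and the difference of squares is
    divided by it. *)
Let cell_main m c y z : (0 < m)%N -> @cell m c y -> @cell m c z ->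
  `|y ord0 c.1.1 - z ord0 c.1.1| <= n * s%:R * r / m%:R.
Proof.
move=> m0 cy cz; have [yr yi _] := cy; have [zr zi _] := cz.
have mR : 0 < m%:R :> R by rewrite ltr0n.
set i := c.1.1 in yi zi *.
have rn0 : 0 < r / n by rewrite divr_gt0.
have sum_ge : 2 * (r / n) <= `|y ord0 i + z ord0 i|.
  apply: (@le_trans _ _ ((-1) ^+ c.1.2 * (y ord0 i + z ord0 i))).
    by rewrite mulrDr mulr2n mulrDl mul1r lerD.
  by apply: le_trans (ler_norm _) _; rewrite normrM normrX normrN1 expr1n mul1r.
have prod_le : `|y ord0 i - z ord0 i| * `|y ord0 i + z ord0 i| <=
    s%:R * (r / m%:R * (2 * r)).
  rewrite -normrM -subr_sqr (sphere_sqr _ yr) (sphere_sqr _ zr).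
  rewrite opprB addrC addrA subrK -sumrB.
  apply: le_trans (ler_norm_sum _ _ _) _.
  rewrite -[X in X%:R](card_ord s) mulr_natl -sumr_const.
  apply: ler_sum => j _; rewrite subr_sqr normrM ler_pM//.
    by rewrite distrC; exact: cell_off.
  rewrite mulrDl mul1r; apply: le_trans (ler_normD _ _) _.
  by rewrite lerD// coord_sphere.
rewrite -(ler_pM2r (x := 2 * (r / n))) ?mulr_gt0//.
apply: le_trans (ler_wpM2l _ sum_ge) _ => //.
apply: le_trans prod_le _.
by rewrite le_eqVlt; apply/orP; left; apply/eqP; field; rewrite !gt_eqF.
Qed.

(** In units of [1 / m]: [n * s * r] for the main coordinate and [r] for each of the [s] others. *)
Let K : R := s%:R * (n + 1) * r.

Let cell_ediam m c : (0 < m)%N -> (ediam (@cell m c) <= (K / m%:R)%:E)%E.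
Proof.
move=> m0; apply: ge_ereal_sup => _ [[y z] [/= cy cz] <-].
rewrite lee_fin; apply: le_trans (enorm_le_sum _) _.
rewrite (bigD1_ord c.1.1)//=.
apply: (@le_trans _ _ (n * s%:R * r / m%:R + s%:R * (r / m%:R))).
  rewrite lerD//; first by rewrite !mxE cell_main.
  rewrite -[X in X%:R](card_ord s) mulr_natl -sumr_const.
  by apply: ler_sum => j _; rewrite !mxE cell_off.
by rewrite le_eqVlt; apply/orP; left; apply/eqP; rewrite /K; ring.
Qed.

Let cell_cover m : (0 < m)%N -> sphere 0 r `<=` \bigcup_c @cell m c.
Proof.
move=> m0 y; rewrite /sphere/= subr0 => yr.
have mR : 0 < m%:R :> R by rewrite ltr0n.
have n0 : 0 < n by rewrite ltr0n.
have [i yi] : exists i, r / n <= `|y ord0 i|.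
  apply: contrapT => /forallNP ny.
  have : r ^+ 2 < r ^+ 2.
    rewrite -{1}yr sqr_enorm.
    apply: (@lt_le_trans _ _ (\sum_(i < s.+1) (r / n) ^+ 2)).
      apply: ltr_sum => [|i _]; first by apply/hasP; exists ord0; rewrite ?mem_index_enum.
      rewrite -real_normK ?num_real// ltrXn2r//.
      by rewrite ltNge; exact/negP.
    rewrite sumr_const card_ord -[leLHS]mulr_natl.
    rewrite [leLHS](_ : _ = r ^+ 2 * n^-1); last by field; rewrite gt_eqF.
    by rewrite ler_piMr ?sqr_ge0// invf_le1// ler1n.
  by rewrite ltxx.
pose g := [ffun j : 'I_s => inord (Num.truncn ((y ord0 (lift i j) + r) * m%:R / r))
  : 'I_(2 * m).+1].
exists (i, y ord0 i < 0, g) => //; split => //=.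
  rewrite mulr_sign; case: ifPn => yi0; first by rewrite -ltr0_norm.
  by rewrite -(@ger0_norm _ (y _ _))// leNgt.
move=> j; rewrite ffunE inordK// ltnS truncn_le_nat.
have := coord_sphere (lift i j) yr; rewrite ler_norml => /andP[_ yj].
apply: (@le_lt_trans _ _ (2 * m)%:R); last by rewrite ltr_nat.
rewrite ler_pdivrMr// natrM -mulrA [_ * r]mulrC mulrA ler_pM2r//.
by rewrite mulrDl mul1r lerD2r.
Qed.

(** The number of cells grows like [m ^ s], while each weighs at most [(K / m) ^ s]. Since
    [(2 * m + 1) * (K / m) <= 3 * K], the total is bounded independently of the mesh. *)
Lemma sphere_hausdorff_lty : (hausdorff s (sphere (0 : 'rV[R]_s.+1) r) < +oo)%E.
Proof.
apply: (@le_lt_trans _ _ (2 * n * (3 * K) ^+ s)%:E); last by rewrite ltry.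
apply: ge_ereal_sup => _ [d /= d0 <-].
have K0 : 0 <= K by rewrite !mulr_ge0 ?addr_ge0// ltW.
pose m := (Num.truncn (K / d)).+1.
have mR : 0 < m%:R :> R by rewrite ltr0n.
have Kmd : K / m%:R <= d.
  by rewrite ler_pdivrMr// mulrC -ler_pdivrMr// ltW// truncnS_gt.
have cov := @cell_cover m isT.
apply: (le_trans (hausdorff_content_fin_cover s cov (d := d) _)).
  by move=> c; rewrite (le_trans (cell_ediam _ _))// lee_fin.
apply: (@le_trans _ _ (\sum_(c : 'I_s.+1 * bool * {ffun 'I_s -> 'I_(2 * m).+1})
    ((K / m%:R) ^+ s)%:E)%E).
  apply: lee_sum => c _; rewrite /hausdorff_weight; case: ifPn => [_|/set0P c0].
    by rewrite lee_fin exprn_ge0// divr_ge0.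
  by rewrite EFin_expe le_expe ?ediam_ge0// cell_ediam.
rewrite sumEFin lee_fin sumr_const !card_prod card_ffun !card_ord card_bool.
rewrite -[leLHS]mulr_natl.
have -> : ((s.+1 * 2 * (2 * m).+1 ^ s)%:R * (K / m%:R) ^+ s =
    2 * n * ((2 * m).+1%:R * (K / m%:R)) ^+ s :> R).
  by rewrite !natrM natrX [in RHS]exprMn [in RHS]mulrA [2 * _]mulrC.
have Km0 : 0 <= (2 * m).+1%:R * (K / m%:R).
  by apply: mulr_ge0 => //; exact: divr_ge0.
have K30 : 0 <= 3 * K by exact: mulr_ge0.
rewrite ler_wpM2l// lerXn2r// ?nnegrE// {Km0 K30}.
rewrite mulrCA [leRHS]mulrC ler_wpM2l// ler_pdivrMr// -natr1 natrM.
have : 1 <= m%:R :> R by rewrite ler1n.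
lra.
Qed.

End sphere_hausdorff_lty.

Lemma cvg_sumr {R : realType} {T : Type} (F : set_system T) {FF : Filter F}
    (I : Type) (r : seq I) (f : I -> T -> R) (l : I -> R) :
  (forall i, f i x @[x --> F] --> l i) ->
  \sum_(i <- r) f i x @[x --> F] --> \sum_(i <- r) l i.
Proof.
move=> fl; elim: r => [|i r IHr].
  by rewrite big_nil; under eq_fun do rewrite big_nil; exact: cvg_cst.
by rewrite big_cons; under eq_fun do rewrite big_cons; exact: cvgD.
Qed.

Lemma cvg_exprn {R : realType} {T : Type} (F : set_system T) {FF : Filter F}
    (f : T -> R) (l : R) n :
  f x @[x --> F] --> l -> f x ^+ n @[x --> F] --> l ^+ n.
Proof. by move=> fl; exact: (cvg_comp _ _ fl (@exprn_continuous R n _)). Qed.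

(** Subtracting from each coordinate its minimum over [E] embeds [E] into a box with [q.+1] values
    per coordinate. The minima may be attained at different members of [E]. *)
Lemma card_box_le (s m q : nat) (E : {set {ffun 'I_s -> 'I_m}}) :
  (forall z z', z \in E -> z' \in E -> forall j, z j <= z' j + q)%N ->
  (#|E| <= q.+1 ^ s)%N.
Proof.
have [->|[z0 z0E]] := set_0Vmem E; first by rewrite cards0.
move=> Eq.
pose lo j := [arg min_(z < z0 in E) z j].
have loE j : lo j \in E by rewrite /lo; case: arg_minnP.
have lo_le j z : z \in E -> (lo j j <= z j)%N.
  by rewrite /lo; case: arg_minnP => // w _ + zE; exact.
pose h (z : {ffun 'I_s -> 'I_m}) := [ffun j : 'I_s => inord (z j - lo j j) : 'I_q.+1].
have hinj : {in E &, injective h}.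
  move=> z z' zE z'E /ffunP hzz'; apply/ffunP => j; apply: val_inj.
  have /(congr1 val) := hzz' j; rewrite !ffunE /= !inordK ?ltnS ?leq_subLR ?Eq//.
  by move/eqP; rewrite eqn_sub2rE ?lo_le// => /eqP.
rewrite -(card_in_imset hinj) (leq_trans (max_card _))//.
by rewrite card_ffun !card_ord.
Qed.

Lemma compact_cover_nat {T : ptopologicalType} (K : set T) (U : nat -> set T) :
  compact K -> (forall k, open (U k)) -> K `<=` \bigcup_k U k ->
  exists n, K `<=` \bigcup_(k < n) U k.
Proof.
rewrite compact_cover => cK oU KU.
have [D _ KD] := cK nat setT U (fun k _ => oU k) KU.
exists (\max_(k <- finmap.enum_fset D) k).+1 => x /KD[k kD Ukx]; exists k => //=.
by rewrite ltnS leq_bigmax_seq.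
Qed.

Lemma coord_cvg {R : realType} {N : nat} (x : 'rV[R]_N) j :
  y ord0 j @[y --> x] --> x ord0 j.
Proof. exact: coord_continuous. Qed.

Lemma sphere_closed {R : realType} {N : nat} (x : 'rV[R]_N) (r : R) :
  closed (sphere x r).
Proof.
have cS : continuous (fun y : 'rV[R]_N => \sum_(i < N) (y - x) ord0 i ^+ 2).
  move=> y; apply: (cvg_sumr (FF := nbhs_filter y)) => i; apply: cvg_exprn.
  rewrite !mxE; under eq_fun do rewrite !mxE.
  by apply: cvgB; [exact: coord_cvg|exact: cvg_cst].
have -> : sphere x r = (fun y => enorm (y - x)) @^-1` [set r] by [].
apply: closed_comp; last exact: closed_eq.
move=> y _; exact: (cvg_comp _ _ (cS y) (@sqrt_continuous R _)).
Qed.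

Lemma sphere_compact {R : realType} {N : nat} (x : 'rV[R]_N) (r : R) :
  compact (sphere x r).
Proof.
apply: bounded_closed_compact; last exact: sphere_closed.
exists (r + `|x|); split; first exact: num_real.
move=> M rM y /= yr; apply: le_trans (ltW rM).
rewrite -[y in leLHS](subrK x); apply: le_trans (ler_normD _ _) _.
by rewrite lerD2r -yr norm_le_enorm.
Qed.

(** * Positive measure of spheres: counting grid points in a cover *)

Section sphere_hausdorff_gt0.
Context {R : realType}.
Variables (s : nat) (r : R).
Hypothesis r0 : 0 < r.

Variable a : R.
Hypothesis aE : a = r / s.+1%:R.
Let a0 : 0 < a. Proof. by rewrite aE divr_gt0. Qed.

(* The point of the sphere above the node [z] of a grid of mesh [a / m] in the cube
   [[0, a]^s]. A set of diameter [D] contains at most about [(D * m / a) ^ s] of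
   these [m ^ s] points, which bounds the weight of any cover from below. *)
Let pt m (z : {ffun 'I_s -> 'I_m}) : 'rV[R]_s.+1 :=
  \row_j if unlift ord_max j is Some j' then a * (z j')%:R / m%:R
         else Num.sqrt (r ^+ 2 - \sum_j' (a * (z j')%:R / m%:R) ^+ 2).

Let pt_lift m z j : @pt m z ord0 (lift ord_max j) = a * (z j)%:R / m%:R.
Proof. by rewrite mxE liftK. Qed.

(** The choice of [a] gives [s * a ^ 2 <= r ^ 2], so the square root in the last coordinate has a
    nonnegative argument. *)
Let pt_sphere m z : sphere 0 r (@pt m z).
Proof.
rewrite /sphere /= subr0; apply/eqP.
rewrite -(eqrXn2 (n := 2))// ?enorm_ge0 ?(ltW r0)//.
rewrite sqr_enorm (bigD1_ord ord_max)//=.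
rewrite mxE unlift_none sqr_sqrtr; last first.
  rewrite subr_ge0; apply: (@le_trans _ _ (\sum_(j < s) a ^+ 2)).
    apply: ler_sum => j _; rewrite lerXn2r ?nnegrE ?(ltW a0)//.
      by rewrite divr_ge0 ?mulr_ge0 ?(ltW a0).
    have m0 : (0 < m)%N by case: (m) (z j) => [[]|].
    by rewrite ler_pdivrMr ?ltr0n// ler_wpM2l ?(ltW a0)// ler_nat ltnW.
  rewrite sumr_const card_ord -[leLHS]mulr_natl aE.
  rewrite [leLHS](_ : _ = r ^+ 2 * (s%:R / s.+1%:R ^+ 2)); last first.
    by field; rewrite nat1r gt_eqF.
  rewrite ler_piMr ?sqr_ge0// ler_pdivrMr ?exprn_gt0// mul1r -natrX ler_nat.
  by rewrite expnS (leq_trans (leqnSn s))// leq_pmulr.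
under eq_bigr do rewrite pt_lift.
by rewrite subrK.
Qed.

Variables (F : nat -> set 'rV[R]_s.+1) (d e : R).
Hypothesis Fd : forall k, (ediam (F k) <= d%:E)%E.
Hypothesis FS : sphere 0 r `<=` \bigcup_k F k.
Hypothesis e0 : 0 < e.

Let diam k : R := fine (ediam (F k)).

Let diamE k : F k !=set0 -> ediam (F k) = (diam k)%:E.
Proof.
move=> F0; rewrite /diam fineK// ge0_fin_numE ?ediam_ge0//.
by rewrite (le_lt_trans (Fd k))// ltry.
Qed.

(** Room for [2 * t], when the set is fattened to an open one by balls of radius [t], and for one
    more [t], when a length is rounded up to the mesh. The costs [e / 2 ^ (k + 1)] sum to [e]. *)
Let slack k : exists2 t : R, 0 < t &
  (diam k + 3 * t) ^+ s <= diam k ^+ s + e / (2 ^ k.+1)%:R.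
Proof.
have e'0 : 0 < e / (2 ^ k.+1)%:R by rewrite divr_gt0// ltr0n expn_gt0.
have : (diam k + 3 * t) ^+ s @[t --> (0 : R)^'+] --> (diam k + 3 * 0) ^+ s.
  apply: cvg_exprn; apply: cvgD; first exact: cvg_cst.
  by apply: cvgM; [exact: cvg_cst|exact: (@cvg_within_filter _ _ id)].
rewrite mulr0 addr0 => cv.
near (0 : R)^'+ => t; exists t => //.
rewrite -lerBlDl; apply/ltW; rewrite ltrBlDl; near: t.
by apply: (cvgr_lt _ cv); rewrite ltrDl.
Unshelve. all: by end_near. Qed.

Let t k : R := sval (cid2 (slack k)).
Let t0 k : 0 < t k. Proof. by rewrite /t; case: cid2. Qed.
Let tP k : (diam k + 3 * t k) ^+ s <= diam k ^+ s + e / (2 ^ k.+1)%:R.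
Proof. by rewrite /t; case: cid2. Qed.

Let U k : set 'rV[R]_s.+1 := \bigcup_(f in F k) ball f (t k).

Let U_open k : open (U k).
Proof. by apply: bigcup_open => f _; exact: ball_open. Qed.

Let U_diam k x y j : U k x -> U k y -> x ord0 j - y ord0 j <= diam k + 2 * t k.
Proof.
move=> [f Ff]; rewrite -ball_normE /= => fx [g Fg]; rewrite -ball_normE /= => gy.
have h1 : `|(f - x) ord0 j| < t k := le_lt_trans (coord_le_norm _ j) fx.
have h2 : `|(g - y) ord0 j| < t k := le_lt_trans (coord_le_norm _ j) gy.
have h3 : `|(f - g) ord0 j| <= diam k.
  apply: le_trans (coord_le_enorm _ j) _.
  rewrite -lee_fin -diamE; last by exists f.
  by apply: ereal_sup_ubound; exists (f, g).
move: h1 h2 h3; rewrite !mxE !ltr_norml !ler_norml.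
move=> /andP[? ?] /andP[? ?] /andP[? ?]; lra.
Qed.

Let E m k : {set {ffun 'I_s -> 'I_m}} := [set z | `[< U k (pt z) >]].

Let card_E m k : (0 < m)%N -> a <= t k * m%:R -> F k !=set0 ->
  #|E m k|%:R <= ((diam k + 3 * t k) * (m%:R / a)) ^+ s :> R.
Proof.
move=> m0 am F0; have mR : 0 < m%:R :> R by rewrite ltr0n.
have d0 : 0 <= diam k by rewrite fine_ge0// ediam_ge0.
have dt0 : 0 <= (diam k + 2 * t k) * (m%:R / a).
  by rewrite mulr_ge0 ?addr_ge0 ?mulr_ge0 ?invr_ge0 ?(ltW (t0 k)) ?(ltW a0).
pose q := Num.truncn ((diam k + 2 * t k) * (m%:R / a)).
have /card_box_le : forall z z', z \in E m k -> z' \in E m k ->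
    forall j, (z j <= z' j + q)%N.
  move=> z z'; rewrite !inE => /asboolP/asboolP Uz /asboolP/asboolP Uz' j.
  rewrite -leq_subLR truncn_ge_nat//.
  have [zz'|zz'] := leqP (z j) (z' j); first by rewrite (eqP zz').
  rewrite natrB ?(ltnW zz')//.
  have := U_diam (lift ord_max j) Uz Uz'; rewrite !pt_lift -mulrBl -mulrBr.
  rewrite -(ler_pM2r (x := m%:R / a)) ?divr_gt0//; apply: le_trans.
  by rewrite le_eqVlt; apply/orP; left; apply/eqP; field; rewrite !gt_eqF.
rewrite -(ler_nat R) => /le_trans; apply; rewrite natrX.
rewrite lerXn2r ?nnegrE//; first by rewrite mulr_ge0 ?addr_ge0 ?mulr_ge0 ?invr_ge0 ?(ltW (t0 k)) ?(ltW a0).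
have /andP[q1 _] := truncn_itv dt0.
rewrite -natr1; apply: (@le_trans _ _ ((diam k + 2 * t k) * (m%:R / a) + t k * m%:R / a)).
  by rewrite lerD// ler_pdivlMr// mul1r.
by rewrite le_eqVlt; apply/orP; left; apply/eqP; field; rewrite !gt_eqF.
Qed.

(** Compactness of the sphere leaves finitely many of the open sets [U k], so that one mesh [a / m]
    is below all their slacks [t k]. Counting the [m ^ s] points set by set and dividing by
    [(m / a) ^ s] bounds the weights from below. *)
Lemma cover_ge : ((a ^+ s)%:E <= \sum_(0 <= k <oo) hausdorff_weight s (F k) + e%:E)%E.
Proof.
have [n Sn] : exists n, sphere 0 r `<=` \bigcup_(k < n) U k.
  apply: (compact_cover_nat (@sphere_compact R s.+1 0 r) U_open) => x /FS[k _ Fx].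
  by exists k => //; exists x => //; exact: ballxx.
pose m := (\max_(k < n) Num.truncn (a / t k)).+1.
have am (k : 'I_n) : a <= t k * m%:R.
  rewrite mulrC -ler_pdivrMr//; apply/ltW; apply: lt_le_trans (truncnS_gt _) _.
  by rewrite ler_nat ltnS (leq_bigmax k).
have mR : 0 < m%:R :> R by rewrite ltr0n.
pose w k : R := if `[< F k !=set0 >] then (diam k + 3 * t k) ^+ s else 0.
have wE k : ((w k)%:E <= hausdorff_weight s (F k) + (e / (2 ^ k.+1)%:R)%:E)%E.
  rewrite /w; case: asboolP => F0; last first.
    by rewrite adde_ge0 ?hausdorff_weight_ge0// lee_fin divr_ge0// ltW.
  rewrite /hausdorff_weight; move/set0P/negbTE : (F0) => ->.
  by rewrite diamE// -EFin_expe -EFinD lee_fin tP.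
have cardw (k : 'I_n) : #|E m k|%:R <= w k * (m%:R / a) ^+ s.
  rewrite /w; case: asboolP => F0; first by rewrite -exprMn card_E.
  rewrite mul0r (_ : E m k = finset.set0) ?cards0//.
  apply/setP => z; rewrite !inE; apply/negbTE/asboolP => -[f Ff _].
  by apply: F0; exists f.
have count : m%:R ^+ s <= \sum_(k < n) #|E m k|%:R :> R.
  rewrite -natr_sum -natrX ler_nat -[m in leqLHS]card_ord -[s in leqLHS]card_ord -card_ffun.
  have -> : (\sum_(k < n) #|E m k| = \sum_z \sum_(k < n) (z \in E m k))%N.
    rewrite exchange_big; apply: eq_bigr => k _.
    by rewrite -sum1_card big_mkcond; apply: eq_bigr => z _; case: (z \in _).
  rewrite -sum1_card; apply: leq_sum => z _.
  have [k kn Uk] := Sn _ (pt_sphere z).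
  rewrite (bigD1 (Ordinal kn))//= inE asboolT//.
have : (a ^+ s <= \sum_(k < n) w k)%R.
  rewrite -(ler_pM2r (x := (m%:R / a) ^+ s)) ?exprn_gt0 ?divr_gt0//.
  rewrite -exprMn mulrC divfK ?gt_eqF// (le_trans count)// mulr_suml.
  by apply: ler_sum => k _; exact: cardw.
rewrite -lee_fin => /le_trans; apply.
rewrite (le_trans _ (epsilon_trick _ _ (ltW e0)))//; last first.
  by move=> *; exact: hausdorff_weight_ge0.
rewrite (le_trans _ (nneseries_lim_ge n _))//; last first.
  by move=> *; rewrite adde_ge0 ?hausdorff_weight_ge0// lee_fin divr_ge0// ltW.
rewrite big_mkord -sumEFin; apply: lee_sum => k _; exact: wE.
Qed.

End sphere_hausdorff_gt0.

Lemma sphere_hausdorff_gt0 {R : realType} (s : nat) (r : R) : 0 < r ->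
  (0 < hausdorff s (sphere (0 : 'rV[R]_s.+1) r))%E.
Proof.
move=> r0; apply: (@lt_le_trans _ _ ((r / s.+1%:R) ^+ s)%:E).
  by rewrite lte_fin exprn_gt0// divr_gt0.
apply: le_trans (hausdorff_content_le s _ ltr01).
apply: le_ereal_inf_tmp => _ [F [FS Fd] <-].
apply/lee_addgt0Pr => e e0; exact: (cover_ge r0 erefl Fd FS e0).
Qed.

(** * Spherical means *)

Section sphere_mean.
Context {R : realType} {N : nat}.
Implicit Types (f : 'rV[R]_N -> R) (x : 'rV[R]_N) (r : R).
Notation mu := (@surface_measure R N : set (borel_rV R N) -> \bar R).

Lemma surface_measure_sphere x r : (0 < N)%N -> 0 < r ->
  (0 < surface_measure (sphere x r) < +oo)%E.
Proof.
move=> N0 r0; have -> : sphere x r = (fun y => y - x) @^-1` sphere 0 r.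
  by apply/seteqP; split => y; rewrite /sphere /= subr0.
have /surface_measure_preimage -> :
    isometry_inv (fun y : 'rV[R]_N => y - x) (fun y => y + x).
  by split=> [y|y|y z]; rewrite ?subrK ?addrK// opprB addrA subrK.
have c0 : 0 < unit_ball_volume R N.-1 / 2 ^+ N.-1.
  by rewrite divr_gt0 ?unit_ball_volume_gt0// exprn_gt0.
case: N N0 c0 => [//|s] _ c0; rewrite /surface_measure.
rewrite mule_gt0 ?lte_fin ?sphere_hausdorff_gt0//=.
by rewrite lte_mul_pinfty ?lee_fin ?(ltW c0)// sphere_hausdorff_lty.
Qed.

Lemma sphere_borel_measurable x r : measurable (sphere x r : set (borel_rV R N)).
Proof. by apply: closed_borel_measurable; exact: sphere_closed. Qed.

Hypothesis N0 : (0 < N)%N.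

Lemma sphere_integrable x r f : 0 < r -> continuous f ->
  mu.-integrable (sphere x r) (EFin \o f).
Proof.
move=> r0 cf; have /andP[_ fin] := surface_measure_sphere x N0 r0.
apply: (measurable_bounded_integrable (sphere_borel_measurable x r) fin).
  by apply: measurable_funTS; exact: continuous_borel_measurable.
have : bounded_set (f @` sphere x r).
  apply: compact_bounded; apply: continuous_compact; last exact: sphere_compact.
  exact: continuous_subspaceT.
move=> [M [Mr Mf]]; exists M; split => // K MK y Sy.
by apply: (Mf _ MK); exists y.
Qed.

Let area_neq0 x r : 0 < r -> fine (surface_measure (sphere x r)) != 0.
Proof.
move=> r0; have /andP[? ?] := surface_measure_sphere x N0 r0.
by rewrite gt_eqF// fine_gt0//; apply/andP.
Qed.

Lemma sphere_mean_linear a f g x r : 0 < r -> continuous f -> continuous g ->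
  sphere_mean (fun y => a * f y + g y) x r = a * sphere_mean f x r + sphere_mean g x r.
Proof.
move=> r0 cf cg; have mS := sphere_borel_measurable x r.
have caf : continuous (fun y => a * f y).
  by move=> y; apply: (cvgM (FF := nbhs_filter y)); [exact: cvg_cst|exact: cf].
have := @RintegralD _ _ _ mu _ (fun y => a * f y) g mS
  (sphere_integrable x r0 caf) (sphere_integrable x r0 cg).
rewrite (@RintegralZl _ _ _ mu _ f a mS (sphere_integrable x r0 cf)).
by rewrite /Rintegral /sphere_mean => ->; rewrite mulrDl mulrA.
Qed.

Lemma sphere_mean_cst a x r : 0 < r -> sphere_mean (fun=> a) x r = a.
Proof.
move=> r0; rewrite /sphere_mean.
rewrite (@integral_cst _ _ _ mu _ (sphere_borel_measurable x r) a%:E).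
rewrite fineM// ?mulfK ?area_neq0//.
have /andP[? ?] := surface_measure_sphere x N0 r0.
by rewrite ge0_fin_numE// ltW.
Qed.

Lemma le_sphere_mean f g x r : 0 < r -> continuous f -> continuous g ->
  (forall y, sphere x r y -> f y <= g y) -> sphere_mean f x r <= sphere_mean g x r.
Proof.
move=> r0 cf cg fg; rewrite ler_pM2r; last first.
  have /andP[? ?] := surface_measure_sphere x N0 r0.
  by rewrite invr_gt0 fine_gt0//; apply/andP.
exact: (@le_Rintegral _ _ _ mu _ f g (sphere_borel_measurable x r)
  (sphere_integrable x r0 cf) (sphere_integrable x r0 cg)).
Qed.

(** The surface measure is its own pushforward under an isometry, so this is a change of
    variables. *)
Lemma sphere_mean_isometry (g g' : 'rV[R]_N -> 'rV[R]_N) f x x' r : 0 < r ->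
  isometry_inv g g' -> g @^-1` sphere x r = sphere x' r -> continuous f ->
  sphere_mean f x r = sphere_mean (f \o g) x' r.
Proof.
move=> r0 gg' gS cf; have cg := isometry_inv_continuous gg'.
rewrite /sphere_mean -gS (surface_measure_preimage _ gg'); congr (fine _ / _).
have pushE : pushforward mu (g : borel_rV R N -> borel_rV R N) = mu.
  by apply/funext => A; exact: surface_measure_preimage gg'.
rewrite -[in LHS]pushE (integral_pushforward (continuous_borel_measurable_rV cg))//.
- by apply/measurable_realfun.measurable_EFinP; exact: continuous_borel_measurable.
- rewrite gS; apply: (@sphere_integrable x' r (f \o g)) => // y.
  by apply: continuous_comp; [exact: cg|exact: cf].
- exact: sphere_borel_measurable.
Qed.

Lemma sphere_mean_shift f x r : 0 < r -> continuous f ->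
  sphere_mean f x r = sphere_mean (fun y => f (x + y)) 0 r.
Proof.
move=> r0 cf; apply: (@sphere_mean_isometry (fun y => x + y) (fun y => y - x)) => //.
  split=> [y|y|y z]; first by rewrite addrAC subrr add0r.
    by rewrite addrC subrK.
  by rewrite opprD addrACA subrr add0r.
by apply/seteqP; split => y; rewrite /sphere /= subr0 addrAC subrr add0r.
Qed.

Definition reflect_coord k (y : 'rV[R]_N) : 'rV[R]_N :=
  \row_j ((-1) ^+ (j == k) * y ord0 j).

Lemma reflect_coordK k : involutive (reflect_coord k).
Proof. by move=> y; apply/rowP => j; rewrite !mxE mulrA -expr2 sqrr_sign mul1r. Qed.

Lemma reflect_coord_isometry k : isometry_inv (reflect_coord k) (reflect_coord k).
Proof.
split=> [||y z]; [exact: reflect_coordK..|congr Num.sqrt; apply: eq_bigr => j _].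
by rewrite !mxE -mulrBr exprMn sqrr_sign mul1r.
Qed.

Lemma sphere_mean_reflect k f r : 0 < r -> continuous f ->
  sphere_mean f 0 r = sphere_mean (fun y => f (reflect_coord k y)) 0 r.
Proof.
move=> r0; apply: (sphere_mean_isometry r0 (reflect_coord_isometry k)).
have [_ _ iso] := reflect_coord_isometry k.
have R0 : reflect_coord k 0 = 0 by apply/rowP => j; rewrite !mxE mulr0.
by apply/seteqP; split => y; have := iso y 0; rewrite /sphere /= R0 !subr0 => ->.
Qed.

Lemma sphere_mean_swap i j f r : 0 < r -> continuous f ->
  sphere_mean f 0 r =
  sphere_mean (fun y => f (\row_k y ord0 (tperm i j k))) 0 r.
Proof.
pose g (y : 'rV[R]_N) : 'rV[R]_N := \row_k y ord0 (tperm i j k).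
have gK : cancel g g by move=> y; apply/rowP => k; rewrite !mxE tpermK.
have iso y z : enorm (g y - g z) = enorm (y - z).
  congr Num.sqrt; rewrite [RHS](reindex_inj (@perm_inj _ (tperm i j))).
  by apply: eq_bigr => k _; rewrite !mxE.
move=> r0; apply: (sphere_mean_isometry (g' := g)) => //.
have g0 : g 0 = 0 by apply/rowP => k; rewrite !mxE.
by apply/seteqP; split => y; have := iso y 0; rewrite /sphere /= g0 !subr0 => ->.
Qed.

Lemma sphere_mean_sum (I : Type) (s : seq I) (F : I -> 'rV[R]_N -> R) r : 0 < r ->
  (forall i, continuous (F i)) ->
  sphere_mean (fun y => \sum_(i <- s) F i y) 0 r = \sum_(i <- s) sphere_mean (F i) 0 r.
Proof.
move=> r0 cF; elim: s => [|i s IHs].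
  by rewrite big_nil -[RHS](sphere_mean_cst 0 0 r0); congr sphere_mean; apply/funext => y; rewrite big_nil.
have cS : continuous (fun y => \sum_(i <- s) F i y).
  by move=> y; apply: (cvg_sumr (FF := nbhs_filter y)) => k; exact: cF.
rewrite big_cons -IHs -[X in X + _]mul1r -sphere_mean_linear//.
by congr sphere_mean; apply/funext => y; rewrite big_cons mul1r.
Qed.

(** Swapping coordinates makes the [N] second moments equal, and the squares sum to the constant
    [r ^ 2] on the sphere. *)
Lemma sphere_mean_sqr_coord (i : 'I_N) r : 0 < r ->
  sphere_mean (fun y => y ord0 i ^+ 2) 0 r = r ^+ 2 / N%:R.
Proof.
have csq k : continuous (fun y : 'rV[R]_N => y ord0 k ^+ 2).
  by move=> y; apply: (cvg_exprn (FF := nbhs_filter y)); exact: coord_cvg.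
move=> r0; apply: (@mulIf _ N%:R); rewrite ?pnatr_eq0 -?lt0n//.
rewrite divfK ?pnatr_eq0 -?lt0n//.
transitivity (sphere_mean (fun y => \sum_(k < N) y ord0 k ^+ 2) 0 r).
  rewrite sphere_mean_sum// (eq_bigr (fun=> sphere_mean (fun y => y ord0 i ^+ 2) 0 r)).
    by rewrite sumr_const card_ord mulr_natr.
  move=> k _; rewrite (sphere_mean_swap i k)//.
  by congr sphere_mean; apply/funext => y; rewrite mxE tpermR.
rewrite -[RHS](sphere_mean_cst _ 0 r0); apply/eqP; rewrite eq_le.
have cS : continuous (fun y : 'rV[R]_N => \sum_(k < N) y ord0 k ^+ 2).
  by move=> y; apply: (cvg_sumr (FF := nbhs_filter y)) => k; exact: csq.
have cc : continuous (fun _ : 'rV[R]_N => r ^+ 2) by exact: cst_continuous.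
have yr y : sphere 0 r y -> \sum_(k < N) y ord0 k ^+ 2 = r ^+ 2.
  by rewrite /sphere/= subr0 => <-; rewrite sqr_enorm.
apply/andP; split.
  by apply: (le_sphere_mean r0 cS cc) => y /yr ->.
by apply: (le_sphere_mean r0 cc cS) => y /yr ->.
Qed.

End sphere_mean.

(** * Mean operators *)

(** With the denominator cleared, the condition holds also at [h = 0] and involves only values of
    [f] on one line, so derivatives are transferred between functions and spaces by rewriting these
    values. *)
Lemma is_deriveP {R : realType} {V : normedModType R} (f : V -> R) x v (l : R) :
  is_derive x v f l <-> forall e : R, 0 < e -> exists2 d : R, 0 < d &
    forall h : R, `|h| < d -> `|f (x + h *: v) - f x - h * l| <= e * `|h|.
Proof.
split=> [[df <-] e e0|dfP].
  have /cvgrPdist_le/(_ e e0) := df.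
  rewrite near_withinE => /nbhs_ballP[d /= d0 dP]; exists d => // h hd.
  have [->|h0] := eqVneq h 0; first by rewrite scale0r addr0 subrr mul0r subr0 normr0 mulr0.
  have : `|'D_v f x - h^-1 *: (f (h *: v + x) - f x)| <= e.
    by apply: dP => //; rewrite -ball_normE /= sub0r normrN.
  rewrite [h *: v + x]addrC distrC [h^-1 *: _]mulrC => fe.
  rewrite [_ - h * _](_ : _ = ((f (x + h *: v) - f x) / h - 'D_v f x) * h); last first.
    by rewrite mulrBl divfK// ['D_v f x * h]mulrC.
  by rewrite normrM ler_wpM2r.
have cv : (fun h => h^-1 *: ((f \o shift x) (h *: v) - f x)) @ 0^' --> l.
  apply/cvgrPdist_le => e e0; have [d d0 dP] := dfP _ e0.
  exists d => //= h /=; rewrite sub0r normrN => hd h0.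
  have := dP _ hd; rewrite [h *: v + x]addrC.
  set A := f (x + _) - f x => Ah.
  rewrite -(ler_pM2r (x := `|h|)) ?normr_gt0// -normrM mulrBl distrC.
  by rewrite [(h^-1 *: A) * h]mulrAC mulVf// mul1r [l * h]mulrC.
by split; [apply/cvg_ex; exists l|exact/cvg_lim].
Qed.

Lemma is_derive_line {R : realType} {V : normedModType R} (f : V -> R) x v s (l : R) :
  is_derive (x + s *: v) v f l -> is_derive s (1 : R) (fun s => f (x + s *: v)) l.
Proof.
move=> /is_deriveP df; apply/is_deriveP => e /df[d d0 dP]; exists d => // h /dP.
by rewrite [h *: 1]mulr1 scalerDl addrA.
Qed.

Lemma derive_line {R : realType} {V : normedModType R} (f : V -> R) x v (l : R) :
  is_derive (0 : R) (1 : R) (fun s => f (x + s *: v)) l -> is_derive x v f l.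
Proof.
move=> /is_deriveP df; apply/is_deriveP => e /df[d d0 dP]; exists d => // h /dP.
by rewrite add0r [h *: 1]mulr1 scale0r addr0.
Qed.

Lemma is_derive_near_eq {R : realType} {V : normedModType R} (f g : V -> R) x v (l : R) :
  (forall h, f (x + h *: v) = g (x + h *: v)) -> is_derive x v f l -> is_derive x v g l.
Proof.
move=> fg /is_deriveP df; apply/is_deriveP => e /df[d d0 dP]; exists d => // h /dP.
by rewrite !fg; have := fg 0; rewrite !scale0r !addr0 => ->.
Qed.

Lemma derivable_line_continuous {R : realType} (g dg : R -> R) (A : set R) :
  (forall s : R, A s -> is_derive s (1 : R) g (dg s)) -> {in A, continuous g}.
Proof.
move=> gd s; rewrite inE => /gd[+ _].
by move=> /derivable1_diffP/differentiable_continuous.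
Qed.

Lemma MVT_itv {R : realType} (g dg : R -> R) (a b : R) : a <= b ->
  (forall s : R, a <= s <= b -> is_derive s (1 : R) g (dg s)) ->
  exists2 c, a <= c <= b & g b - g a = dg c * (b - a).
Proof.
move=> ab gd; have [||c] := @MVT_segment R g dg a b ab.
- by move=> x /[!in_itv]/= /andP[/ltW ax /ltW xb]; apply: gd; rewrite ax.
- apply: continuous_in_subspaceT; apply: (derivable_line_continuous (dg := dg)) => s /=.
- by rewrite in_itv /= => cab ->; exists c.
Qed.

Lemma MVT0 {R : realType} (g dg : R -> R) (h : R) :
  (forall s : R, `|s| <= `|h| -> is_derive s (1 : R) g (dg s)) ->
  exists2 c, `|c| <= `|h| & g h - g 0 = dg c * h.
Proof.
move=> gd; have [h0|/ltW h0] := leP 0 h.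
  have [||c /andP[c0 ch]] := @MVT_itv _ g dg 0 h => //.
    by move=> s /andP[s0 sh]; apply: gd; rewrite !ger0_norm.
  by rewrite subr0 => ->; exists c => //; rewrite !ger0_norm.
have [||c /andP[hc c0]] := @MVT_itv _ g dg h 0 => //.
  by move=> s /andP[hs s0]; apply: gd; rewrite !ler0_norm// lerN2.
rewrite sub0r => e; exists c; first by rewrite !ler0_norm// lerN2.
by rewrite -opprB e mulrN opprK.
Qed.

Section mean_operators.
Context {R : realType} {N : nat}.
Implicit Types (f g : 'rV[R]_N -> R) (x y : 'rV[R]_N) (K : R).
Implicit Types (T : ('rV[R]_N -> R) -> 'rV[R]_N -> R).

Lemma BUCP f : BUC f <-> (exists K, forall x, `|f x| <= K) /\
  (forall e : R, 0 < e -> exists2 d : R, 0 < d & forall x y, `|x - y| < d -> `|f x - f y| < e).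
Proof.
split=> [[[M [_ Mf]] ucf]|[[K fK] ucf]]; split.
- by exists (M + 1) => x; apply: Mf => //; rewrite ltrDl.
- move=> e e0; have : entourage [set xy : R * R | ball xy.1 e xy.2] by rewrite -entourage_ballE; exists e.
  move=> /ucf; rewrite /= -entourage_ballE => -[d /= d0 dP].
  exists d => // x y xy; have /(dP (x, y)) : ball x d y by rewrite -ball_normE.
  by rewrite /= -ball_normE.
- by exists K; split=> [|M KM x _]; [exact: num_real|exact: le_trans (fK x) (ltW KM)].
- move=> P; rewrite -entourage_ballE => -[e /= e0 eP].
  have [d d0 dP] := ucf _ e0.
  rewrite /= -entourage_ballE; exists d => // -[x y] /=.
  by rewrite /ball_ -ball_normE /= => /dP xy; apply: eP => /=; rewrite -ball_normE.
Qed.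

Lemma BUC_lin (a : R) f g : BUC f -> BUC g -> BUC (fun x => a * f x + g x).
Proof.
move=> /BUCP[[K fK] fu] /BUCP[[L gL] gu]; apply/BUCP; split.
  exists (`|a| * K + L) => x; rewrite (le_trans (ler_normD _ _))// lerD//.
  by rewrite normrM ler_wpM2l.
move=> e e0; have e1 : 0 < e / 2 / (`|a| + 1) by rewrite !divr_gt0// ltr_wpDl.
have [d d0 dP] := fu _ e1; have [d' d'0 d'P] := gu _ (divr_gt0 e0 (ltr0Sn _ 1)).
exists (Num.min d d'); first by rewrite lt_min d0.
move=> x y; rewrite lt_min => /andP[/dP xy /d'P xy'].
rewrite opprD addrACA -mulrBr; apply: le_lt_trans (ler_normD _ _) _.
rewrite [ltRHS](splitr e) ler_ltD// normrM.
apply: (le_trans (ler_wpM2l _ (ltW xy))) => //.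
by rewrite mulrCA ler_piMr ?ltW ?divr_gt0// ltr_pdivrMr ?mul1r ?ltrDl// ltr_wpDl.
Qed.

Lemma BUC_cst (a : R) : BUC (fun _ : 'rV[R]_N => a).
Proof.
apply/BUCP; split; first by exists `|a|.
by move=> e e0; exists 1 => // x y _; rewrite subrr normr0.
Qed.

Lemma BUC_continuous f : BUC f -> continuous f.
Proof.
move=> /BUCP[_ fu] x; apply/(@cvgrPdist_lt _ _ _ _ (nbhs_filter x)) => e /fu[d d0 dP].
have := nbhsx_ballx x d d0; rewrite -ball_normE.
by apply: (@filterS _ _ (nbhs_filter x)) => y /dP.
Qed.

(* Linearity and the second clause make [T] a contraction for the sup norm;
   translation invariance makes it commute with derivatives. *)
Definition mean_op T := [/\
  forall a f g, BUC f -> BUC g ->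
    forall x, T (fun y => a * f y + g y) x = a * T f x + T g x,
  forall f K x, BUC f -> (forall y, f y <= K) -> T f x <= K &
  forall f a x, BUC f -> T (fun y => f (y + a)) x = T f (x + a)].

End mean_operators.

Section mean_operator_theory.
Context {R : realType} {N : nat}.
Implicit Types (f g : 'rV[R]_N -> R) (x y : 'rV[R]_N) (K : R).
Implicit Types (T S : ('rV[R]_N -> R) -> 'rV[R]_N -> R).
Notation e i := (delta_mx ord0 i : 'rV[R]_N).

Lemma norm_delta_le1 i : `|e i| <= 1.
Proof.
rewrite [leLHS]/Num.norm /= mx_normrE; apply/bigmax_leP; split=> // -[j k] _ /=.
by rewrite mxE; case: (_ && _); rewrite ?normr1 ?normr0.
Qed.

Lemma BUC_opp f : BUC f -> BUC (fun x => - f x).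
Proof.
move=> bf; rewrite (_ : (fun x => _) = (fun x => -1 * f x + (fun=> 0) x)).
  by apply: BUC_lin => //; exact: BUC_cst.
by apply/funext => x; rewrite addr0 mulN1r.
Qed.

Lemma BUC_sub f g : BUC f -> BUC g -> BUC (fun x => f x - g x).
Proof.
move=> bf bg; rewrite (_ : (fun x => _) = (fun x => -1 * g x + f x)); first exact: BUC_lin.
by apply/funext => x; rewrite mulN1r addrC.
Qed.

Lemma BUC_scale a f : BUC f -> BUC (fun x => a * f x).
Proof.
move=> bf; rewrite (_ : (fun x => _) = (fun x => a * f x + (fun=> 0) x)).
  by apply: BUC_lin => //; exact: BUC_cst.
by apply/funext => x; rewrite addr0.
Qed.

Lemma BUC_add f g : BUC f -> BUC g -> BUC (fun x => f x + g x).
Proof.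
move=> bf bg; rewrite (_ : (fun x => _) = (fun x => 1 * f x + g x)); first exact: BUC_lin.
by apply/funext => x; rewrite mul1r.
Qed.

Lemma BUC_shift f a : BUC f -> BUC (fun y => f (y + a)).
Proof.
move=> /BUCP[[K fK] fu]; apply/BUCP; split; first by exists K.
move=> e e0; have [d d0 dP] := fu _ e0; exists d => // x y xy; apply: dP.
by rewrite opprD addrACA subrr addr0.
Qed.

Section one_operator.
Variable T : ('rV[R]_N -> R) -> 'rV[R]_N -> R.
Hypothesis mT : mean_op T.

Lemma mean_op_lin a f g x : BUC f -> BUC g ->
  T (fun y => a * f y + g y) x = a * T f x + T g x.
Proof. by case: mT => + _ _ bf bg; exact. Qed.

Lemma mean_op0 x : T (fun=> 0) x = 0.
Proof.
have := mean_op_lin 1 x (BUC_cst 0) (BUC_cst 0).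
rewrite (_ : (fun y => _) = fun=> 0); last by apply/funext => y; rewrite mulr0 addr0.
rewrite mul1r => /eqP; rewrite -subr_eq subrr => /eqP <-//.
Qed.

Lemma mean_op_scale a f x : BUC f -> T (fun y => a * f y) x = a * T f x.
Proof.
move=> bf; have := mean_op_lin a x bf (BUC_cst 0).
by rewrite mean_op0 addr0 => <-; congr T; apply/funext => y; rewrite addr0.
Qed.

Lemma mean_opB f g x : BUC f -> BUC g ->
  T (fun y => f y - g y) x = T f x - T g x.
Proof.
move=> bf bg; rewrite addrC -mulN1r -mean_op_lin//.
by congr T; apply/funext => y; rewrite mulN1r addrC.
Qed.

Lemma mean_opD f g x : BUC f -> BUC g ->
  T (fun y => f y + g y) x = T f x + T g x.
Proof.
move=> bf bg; have := mean_op_lin 1 x bf bg; rewrite mul1r => <-.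
by congr T; apply/funext => y; rewrite mul1r.
Qed.

Lemma mean_op_le f K x : BUC f -> (forall y, f y <= K) -> T f x <= K.
Proof. by case: mT => _ + _; exact. Qed.

Lemma mean_op_bound f K x : BUC f -> (forall y, `|f y| <= K) -> `|T f x| <= K.
Proof.
move=> bf fK; rewrite ler_norml -[- K <= _]lerN2 opprK -mulN1r -mean_op_scale//.
rewrite (mean_op_le _ (BUC_scale _ bf)) ?(mean_op_le _ bf)// => y.
  by rewrite (le_trans (ler_norm _)).
by rewrite mulN1r lerNl; have := fK y; rewrite ler_norml => /andP[].
Qed.

Lemma mean_op_dist f g K x : BUC f -> BUC g ->
  (forall y, `|f y - g y| <= K) -> `|T f x - T g x| <= K.
Proof. by move=> bf bg fgK; rewrite -mean_opB// mean_op_bound//; exact: BUC_sub. Qed.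

Lemma mean_op_shift f a x : BUC f -> T (fun y => f (y + a)) x = T f (x + a).
Proof. by case: mT => _ _; exact. Qed.

(** By translation invariance an increment of [T f] is [T] applied to an increment of [f], so [T f]
    inherits the modulus of continuity. *)
Lemma mean_op_BUC f : BUC f -> BUC (T f).
Proof.
move=> bf; have /BUCP[[K fK] fu] := bf; apply/BUCP; split.
  by exists K => x; exact: mean_op_bound.
move=> e e0; have [d d0 dP] := fu _ (divr_gt0 e0 (ltr0Sn _ 1)).
exists d => // x y xy; rewrite -[y](subrKC x) -mean_op_shift//.
apply: (@le_lt_trans _ _ (e / 2)); last by rewrite ltr_pdivrMr// ltr_pMr// ltr1n.
apply: (mean_op_dist x bf (BUC_shift _ bf)) => z.
by apply/ltW/dP; rewrite opprD addrA subrr sub0r opprB.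
Qed.

(** Uniform continuity of the derivative makes the first-order expansion of [f] uniform in the base
    point. [T] carries the expansion over, because it commutes with translations and does not
    increase the sup norm. *)
Lemma mean_op_is_derive f i : BUC f -> (forall x, derivable f x (e i)) ->
  BUC (fun x => 'D_(e i) f x) ->
  forall x, is_derive x (e i) (T f) (T (fun x => 'D_(e i) f x) x).
Proof.
move=> bf df bdf x; apply/is_deriveP => eps eps0.
have /BUCP[_ /(_ _ eps0)[d d0 dP]] := bdf.
exists d => // h hd.
have key y : `|f (y + h *: e i) - f y - h * 'D_(e i) f y| <= eps * `|h|.
  have := @MVT0 R (fun s => f (y + s *: e i)) (fun s => 'D_(e i) f (y + s *: e i)) h.
  case=> [s _|c ch]; first exact/is_derive_line/derivableP.
  rewrite scale0r addr0 => ->; rewrite [h * _]mulrC -mulrBl normrM ler_wpM2r//.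
  apply/ltW/dP; rewrite addrAC subrr add0r normrZ.
  by apply: le_lt_trans hd; rewrite -[leRHS]mulr1 ler_pM// norm_delta_le1.
have := @mean_op_dist (fun y => f (y + h *: e i) - f y) (fun y => h * 'D_(e i) f y)
  (eps * `|h|) x _ _ key.
rewrite mean_opB// ?mean_op_shift ?mean_op_scale//; last exact: BUC_shift.
by apply; [apply: BUC_sub => //; exact: BUC_shift|exact: BUC_scale].
Qed.

Lemma mean_op_derivable f i : BUC f -> (forall x, derivable f x (e i)) ->
  BUC (fun x => 'D_(e i) f x) ->
  (forall x, derivable (T f) x (e i)) /\
  (fun x => 'D_(e i) (T f) x) = T (fun x => 'D_(e i) f x).
Proof.
move=> bf df bdf; split=> [x|]; first by case: (mean_op_is_derive bf df bdf x).
by apply/funext => x; case: (mean_op_is_derive bf df bdf x).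
Qed.

End one_operator.

Lemma mean_op_comp T S : mean_op T -> mean_op S -> mean_op (T \o S).
Proof.
move=> mT mS; split=> [a f g bf bg x|f K x bf fK|f a x bf] /=.
- rewrite -(mean_op_lin mT a x (mean_op_BUC mS bf) (mean_op_BUC mS bg)); congr (T _ x).
  by apply/funext => y; rewrite mean_op_lin.
- by apply: (mean_op_le mT) => [|y]; [exact: mean_op_BUC|exact: mean_op_le].
- rewrite -(mean_op_shift mT a x (mean_op_BUC mS bf)); congr (T _ x).
  by apply/funext => y; rewrite mean_op_shift.
Qed.

Lemma mean_op_id : mean_op (id : ('rV[R]_N -> R) -> 'rV[R]_N -> R).
Proof. by []. Qed.

Lemma mean_op_iter T n : mean_op T -> mean_op (iter n T).
Proof.
move=> mT; elim: n => [|n IHn]; first exact: mean_op_id.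
exact: mean_op_comp mT IHn.
Qed.

Lemma mean_op_translation (a : 'rV[R]_N) : mean_op (fun f x => f (x + a) : R).
Proof. by split=> // f b x _; rewrite addrAC. Qed.

(* The space C^k_b, with a common bound [K] for all derivatives up to order [k]. *)
Fixpoint Cbd k K f : Prop := [/\ BUC f, forall x, `|f x| <= K &
  if k is k'.+1 then forall i, (forall x, derivable f x (e i)) /\
    Cbd k' K (fun x => 'D_(e i) f x) else True].

Definition lap f x := \sum_i 'D_(e i) (fun y => 'D_(e i) f y) x.

Lemma Cbd_BUC k K f : Cbd k K f -> BUC f.
Proof. by case: k => [|k] []. Qed.

Lemma Cbd_bound k K f : Cbd k K f -> forall x, `|f x| <= K.
Proof. by case: k => [|k] []. Qed.

Lemma Cbd_derivable k K f i : Cbd k.+1 K f -> forall x, derivable f x (e i).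
Proof. by case=> _ _ /(_ i)[]. Qed.

Lemma Cbd_derive k K f i : Cbd k.+1 K f -> Cbd k K (fun x => 'D_(e i) f x).
Proof. by case=> _ _ /(_ i)[]. Qed.

Lemma CbdS k K f : Cbd k.+1 K f -> Cbd k K f.
Proof.
elim: k f => [|k IHk] f [bf fK fd]; first by split.
by split => // i; have [df /IHk] := fd i.
Qed.

Lemma le_Cbd k l K f : (l <= k)%N -> Cbd k K f -> Cbd l K f.
Proof.
elim: k => [|k IHk]; first by rewrite leqn0 => /eqP ->.
rewrite leq_eqVlt => /predU1P[->//|lk]; rewrite ltnS in lk.
by move=> /CbdS; exact: IHk.
Qed.

Lemma Cbd_le k K K' f : K <= K' -> Cbd k K f -> Cbd k K' f.
Proof.
move=> KK'; elim: k f => [|k IHk] f [bf fK fd].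
  by split=> // x; exact: le_trans (fK x) KK'.
split=> // [x|i]; first exact: le_trans (fK x) KK'.
by have [df /IHk] := fd i.
Qed.

Lemma Cbd_mean_op T k K f : mean_op T -> Cbd k K f -> Cbd k K (T f).
Proof.
move=> mT; elim: k f => [|k IHk] f [bf fK fd].
  by split=> //; [exact: mean_op_BUC|move=> x; exact: mean_op_bound].
split=> [|x|i]; [exact: mean_op_BUC|exact: mean_op_bound|].
have [df Cdf] := fd i.
have [dTf ->] := mean_op_derivable mT bf df (Cbd_BUC Cdf).
by split => //; exact: IHk.
Qed.

Lemma derive_mean_op T k K f i : mean_op T -> Cbd k.+1 K f ->
  (fun x => 'D_(e i) (T f) x) = T (fun x => 'D_(e i) f x).
Proof.
move=> mT [bf _ /(_ i)[df Cdf]].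
by have [_ ->] := mean_op_derivable mT bf df (Cbd_BUC Cdf).
Qed.

Lemma Cbd_lin k K K' a f g : Cbd k K f -> Cbd k K' g ->
  Cbd k (`|a| * K + K') (fun x => a * f x + g x).
Proof.
have bd (f' g' : 'rV[R]_N -> R) : (forall x, `|f' x| <= K) -> (forall x, `|g' x| <= K') ->
    forall x, `|a * f' x + g' x| <= `|a| * K + K'.
  move=> fK gK x; rewrite (le_trans (ler_normD _ _))// lerD// normrM.
  by rewrite ler_wpM2l.
elim: k f g => [|k IHk] f g [bf fK fd] [bg gK gd].
  by split=> //; [exact: BUC_lin|exact: bd].
split=> [||i]; [exact: BUC_lin|exact: bd|].
have [df Cdf] := fd i; have [dg Cdg] := gd i.
have D x : is_derive x (e i) (fun x => a * f x + g x) (a * 'D_(e i) f x + 'D_(e i) g x).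
  have -> : (fun x => a * f x + g x) = a \*: f + g by [].
  by apply: is_deriveD; [apply: is_deriveZ; exact/derivableP|exact/derivableP].
split=> [x|]; first by case: (D x).
have -> : (fun x => 'D_(e i) (fun x => a * f x + g x) x) =
    (fun x => a * 'D_(e i) f x + 'D_(e i) g x).
  by apply/funext => x; case: (D x).
exact: IHk.
Qed.

Lemma Cbd_sum k K (I : Type) (s : seq I) (F : I -> 'rV[R]_N -> R) :
  (forall i, Cbd k K (F i)) ->
  Cbd k ((size s)%:R * K) (fun x => \sum_(i <- s) F i x).
Proof.
move=> CF; elim: s => [|i s IHs].
  rewrite mul0r; under eq_fun do rewrite big_nil.
  elim: k {CF} => [|k IHk]; split=> //; do ?exact: BUC_cst; try by move=> x; rewrite normr0.
  move=> i; split=> [x|]; first exact: derivable_cst.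
  rewrite (_ : (fun x => _) = fun=> 0)//.
  by apply/funext => x; rewrite derive_cst.
under eq_fun do rewrite big_cons -[F i _]mul1r.
rewrite [(size _)%:R * K](_ : _ = `|1| * K + (size s)%:R * K); first exact: Cbd_lin.
by rewrite normr1 -mulrDl nat1r.
Qed.

Lemma Cbd_lap k K f : Cbd k.+2 K f -> Cbd k (N%:R * K) (lap f).
Proof.
move=> Cf; have -> : lap f =
    fun x => \sum_(i <- enum 'I_N) 'D_(e i) (fun y => 'D_(e i) f y) x.
  by apply/funext => x; rewrite big_enum.
rewrite -[N in N%:R](size_enum_ord N); apply: Cbd_sum => i.
by apply: Cbd_derive; exact: Cbd_derive.
Qed.

Lemma lap_mean_op T K f : mean_op T -> Cbd 2 K f -> lap (T f) = T (lap f).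
Proof.
move=> mT Cf; apply/funext => x; rewrite /lap.
have -> : T (fun y => \sum_i 'D_(e i) (fun z => 'D_(e i) f z) y) x =
    \sum_i T (fun y => 'D_(e i) (fun z => 'D_(e i) f z) y) x.
  have bdd i : BUC (fun y => 'D_(e i) (fun z => 'D_(e i) f z) y).
    exact: (Cbd_BUC (Cbd_derive i (Cbd_derive i Cf))).
  elim: (index_enum _) => [|i s IHs].
    by rewrite big_nil -[RHS](mean_op0 mT x); congr T; apply/funext => y; rewrite big_nil.
  rewrite big_cons -IHs -mean_opD//.
    by congr T; apply/funext => y; rewrite big_cons.
  have := @Cbd_sum 0 K _ s (fun i y => 'D_(e i) (fun z => 'D_(e i) f z) y).
  by move=> /(_ (fun i => Cbd_derive i (Cbd_derive i Cf)))/Cbd_BUC.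
apply: eq_bigr => i _.
rewrite (derive_mean_op i mT Cf).
by rewrite -(derive_mean_op i mT (Cbd_derive i Cf)).
Qed.

End mean_operator_theory.

(** * Density of smooth functions *)

Section smoothing.
Context {R : realType}.
Notation leb := (@lebesgue_measure R).

Lemma continuous_primitive (g : R -> R) : continuous g ->
  forall s : R, -1 < s ->
    is_derive s (1 : R) (fun s : R => \int[leb]_(t in `[-1, s]) g t) (g s).
Proof.
move=> cg s s1.
have int : leb.-integrable `[-1, s + 1] (EFin \o g).
  apply: continuous_compact_integrable; first exact: segment_compact.
  exact: continuous_subspaceT.
have [] := @continuous_FTC1_closed R g (-1) s (s + 1) _ int s1 (cg s).
  by rewrite ltrDl.
by move=> d; rewrite derive1E => <-; exact: derivableP.
Qed.

(* The mean of [g] on [[0, eta]]; the base point [-1] makes the primitive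
   differentiable also at the endpoint [0]. *)
Definition itv_mean (eta : R) (g : R -> R) : R :=
  (\int[leb]_(t in `[-1, eta]) g t - \int[leb]_(t in `[-1, 0]) g t) / eta.

Lemma itv_meanE (eta : R) (g G : R -> R) : 0 < eta -> continuous g ->
  (forall s : R, 0 <= s <= eta -> is_derive s (1 : R) G (g s)) ->
  itv_mean eta g = (G eta - G 0) / eta.
Proof.
move=> eta0 cg dG; congr (_ / _); apply/eqP; rewrite -subr_eq0.
pose G0 s := \int[leb]_(t in `[-1, s]) g t.
have [|c _] := @MVT_itv R (G0 \- G) (fun=> 0) 0 eta (ltW eta0).
  move=> s s01; rewrite -(subrr (g s)); apply: is_deriveB; last exact: dG.
  by apply: continuous_primitive => //; case/andP: s01 => + _; apply: lt_le_trans.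
rewrite mul0r /= => h; apply/eqP; rewrite -[RHS]h /G0; ring.
Qed.

Context {N : nat}.
Notation e i := (delta_mx ord0 i : 'rV[R]_N).
Implicit Types (f : 'rV[R]_N -> R) (x : 'rV[R]_N).

Lemma BUC_line_continuous f x i : BUC f -> continuous (fun s : R => f (x + s *: e i)).
Proof.
move=> /BUCP[_ fu] s; apply/cvgrPdist_lt => eps /fu[d d0 dP].
exists d => //= t /= st; apply: dP.
rewrite opprD addrACA subrr add0r -scalerBl normrZ.
by apply: le_lt_trans st; rewrite -[leRHS]mulr1 ler_wpM2l// norm_delta_le1.
Qed.

Definition coord_avg (eta : R) i f x := itv_mean eta (fun s : R => f (x + s *: e i)).

Variable eta : R.
Hypothesis eta0 : 0 < eta.

Lemma coord_avg_mean_op i : mean_op (coord_avg eta i).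
Proof.
have dprim f x (s : R) : BUC f -> 0 <= s <= eta -> is_derive s (1 : R)
    (fun s : R => \int[leb]_(t in `[-1, s]) f (x + t *: e i)) (f (x + s *: e i)).
  move=> bf /andP[s0 _].
  by apply: (@continuous_primitive _ (BUC_line_continuous (x := x) (i := i) bf)); exact: lt_le_trans s0.
split=> [a f g bf bg x|f K x bf fK|f a x bf].
- pose F h s := \int[leb]_(t in `[-1, s]) h (x + t *: e i).
  have dF s : 0 <= s <= eta -> is_derive s (1 : R) (a \*: F f + F g)
      (a * f (x + s *: e i) + g (x + s *: e i)).
    move=> s01; apply: is_deriveD; last exact: dprim.
    by apply: is_deriveZ; exact: dprim.
  rewrite /coord_avg (itv_meanE eta0 (BUC_line_continuous (BUC_lin a bf bg)) dF).
  have FE h : itv_mean eta (fun s => h (x + s *: e i)) = (F h eta - F h 0) / eta by [].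
  have lE s : (a \*: F f + F g) s = a * F f s + F g s by [].
  by rewrite !FE !lE; ring.
- have [c _ dc] := @MVT_itv R (fun s => \int[leb]_(t in `[-1, s]) f (x + t *: e i))
    (fun s => f (x + s *: e i)) 0 eta (ltW eta0) (fun s => dprim f x s bf).
  by rewrite /coord_avg /itv_mean dc subr0 mulfK ?gt_eqF.
- by congr itv_mean; apply/funext => s; rewrite addrAC.
Qed.

(** Moving [x] along the axis slides the interval of averaging, so the derivative is a difference
    quotient of [f] itself: an average gains one derivative in its direction. *)
Lemma coord_avg_is_derive i f x : BUC f ->
  is_derive x (e i) (coord_avg eta i f) (eta^-1 * (f (x + eta *: e i) - f x)).
Proof.
move=> bf; apply: derive_line.
pose g (s : R) := f (x + s *: e i); pose G (s : R) := \int[leb]_(t in `[-1, s]) g t.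
have cg : continuous g := BUC_line_continuous (x := x) (i := i) bf.
have dG (s : R) : -1 < s -> is_derive s (1 : R) G (g s) by exact: continuous_primitive.
have G1 (a b : R) : -1 < a + b -> is_derive b (1 : R) (fun s => G (a + s)) (g (a + b)).
  move=> ab; have := @is_derive_line R R G a 1 b (g (a + b)).
  rewrite [b *: 1]mulr1 => /(_ (dG _ ab)).
  by under eq_fun do rewrite [_ *: 1]mulr1.
have avgE h : `|h| < 1 -> coord_avg eta i f (x + h *: e i) = (G (h + eta) - G (h + 0)) / eta.
  rewrite ltr_norml => /andP[h1 _]; apply: (itv_meanE (G := fun s => G (h + s)) eta0).
    by apply: BUC_line_continuous.
  move=> s /andP[s0 _]; rewrite -addrA -scalerDl.
  by apply: G1; rewrite (lt_le_trans h1)// lerDl.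
have D : is_derive (0 : R) (1 : R) (eta^-1 \*: ((fun h => G (eta + h)) - G))
    (eta^-1 *: (g (eta + 0) - g 0)).
  have D1 : is_derive (0 : R) (1 : R) (fun h => G (eta + h)) (g (eta + 0)).
    by apply: G1; rewrite addr0 (lt_trans _ eta0).
  have D2 : is_derive (0 : R) (1 : R) G (g 0) by exact: dG.
  exact: (@is_deriveZ _ _ _ _ _ _ _ _ (is_deriveB D1 D2)).
have -> : f (x + eta *: e i) - f x = g (eta + 0) - g 0.
  by rewrite /g addr0 scale0r addr0.
move/is_deriveP in D; apply/is_deriveP => eps /D[d d0 dP].
(* Steps below 1 keep the shifted interval to the right of the base point -1, where [G] is known to
   be differentiable. *)
exists (Num.min d 1) => [|h]; first by rewrite lt_min d0 ltr01.
rewrite lt_min => /andP[/dP + h1]; rewrite !add0r [h *: 1]mulr1.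
rewrite !avgE ?normr0 ?ltr01// !addr0 !add0r /=.
have E t : ((fun h => G (eta + h)) - G) t = G (eta + t) - G t by [].
by rewrite !E addr0 ![_ / eta]mulrC [h + eta]addrC.
Qed.

(** The derivative of an average is [eta^-1 * h], where [h] is a translate of [f] minus [f]. Writing
    it as [(eta^-1 - 1) * h + h] gives it the shape of [Cbd_lin]; the constants nest because that
    lemma is used twice. *)
Let avgK (K : R) : R :=
  let K1 := `|-1| * K + K in `|eta^-1 - 1| * K1 + K1.

Lemma coord_avg_Cbd_derive i k K f : Cbd k K f ->
  Cbd k (avgK K) (fun x => 'D_(e i) (coord_avg eta i f) x).
Proof.
move=> Cf; have bf := Cbd_BUC Cf.
pose h x := -1 * f x + f (x + eta *: e i).
have Ch : Cbd k (`|-1| * K + K) h.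
  by apply: Cbd_lin => //; exact: (Cbd_mean_op (mean_op_translation _)).
rewrite (_ : (fun x => _) = fun x => (eta^-1 - 1) * h x + h x); first exact: Cbd_lin.
apply/funext => x; have [_ ->] := coord_avg_is_derive i x bf.
by rewrite mulrBl mul1r subrK /h mulN1r addrC.
Qed.

(** Over all coordinates this is the mean on a cube of side [eta] with corner [x]. A derivative is
    absorbed by the average in its own direction and passes through the others, so the order of
    smoothness rises by one. *)
Definition box_avg s f := foldr (fun i g => coord_avg eta i g) f s.

Lemma box_avg_mean_op s : mean_op (box_avg s).
Proof.
elim: s => [|i s IHs]; first exact: mean_op_id.
exact: (mean_op_comp (coord_avg_mean_op i) IHs).
Qed.

Lemma box_avg_Cbd_derive s i k K f : i \in s -> Cbd k K f ->
  (forall x, derivable (box_avg s f) x (e i)) /\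
  Cbd k (avgK K) (fun x => 'D_(e i) (box_avg s f) x).
Proof.
elim: s => [//|j s IHs]; rewrite inE => ijs Cf /=.
have [<-|ij] := eqVneq i j.
  have Cs := Cbd_mean_op (box_avg_mean_op s) Cf.
  split=> [x|]; last exact: coord_avg_Cbd_derive.
  by have [] := coord_avg_is_derive i x (Cbd_BUC Cs).
have is_ : i \in s by case/predU1P: ijs ij => [->|//]; rewrite eqxx.
have [ds Cs] := IHs is_ Cf.
have mj := coord_avg_mean_op j.
have [? ->] := mean_op_derivable mj (mean_op_BUC (box_avg_mean_op s) (Cbd_BUC Cf)) ds (Cbd_BUC Cs).
by split => //; exact: Cbd_mean_op.
Qed.

Lemma box_avg_Cbd k K f : Cbd k K f ->
  Cbd k.+1 (Num.max K (avgK K)) (box_avg (enum 'I_N) f).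
Proof.
move=> Cf; have mb := box_avg_mean_op (enum 'I_N).
split=> [|x|i]; first exact: mean_op_BUC (Cbd_BUC Cf).
  by rewrite le_max (mean_op_bound mb _ (Cbd_BUC Cf) (Cbd_bound Cf)).
have [] := @box_avg_Cbd_derive (enum 'I_N) i k K f; rewrite ?mem_enum//.
by move=> d C; split => //; apply: Cbd_le C; rewrite le_max lexx orbT.
Qed.

Lemma box_avg_dist s f eps : BUC f ->
  (forall x y, `|x - y| <= eta -> `|f x - f y| <= eps) ->
  forall x, `|box_avg s f x - f x| <= (size s)%:R * eps.
Proof.
move=> bf fe; elim: s => [|i s IHs] x; first by rewrite subrr normr0 mul0r.
have mi := coord_avg_mean_op i.
rewrite /= -[X in `|X|](subrKA (coord_avg eta i f x)) -natr1 mulrDl mul1r.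
apply: le_trans (ler_normD _ _) _; rewrite lerD//.
  exact: (mean_op_dist mi x (mean_op_BUC (box_avg_mean_op s) bf) bf IHs).
have dprim (a : R) : 0 <= a <= eta -> is_derive a (1 : R)
    (fun s : R => \int[leb]_(t in `[-1, s]) f (x + t *: e i)) (f (x + a *: e i)).
  move=> /andP[s0 _].
  by apply: (@continuous_primitive _ (BUC_line_continuous bf)); exact: lt_le_trans s0.
have [c c01 dc] := @MVT_itv R (fun s => \int[leb]_(t in `[-1, s]) f (x + t *: e i))
  (fun s => f (x + s *: e i)) 0 eta (ltW eta0) dprim.
rewrite /coord_avg /itv_mean dc subr0 mulfK ?gt_eqF//.
apply: fe; rewrite addrAC subrr add0r normrZ.
case/andP: c01 => c0 c1; rewrite ger0_norm//.
by apply: le_trans c1; rewrite -[leRHS]mulr1 ler_wpM2l// norm_delta_le1.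
Qed.

End smoothing.

(** Each box average gains one derivative and, for a small side, moves the function by at most
    [eps / 2]. It composes [N] averages that share this error; dividing by [N.+1] covers every
    dimension. *)
Lemma Cbd_dense {R : realType} {N : nat} k (f : 'rV[R]_N -> R) eps : BUC f -> 0 < eps ->
  exists g K, Cbd k K g /\ forall x, `|f x - g x| <= eps.
Proof.
move=> bf; elim: k eps => [|k IHk] eps eps0.
  have /BUCP[[K fK] _] := bf.
  by exists f, K; split=> // x; rewrite subrr normr0 ltW.
have [g [K [Cg fg]]] := IHk _ (divr_gt0 eps0 (ltr0Sn _ 1)).
have /BUCP[_ gu] := Cbd_BUC Cg.
have e0 : 0 < eps / 2 / N.+1%:R by rewrite !divr_gt0.
have [d d0 dP] := gu _ e0.
have eta0 : 0 < d / 2 by rewrite divr_gt0.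
have Cb := box_avg_Cbd eta0 Cg.
exists (box_avg (d / 2) (enum 'I_N) g); eexists; split; first exact: Cb.
move=> x; rewrite -[X in `|X|](subrKA (g x)) (splitr eps).
apply: le_trans (ler_normD _ _) _; rewrite lerD// distrC.
apply: (le_trans (box_avg_dist eta0 (enum 'I_N) (Cbd_BUC Cg) (eps := eps / 2 / N.+1%:R) _ x)).
  move=> y z yz; apply/ltW/dP; apply: (le_lt_trans yz).
  by rewrite ltr_pdivrMr// ltr_pMr// ltr1n.
rewrite size_enum_ord mulrCA ler_piMr ?divr_ge0 ?(ltW eps0)//.
by rewrite ler_pdivrMr// mul1r ler_nat.
Qed.

(** * Second-order expansion of spherical means *)

Section spherical_mean_operator.
Context {R : realType} {N : nat}.
Implicit Types (f : 'rV[R]_N -> R) (x y z : 'rV[R]_N) (K r h : R).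
Notation e i := (delta_mx ord0 i : 'rV[R]_N).

Lemma is_deriveNdir (f : 'rV[R]_N -> R) x v (l : R) :
  is_derive x v f l -> is_derive x (- v) f (- l).
Proof.
move=> /is_deriveP df; apply/is_deriveP => eps /df[d d0 dP]; exists d => // h hd.
have := dP (- h); rewrite normrN => /(_ hd).
by rewrite scaleNr scalerN mulNr mulrN.
Qed.

Lemma Cbd_is_derive_line k K f x v i : Cbd k.+1 K f -> v = e i ->
  forall s : R, is_derive s (1 : R) (fun s => f (x + s *: v)) ('D_(e i) f (x + s *: v)).
Proof.
by move=> Cf -> s; apply: is_derive_line; apply: derivableP; exact: Cbd_derivable Cf _.
Qed.

Lemma Cbd_lip_line K f x i (s : R) : Cbd 1 K f ->
  `|f (x + s *: e i) - f x| <= K * `|s|.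
Proof.
move=> Cf; have [c _] := @MVT0 R (fun s => f (x + s *: e i))
  (fun s => 'D_(e i) f (x + s *: e i)) s
  (fun t _ => Cbd_is_derive_line x Cf erefl t).
rewrite scale0r addr0 => ->; rewrite normrM ler_wpM2r//.
exact: (Cbd_bound (Cbd_derive i Cf)).
Qed.

(** The symmetric sum has no odd terms. After the quadratic term is removed, the second derivative
    [F2] is at most [2 * K * |t|], as second derivatives of [f] are Lipschitz; two applications of
    the mean value theorem each add a factor [|t|]. *)
Lemma second_difference K f z i (s : R) : Cbd 3 K f ->
  `|f (z + s *: e i) + f (z - s *: e i) - 2 * f z
    - s ^+ 2 * 'D_(e i) (fun y => 'D_(e i) f y) z| <= 2 * K * `|s| ^+ 3.
Proof.
move=> Cf; set c := 'D_(e i) _ z.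
have C1 := Cbd_derive i Cf; have C2 := Cbd_derive i C1.
have dm (g : 'rV[R]_N -> R) k : Cbd k.+1 K g -> forall t : R,
    is_derive t (1 : R) (fun t => g (z + t *: - e i)) (- 'D_(e i) g (z + t *: - e i)).
  move=> Cg t; apply: is_derive_line; apply: is_deriveNdir.
  by apply: derivableP; exact: Cbd_derivable Cg _.
have dp (g : 'rV[R]_N -> R) k : Cbd k.+1 K g -> forall t : R,
    is_derive t (1 : R) (fun t => g (z + t *: e i)) ('D_(e i) g (z + t *: e i)).
  by move=> Cg t; exact: (Cbd_is_derive_line z Cg erefl).
pose D1 y := 'D_(e i) f y; pose D2 y := 'D_(e i) D1 y.
pose F2 (t : R) := D2 (z + t *: e i) + D2 (z + t *: - e i) - 2 * c.
pose F1 (t : R) := D1 (z + t *: e i) - D1 (z + t *: - e i) - 2 * c * t.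
pose F0 (t : R) := f (z + t *: e i) + f (z + t *: - e i) - c * t ^+ 2.
have F2b t : `|F2 t| <= 2 * K * `|t|.
  have sub2 (a b c' : R) : a + b - 2 * c' = (a - c') + (b - c') by ring.
  rewrite /F2 sub2 -mulrA mulr2n mulrDl mul1r (le_trans (ler_normD _ _))// lerD//.
    exact: Cbd_lip_line.
  by have := Cbd_lip_line z i (- t) C2; rewrite normrN scaleNr -scalerN.
have dF1 t : is_derive t (1 : R) F1 (F2 t).
  have -> : F1 = (fun t => D1 (z + t *: e i)) - (fun t => D1 (z + t *: - e i))
                  - ((2 * c) \*: id) by [].
  rewrite /F2 -[D2 (z + t *: - e i)]opprK.
  apply: (is_deriveB (is_deriveB (dp _ _ C1 t) (dm _ _ C1 t))).
  have D := @is_deriveZ _ _ _ _ (2 * c) _ _ _ (is_derive_id t (1 : R)).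
  by rewrite [_ *: 1]mulr1 in D.
have dF0 t : is_derive t (1 : R) F0 (F1 t).
  have -> : F0 = (fun t => f (z + t *: e i)) + (fun t => f (z + t *: - e i))
                  - (c \*: (id ^+ 2)) by [].
  rewrite /F1; apply: (is_deriveB (is_deriveD (dp _ _ Cf t) (dm _ _ Cf t))).
  have D := @is_deriveZ _ _ _ _ c _ _ _ (is_deriveX 2 (is_derive_id t (1 : R))).
  by rewrite /= expr1 [_ *: 1]mulr1 [_ *: _]mulrA [c * 2]mulrC in D.
have F1b t : `|F1 t| <= 2 * K * `|t| ^+ 2.
  have [a ta] := @MVT0 R F1 F2 t (fun u _ => dF1 u).
  rewrite {2}/F1 !scale0r !addr0 subrr mulr0 !subr0 => ->.
  rewrite normrM expr2 mulrA ler_wpM2r// (le_trans (F2b a))// ler_wpM2l//.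
  by rewrite mulr_ge0// (le_trans _ (Cbd_bound Cf 0)).
have [a sa] := @MVT0 R F0 F1 s (fun u _ => dF0 u).
rewrite {2}/F0 !scale0r !addr0 expr0n mulr0 subr0 => E.
have rearr (u v c' d : R) : u + v - 2 * d - s ^+ 2 * c' = u + v - c' * s ^+ 2 - (d + d).
  by ring.
rewrite -scalerN rearr E normrM exprSr mulrA ler_wpM2r// (le_trans (F1b a))// ler_wpM2l//.
  by rewrite mulr_ge0// (le_trans _ (Cbd_bound Cf 0)).
by rewrite lerXn2r// nnegrE.
Qed.

(** Going from [x] to [x + y] one coordinate at a time leaves increments along a single axis, and
    [prefix k y] is unchanged when the [k]-th coordinate of [y] is reflected. Symmetrizing thus
    produces pure second differences and no mixed terms. *)
Definition prefix k y : 'rV[R]_N := \row_j (if (j < k)%N then y ord0 j else 0).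

Lemma prefix0 y : prefix 0 y = 0.
Proof. by apply/rowP => j; rewrite !mxE. Qed.

Lemma prefixN y : prefix N y = y.
Proof. by apply/rowP => j; rewrite !mxE ltn_ord. Qed.

Lemma prefixS (k : 'I_N) y : prefix k.+1 y = prefix k y + y ord0 k *: e k.
Proof.
apply/rowP => j; rewrite !mxE/= ltnS leq_eqVlt -(inj_eq val_inj) eq_sym.
have [->|jk] := eqVneq j k; first by rewrite eqxx ltnn/= mulr1 add0r.
by rewrite (inj_eq val_inj) eq_sym (negbTE jk)/= mulr0 addr0.
Qed.

Lemma prefixB k y z : prefix k y - prefix k z = prefix k (y - z).
Proof. by apply/rowP => j; rewrite !mxE; case: ifP => // _; rewrite subrr. Qed.

Lemma norm_prefix k y : `|prefix k y| <= `|y|.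
Proof.
rewrite [leLHS]/Num.norm /= mx_normrE; apply/bigmax_leP; split=> // -[i j] _ /=.
by rewrite mxE; case: ifP => _; rewrite ?normr0// ord1 coord_le_norm.
Qed.

Lemma prefix_telescope f x y :
  f (x + y) - f x = \sum_(k < N) (f (x + prefix k.+1 y) - f (x + prefix k y)).
Proof.
rewrite -(big_mkord xpredT (fun k => f (x + prefix k.+1 y) - f (x + prefix k y))).
by rewrite (telescope_sumr (fun k => f (x + prefix k y)))// prefixN prefix0 addr0.
Qed.

Lemma BUC_prefix f x k : BUC f -> BUC (fun y => f (x + prefix k y)).
Proof.
move=> /BUCP[[K fK] fu]; apply/BUCP; split; first by exists K.
move=> eps /fu[d d0 dP]; exists d => // y z yz; apply: dP.
rewrite opprD addrACA subrr add0r prefixB.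
exact: le_lt_trans (norm_prefix _ _) yz.
Qed.

Lemma Cbd_lip K f x y : Cbd 1 K f -> `|f (x + y) - f x| <= K * \sum_i `|y ord0 i|.
Proof.
move=> Cf; rewrite prefix_telescope mulr_sumr.
apply: le_trans (ler_norm_sum _ _ _) _; apply: ler_sum => k _.
by rewrite prefixS addrA Cbd_lip_line.
Qed.

Hypothesis N0 : (0 < N)%N.

Lemma sphere_mean_bound f r B : 0 < r -> continuous f ->
  (forall y, sphere 0 r y -> `|f y| <= B) -> `|sphere_mean f 0 r| <= B.
Proof.
move=> r0 cf fB; rewrite ler_norml.
have cc a : continuous (fun _ : 'rV[R]_N => a : R) by exact: cst_continuous.
rewrite -{1}(sphere_mean_cst N0 (- B) 0 r0) -[X in _ && (_ <= X)](sphere_mean_cst N0 B 0 r0).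
apply/andP; split; apply: le_sphere_mean => // y /fB; rewrite ler_norml => /andP[]//.
Qed.

(** For each of the [N] coordinates, the second difference costs [K * r ^ 3], and replacing the
    second derivative at [x + prefix k y] by the one at [x] costs [N * K * r ^ 3]. *)
Lemma sphere_mean_expansion K f x r : 0 < r -> Cbd 3 K f ->
  `|sphere_mean f x r - f x - r ^+ 2 / (2 * N%:R) * lap f x|
    <= N%:R * ((1 + N%:R) * K * r ^+ 3).
Proof.
move=> r0 Cf; have bf := Cbd_BUC Cf.
have K0 : 0 <= K := le_trans (normr_ge0 _) (Cbd_bound Cf 0).
pose m F := sphere_mean F (0 : 'rV[R]_N) r.
pose u k y := f (x + prefix k y).
have cu k : continuous (u k) by apply: BUC_continuous; exact: BUC_prefix.
pose c i := 'D_(e i) (fun y => 'D_(e i) f y) x.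
have cK i : `|c i| <= K by exact: (Cbd_bound (Cbd_derive i (Cbd_derive i Cf))).
have csq (i : 'I_N) : continuous (fun y : 'rV[R]_N => y ord0 i ^+ 2).
  by move=> y; apply: (cvg_exprn (FF := nbhs_filter y)); exact: coord_cvg.
have ureflect (k : 'I_N) y :
    u k.+1 (reflect_coord k y) = f (x + prefix k y - y ord0 k *: e k).
  rewrite /u prefixS addrA -scaleNr; congr (f (_ + _ + _ *: _)).
    by apply/rowP => j; rewrite !mxE; case: ifP => // jk;
       rewrite -(inj_eq val_inj) ltn_eqF// mul1r.
  by rewrite mxE eqxx mulN1r.
have creflect (k : 'I_N) : continuous (fun y => u k.+1 (reflect_coord k y)).
  move=> y; apply: continuous_comp; last exact: cu.
  exact: (isometry_inv_continuous (reflect_coord_isometry k)).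
have main (k : 'I_N) : `|m (u k.+1) - m (u k) - r ^+ 2 / (2 * N%:R) * c k|
    <= (1 + N%:R) * K * r ^+ 3.
  (* Symmetrizing in the [k]-th coordinate replaces the increment of [f] along [e k]
     by half a second difference. *)
  pose g y := 2^-1 * u k.+1 y + (2^-1 * u k.+1 (reflect_coord k y) +
    (- 1 * u k y + (- (c k / 2)) * y ord0 k ^+ 2)).
  have cg1 : continuous (fun y => - (c k / 2) * y ord0 k ^+ 2).
    by move=> y; apply: (cvgM (FF := nbhs_filter y)); [exact: cvg_cst|exact: csq].
  have cg2 : continuous (fun y => - 1 * u k y + - (c k / 2) * y ord0 k ^+ 2).
    move=> y; apply: (cvgD (FF := nbhs_filter y)); last exact: cg1.
    by apply: (cvgM (FF := nbhs_filter y)); [exact: cvg_cst|exact: cu].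
  have cg3 : continuous (fun y => 2^-1 * u k.+1 (reflect_coord k y) +
      (- 1 * u k y + - (c k / 2) * y ord0 k ^+ 2)).
    move=> y; apply: (cvgD (FF := nbhs_filter y)); last exact: cg2.
    by apply: (cvgM (FF := nbhs_filter y)); [exact: cvg_cst|exact: creflect].
  have cg : continuous g.
    move=> y; apply: (cvgD (FF := nbhs_filter y)); last exact: cg3.
    by apply: (cvgM (FF := nbhs_filter y)); [exact: cvg_cst|exact: cu].
  have -> : m (u k.+1) - m (u k) - r ^+ 2 / (2 * N%:R) * c k = m g.
    rewrite /m /g !sphere_mean_linear// -(sphere_mean_reflect N0 k)//.
    have -> : sphere_mean (fun y => - (c k / 2) * y ord0 k ^+ 2) 0 r =
        - (c k / 2) * (r ^+ 2 / N%:R).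
      have cz : continuous (fun _ : 'rV[R]_N => 0 : R) by exact: cst_continuous.
      have := sphere_mean_linear N0 (- (c k / 2)) 0 r0 (csq k) cz.
      rewrite sphere_mean_cst// sphere_mean_sqr_coord// addr0 => <-.
      by congr sphere_mean; apply/funext => y; rewrite addr0.
    by field; rewrite pnatr_eq0 -lt0n.
  apply: sphere_mean_bound => // y; rewrite /sphere /= subr0 => yr.
  have yk : `|y ord0 k| <= r by rewrite -yr coord_le_enorm.
  pose z := x + prefix k y; pose ck z := 'D_(e k) (fun w => 'D_(e k) f w) z.
  have E : g y = 2^-1 * (f (z + y ord0 k *: e k) + f (z - y ord0 k *: e k) - 2 * f z
      - y ord0 k ^+ 2 * ck z) + 2^-1 * (y ord0 k ^+ 2 * (ck z - c k)).
    have rearr (a b d q s t : R) : 2^-1 * a + (2^-1 * b + (- 1 * d + (- (t / 2)) * q)) =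
        2^-1 * (a + b - 2 * d - q * s) + 2^-1 * (q * (s - t)) by field.
    by rewrite /g ureflect [u k.+1 y]/u prefixS [x + (_ + _)]addrA -/z (rearr _ _ _ _ (ck z)).
  rewrite E; apply: le_trans (ler_normD _ _) _.
  rewrite [(1 + _) * K]mulrDl mul1r [leRHS]mulrDl lerD//.
    have half0 : 0 <= 2^-1 :> R by rewrite invr_ge0.
    rewrite normrM ger0_norm//.
    apply: (le_trans (ler_wpM2l half0 (second_difference z k (y ord0 k) Cf))).
    rewrite [leLHS](_ : _ = K * `|y ord0 k| ^+ 3); last by field.
    by rewrite ler_wpM2l// lerXn2r// nnegrE// ltW.
  have ckz : `|ck z - c k| <= K * (N%:R * r).
    apply: le_trans (Cbd_lip x (prefix k y) (Cbd_derive k (Cbd_derive k Cf))) _.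
    rewrite ler_wpM2l// -[X in X%:R](card_ord N) mulr_natl -sumr_const.
    apply: ler_sum => j _; apply: le_trans (coord_le_norm _ j) _.
    apply: le_trans (norm_prefix _ _) _.
    by apply: le_trans (norm_le_enorm _) _; rewrite yr.
  rewrite normrM ger0_norm ?invr_ge0//.
  apply: (@le_trans _ _ `|y ord0 k ^+ 2 * (ck z - c k)|).
    by rewrite ler_piMl// invf_le1// ler1n.
  rewrite normrM normrX; apply: (@le_trans _ _ (r ^+ 2 * (K * (N%:R * r)))).
    by rewrite ler_pM// ?exprn_ge0// lerXn2r// nnegrE// ltW.
  by rewrite le_eqVlt; apply/orP; left; apply/eqP; ring.
have -> : sphere_mean f x r - f x - r ^+ 2 / (2 * N%:R) * lap f x =
    \sum_(k < N) (m (u k.+1) - m (u k) - r ^+ 2 / (2 * N%:R) * c k).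
  rewrite sumrB -mulr_sumr; congr (_ - _).
  rewrite -(big_mkord xpredT (fun k => m (u k.+1) - m (u k))).
  rewrite (telescope_sumr (fun k => m (u k)))//.
  rewrite (sphere_mean_shift N0 x r0 (BUC_continuous bf)); congr (_ - _).
    by rewrite /m /u; congr sphere_mean; apply/funext => y; rewrite prefixN.
  rewrite -[LHS](sphere_mean_cst N0 _ 0 r0) /m /u; congr sphere_mean.
  by apply/funext => y; rewrite prefix0 addr0.
apply: le_trans (ler_norm_sum _ _ _) _.
rewrite [leRHS]mulr_natl -[X in _ <= _ *+ X](card_ord N) -sumr_const.
by apply: ler_sum => k _; exact: main.
Qed.

Lemma M2_mean_op h : 0 <= h -> mean_op (M2 (N := N) h).
Proof.
rewrite le_eqVlt => /predU1P[<-|h0].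
  by rewrite /M2 eqxx; split.
have r0 : 0 < Num.sqrt (2 * h) by rewrite sqrtr_gt0 mulr_gt0.
have M2E f x : M2 h f x = sphere_mean f x (Num.sqrt (2 * h)) by rewrite /M2 gt_eqF.
split=> [a f g bf bg x|f K x bf fK|f a x bf]; rewrite !M2E.
- exact: (sphere_mean_linear N0 a x r0 (BUC_continuous bf) (BUC_continuous bg)).
- rewrite -[leRHS](sphere_mean_cst N0 K x r0).
  apply: (le_sphere_mean N0 r0 (BUC_continuous bf)) => //; exact: cst_continuous.
- have bfa := BUC_shift a bf.
  rewrite (sphere_mean_shift N0 _ r0 (BUC_continuous bfa)).
  rewrite [RHS](sphere_mean_shift N0 _ r0 (BUC_continuous bf)).
  by congr sphere_mean; apply/funext => y; rewrite addrAC.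
Qed.

(** The constant [N * (1 + N)] of the spherical expansion, times 4: for [r = sqrt (2 * h)], [r ^ 3]
    is at most [2 * h * (2 * sqrt h)]. *)
Definition generator_cst : R := 4 * N%:R * (1 + N%:R).

Lemma M2_generator K f h x : 0 <= h -> Cbd 3 K f ->
  `|M2 h f x - f x - h / N%:R * lap f x| <= generator_cst * K * (h * Num.sqrt h).
Proof.
rewrite le_eqVlt => /predU1P[<-|h0] Cf.
  by rewrite /M2 eqxx subrr !mul0r subrr normr0 mulr0.
have r0 : 0 < Num.sqrt (2 * h) by rewrite sqrtr_gt0 mulr_gt0.
have K0 : 0 <= K := le_trans (normr_ge0 _) (Cbd_bound Cf 0).
have r2 : Num.sqrt (2 * h) ^+ 2 = 2 * h by rewrite sqr_sqrtr// mulr_ge0// ltW.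
have := sphere_mean_expansion x r0 Cf.
rewrite /M2 gt_eqF// [_ ^+ 3]exprSr r2 [_ / (2 * _)](_ : _ = h / N%:R); last first.
  by field; rewrite pnatr_eq0 -lt0n.
move=> /le_trans; apply; rewrite sqrtrM//.
have s2 : Num.sqrt 2 <= 2 :> R.
  by rewrite -[leRHS]ger0_norm// -sqrtr_sqr ler_sqrt ?exprn_ge0// expr2 ler_peMr// ler1n.
apply: (@le_trans _ _ (N%:R * ((1 + N%:R) * K * (2 * h * (2 * Num.sqrt h))))).
  have A0 : 0 <= (1 + N%:R) * K by rewrite mulr_ge0 ?addr_ge0.
  have h2 : 0 <= 2 * h by rewrite mulr_ge0 ?(ltW h0).
  apply: ler_wpM2l => //; apply: ler_wpM2l => //; apply: ler_wpM2l => //.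
  by apply: ler_wpM2r => //; exact: sqrtr_ge0.
by rewrite le_eqVlt; apply/orP; left; apply/eqP; rewrite /generator_cst; ring.
Qed.

End spherical_mean_operator.

(** * Convergence of the Euler iterates *)

Lemma ler_cvg_near {R : realType} (u : nat -> R) (l b : R) :
  u @ \oo --> l -> (\forall n \near \oo, u n <= b) -> l <= b.
Proof. by move=> ul ub; exact: (closed_cvg (fun x => x <= b) (@closed_le R b) ub l ul). Qed.

Section chernoff.
Context {R : realType} {N : nat}.
Implicit Types (f g phi : 'rV[R]_N -> R) (x y : 'rV[R]_N) (K : R).
Implicit Types (A B : ('rV[R]_N -> R) -> 'rV[R]_N -> R).
Hypothesis N0 : (0 < N)%N.

(** Since [A^(n+1) - B^(n+1) = A (A^n - B^n) + (A - B) B^n] and [A] is a contraction, the one-step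
    error is incurred only along the orbit of [B], where bounds on derivatives persist. *)
Lemma chernoff_telescope A B phi n (eps : R) : mean_op A -> mean_op B -> BUC phi ->
  (forall j x, `|A (iter j B phi) x - B (iter j B phi) x| <= eps) ->
  forall x, `|iter n A phi x - iter n B phi x| <= n%:R * eps.
Proof.
move=> mA mB bphi AB; have bA k := mean_op_BUC (mean_op_iter k mA) bphi.
have bB k := mean_op_BUC (mean_op_iter k mB) bphi.
elim: n => [|n IHn] x; first by rewrite subrr normr0 mul0r.
rewrite !iterS -[X in `|X|](subrKA (A (iter n B phi) x)) -natr1 mulrDl mul1r.
rewrite (le_trans (ler_normD _ _))// lerD//.
exact: (mean_op_dist mA x (bA n) (bB n) IHn).
Qed.

Lemma iter_dist A phi n (eps : R) : mean_op A -> BUC phi ->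
  (forall x, `|A phi x - phi x| <= eps) ->
  forall x, `|iter n A phi x - phi x| <= n%:R * eps.
Proof.
move=> mA bphi Ae x.
have := @chernoff_telescope A id phi n eps mA (mean_op_id (R := R)) bphi _ x.
have idn k : iter k id phi = phi by elim: k => [//|k IHk]; rewrite iterS.
by rewrite idn; apply => j y; rewrite idn.
Qed.

Lemma lap_bound K f x : Cbd 2 K f -> `|lap f x| <= N%:R * K.
Proof. by move=> Cf; exact: (Cbd_bound (Cbd_lap Cf)). Qed.

Let NR0 : (N%:R : R) != 0. Proof. by rewrite pnatr_eq0 -lt0n. Qed.

(* Meant for Euler steps [A] and [B] of lengths [t / n] and [s / n], with [d = t - s]
   and an error [eta] that vanishes as [n] grows. *)
Lemma chernoff_time A B (d eta : R) n phi K : (0 < n)%N -> 0 <= eta ->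
  mean_op A -> mean_op B ->
  (forall K' f x, Cbd 3 K' f ->
    `|A f x - B f x - d / n%:R / N%:R * lap f x| <= K' * (eta / n%:R)) ->
  (forall K' f x, Cbd 3 K' f -> `|A f x - f x| <= K' * eta) ->
  Cbd 5 K phi -> forall x,
  `|iter n A phi x - iter n B phi x - d / N%:R * iter n A (lap phi) x|
     <= K * (d ^+ 2 + eta * (1 + 2 * `|d|)).
Proof.
move=> n0 eta0 mA mB AB AI Cphi.
have nR : 0 < n%:R :> R by rewrite ltr0n.
have K0 : 0 <= K := le_trans (normr_ge0 _) (Cbd_bound Cphi 0).
have Cchi : Cbd 3 (N%:R * K) (lap phi) := Cbd_lap Cphi.
have C3 : Cbd 3 K phi := le_Cbd (isT : 3 <= 5)%N Cphi.
have bA k := mean_op_BUC (mean_op_iter k mA) (Cbd_BUC Cphi).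
have bB k := mean_op_BUC (mean_op_iter k mB) (Cbd_BUC Cphi).
have bAc k := mean_op_BUC (mean_op_iter k mA) (Cbd_BUC Cchi).
have bBc k := mean_op_BUC (mean_op_iter k mB) (Cbd_BUC Cchi).
have AB1 K' f x : Cbd 3 K' f -> `|A f x - B f x| <= K' * ((`|d| + eta) / n%:R).
  move=> Cf; rewrite -[X in `|X|](subrK (d / n%:R / N%:R * lap f x)).
  apply: (le_trans (ler_normD _ _)); rewrite addrC mulrDl mulrDr lerD//; last exact: AB.
  rewrite normrM (le_trans (ler_wpM2l _ (lap_bound x (CbdS Cf))))//.
  rewrite !normrM !normfV (ger0_norm (ltW nR)) [`|N%:R|]ger0_norm//.
  by rewrite le_eqVlt; apply/orP; left; apply/eqP; field; rewrite NR0 gt_eqF.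
have chi_dist j x : (j <= n)%N ->
    `|iter j B (lap phi) x - iter j.+1 A (lap phi) x| <= N%:R * K * (`|d| + 2 * eta).
  move=> jn; rewrite -[X in `|X|](subrKA (iter j A (lap phi) x)).
  rewrite (_ : `|d| + _ = (`|d| + eta) + eta); last by ring.
  apply: (le_trans (ler_normD _ _)); rewrite mulrDr lerD//.
    rewrite distrC; apply: (le_trans (chernoff_telescope j mA mB (Cbd_BUC Cchi)
      (eps := N%:R * K * ((`|d| + eta) / n%:R)) _ x)).
      by move=> i y; apply: AB1; exact: Cbd_mean_op (mean_op_iter i mB) Cchi.
    rewrite mulrCA ler_wpM2l ?mulr_ge0// mulrCA ler_piMr ?addr_ge0//.
    by rewrite ler_pdivrMr// mul1r ler_nat.
  rewrite iterSr distrC.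
  apply: (mean_op_dist (mean_op_iter j mA) x (mean_op_BUC mA (Cbd_BUC Cchi)) (Cbd_BUC Cchi)).
  by move=> y; exact: AI.
pose c j : R := j%:R * (d / n%:R) / N%:R.
(* The first-order term is carried inside the telescoped quantity. A step adds the error of [AB] and
   the replacement of [lap] of a [B]-iterate, which is the [B]-iterate of [lap phi], by an
   [A]-iterate. [chi_dist] bounds the latter by a multiple of [|d| + 2 * eta], and the factor
   [d / n] in front yields [d ^ 2] after [n] steps. *)
pose D j x := iter j A phi x - iter j B phi x - c j * iter j A (lap phi) x.
pose step := K * (eta / n%:R) + `|d| / n%:R * K * (`|d| + 2 * eta).
have D_le j : (j <= n)%N -> forall x, `|D j x| <= j%:R * step.
  elim: j => [_|j IHj jn] x; first by rewrite /D /c !mul0r !subrr normr0.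
  have bD : BUC (D j).
    by apply: BUC_sub; [exact: BUC_sub|exact: BUC_scale].
  have AD : A (D j) x = iter j.+1 A phi x - A (iter j B phi) x - c j * iter j.+1 A (lap phi) x.
    rewrite /D mean_opB//; [|exact: BUC_sub|exact: BUC_scale].
    by rewrite mean_opB// mean_op_scale.
  have -> : D j.+1 x = A (D j) x
      + ((A (iter j B phi) x - B (iter j B phi) x - d / n%:R / N%:R * lap (iter j B phi) x)
      + d / n%:R / N%:R * (iter j B (lap phi) x - iter j.+1 A (lap phi) x)).
    have rearr (a b b' b'' e g g' : R) : a - b - (j.+1%:R * (d / n%:R) / N%:R) * e =
        a - b' - (j%:R * (d / n%:R) / N%:R) * e + ((b' - b - d / n%:R / N%:R * g)
        + d / n%:R / N%:R * (g - e)).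
      by rewrite -natr1; ring.
    rewrite AD (lap_mean_op (mean_op_iter j mB) (le_Cbd (isT : 2 <= 5)%N Cphi)).
    exact: rearr.
  apply: (le_trans (ler_normD _ _)); rewrite -natr1 mulrDl mul1r lerD//.
    by apply: (mean_op_bound mA) => // y; apply: IHj; exact: ltnW.
  apply: (le_trans (ler_normD _ _)); rewrite lerD//.
    by apply: AB; exact: Cbd_mean_op (mean_op_iter j mB) C3.
  rewrite normrM (le_trans (ler_wpM2l _ (chi_dist j x (ltnW jn))))//.
  rewrite !normrM !normfV (ger0_norm (ltW nR)) [`|N%:R|]ger0_norm//.
  by rewrite le_eqVlt; apply/orP; left; apply/eqP; field; rewrite NR0 gt_eqF.
move=> x; have := D_le n (leqnn n) x; rewrite /D.
have -> : c n = d / N%:R by rewrite /c; field; rewrite NR0 gt_eqF.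
move=> /le_trans; apply; rewrite le_eqVlt; apply/orP; left; apply/eqP.
rewrite /step -[in RHS]real_normK ?num_real//; field; by rewrite gt_eqF.
Qed.

End chernoff.

(** * The limit of the iterates and its dependence on time *)

Section heat_semigroup.
Context {R : realType} {N : nat}.
Implicit Types (f g phi : 'rV[R]_N -> R) (x y : 'rV[R]_N) (K t s h : R).
Hypothesis N0 : (0 < N)%N.

Notation A := (generator_cst (R := R) (N := N)).
Let A0 : 0 <= A. Proof. by rewrite !mulr_ge0 ?addr_ge0. Qed.
Let NR0 : (N%:R : R) != 0. Proof. by rewrite pnatr_eq0 -lt0n. Qed.

Lemma M2_increment K f h x : 0 <= h -> Cbd 3 K f ->
  `|M2 h f x - f x| <= K * (h + A * (h * Num.sqrt h)).
Proof.
move=> h0 Cf; rewrite -[X in `|X|](subrK (h / N%:R * lap f x)).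
apply: (le_trans (ler_normD _ _)); rewrite addrC mulrDr lerD//; last first.
  by rewrite mulrA [K * A]mulrC; exact: M2_generator.
rewrite normrM (le_trans (ler_wpM2l _ (lap_bound x (CbdS Cf))))//.
rewrite normrM normfV !ger0_norm//.
by rewrite le_eqVlt; apply/orP; left; apply/eqP; field.
Qed.

(** To this order, [m] short steps act like one step of length [h = m * tau]. The Laplacian of an
    iterate is the iterate of [lap f], which stays close to [lap f] by [M2_increment]. The bound
    [h <= 1] absorbs [h ^ 2] and the product of [h] with the summed errors into [h * sqrt h]. *)
Lemma iter_M2_generator K f tau m x : 0 <= tau -> m%:R * tau <= 1 -> Cbd 5 K f ->
  `|iter m (M2 tau) f x - f x - m%:R * tau / N%:R * lap f x|
    <= (2 * A + 1) * K * (m%:R * tau * Num.sqrt (m%:R * tau)).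
Proof.
move=> tau0 h1 Cf; set h := m%:R * tau.
have h0 : 0 <= h by rewrite mulr_ge0.
have K0 : 0 <= K := le_trans (normr_ge0 _) (Cbd_bound Cf 0).
have mT := M2_mean_op N0 tau0.
have Cchi : Cbd 3 (N%:R * K) (lap f) := Cbd_lap Cf.
pose w := tau * Num.sqrt tau.
have w0 : 0 <= w by rewrite mulr_ge0// sqrtr_ge0.
have dchi j y : (j <= m)%N -> `|iter j (M2 tau) (lap f) y - lap f y|
    <= m%:R * (N%:R * K * (tau + A * w)).
  move=> jm; apply: (le_trans (iter_dist j mT (Cbd_BUC Cchi) (fun y => M2_increment y tau0 Cchi) y)).
  by rewrite ler_wpM2r ?ler_nat// !mulr_ge0// addr_ge0// mulr_ge0.
pose step := A * K * w + tau * m%:R * K * (tau + A * w).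
have main j : (j <= m)%N -> forall y,
    `|iter j (M2 tau) f y - f y - j%:R * tau / N%:R * lap f y| <= j%:R * step.
  elim: j => [_|j IHj jm] y; first by rewrite !mul0r !subrr normr0.
  have Cj := Cbd_mean_op (mean_op_iter j mT) (le_Cbd (isT : 3 <= 5)%N Cf).
  have rearr (a b c l l' : R) : a - c - (j.+1%:R * tau / N%:R) * l =
      (b - c - (j%:R * tau / N%:R) * l) + ((a - b - tau / N%:R * l') + tau / N%:R * (l' - l)).
    by rewrite -natr1; ring.
  rewrite iterS (rearr _ (iter j (M2 tau) f y) _ _ (lap (iter j (M2 tau) f) y)).
  rewrite -natr1 mulrDl mul1r; apply: (le_trans (ler_normD _ _)); rewrite lerD//.
    by apply: IHj; exact: ltnW.
  apply: (le_trans (ler_normD _ _)); rewrite lerD//; first exact: M2_generator.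
  rewrite (lap_mean_op (mean_op_iter j mT) (le_Cbd (isT : 2 <= 5)%N Cf)).
  rewrite normrM (le_trans (ler_wpM2l _ (dchi j y (ltnW jm))))//.
  rewrite normrM normfV !ger0_norm//.
  by rewrite le_eqVlt; apply/orP; left; apply/eqP; field.
apply: (le_trans (main m (leqnn m) x)).
have hw : m%:R * w <= h * Num.sqrt h.
  rewrite /w mulrA -/h; have [m0|m0] := posnP m; first by rewrite /h m0 !mul0r.
  by rewrite ler_wpM2l// ler_sqrt// /h ler_peMl// ler1n.
have hh : h * h <= h * Num.sqrt h.
  rewrite ler_wpM2l// -[leLHS]ger0_norm// -sqrtr_sqr ler_sqrt//.
  by rewrite expr2 ler_piMr.
have -> : m%:R * step = A * K * (m%:R * w) + K * (h * h) + h * (A * K * (m%:R * w)).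
  by rewrite /step /h; ring.
have AKw : A * K * (m%:R * w) <= A * K * (h * Num.sqrt h).
  by rewrite ler_wpM2l// mulr_ge0.
rewrite (_ : (2 * A + 1) * K * _ = A * K * (h * Num.sqrt h) + K * (h * Num.sqrt h)
  + A * K * (h * Num.sqrt h)); last by ring.
apply: lerD; first by apply: lerD => //; exact: ler_wpM2l.
by apply: le_trans AKw; apply: ler_piMl => //; rewrite !mulr_ge0.
Qed.

Definition euler_iter t n phi := iter n (M2 (t / n%:R)) phi.

Lemma euler_iter_mean_op t n : 0 <= t -> mean_op (euler_iter t n).
Proof. by move=> t0; apply: mean_op_iter; apply: M2_mean_op => //; rewrite divr_ge0. Qed.

(* One step of length [t / n] is compared with [m] steps of length [t / (n * m)]. *)
Lemma euler_iter_mul t n m K phi x : 0 <= t -> (0 < n)%N -> (0 < m)%N ->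
  t / n%:R <= 1 -> Cbd 5 K phi ->
  `|euler_iter t n phi x - euler_iter t (n * m) phi x|
    <= (3 * A + 1) * K * t * Num.sqrt (t / n%:R).
Proof.
move=> t0 n0 m0 tn1 Cphi.
have nR : 0 < n%:R :> R by rewrite ltr0n.
have mR : 0 < m%:R :> R by rewrite ltr0n.
pose tau := t / (n * m)%:R; have tau0 : 0 <= tau by rewrite divr_ge0.
have h0 : 0 <= t / n%:R by rewrite divr_ge0.
have mtau : m%:R * tau = t / n%:R.
  by rewrite /tau natrM; field; rewrite !gt_eqF.
have mB := mean_op_iter m (M2_mean_op N0 tau0).
have mA := M2_mean_op N0 h0.
have itE k : iter k (iter m (M2 tau)) phi = iter (k * m) (M2 tau) phi.
  by elim: k => [//|k IHk]; rewrite iterS IHk mulSn iterD.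
rewrite /euler_iter -[iter (n * m) _ _]itE.
apply: (le_trans (chernoff_telescope n mA mB (Cbd_BUC Cphi)
  (eps := (3 * A + 1) * K * (t / n%:R * Num.sqrt (t / n%:R))) _ x)).
  move=> j y; have Cj := Cbd_mean_op (mean_op_iter j mB) Cphi.
  have rearr (a b c l : R) : a - b = (a - c - t / n%:R / N%:R * l)
    - (b - c - t / n%:R / N%:R * l) by ring.
  set g := iter j _ phi; rewrite (rearr _ _ (g y) (lap g y)).
  apply: (le_trans (ler_normB _ _)).
  rewrite (_ : 3 * A + 1 = A + (2 * A + 1)); last by ring.
  rewrite 2!mulrDl lerD//.
    by apply: M2_generator => //; exact: le_Cbd (isT : 3 <= 5)%N Cj.
  by have := @iter_M2_generator K g tau m y tau0; rewrite mtau; apply.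
rewrite le_eqVlt; apply/orP; left; apply/eqP.
by field; rewrite gt_eqF.
Qed.

Lemma sqrt_quotient_small t (e : R) : 0 <= t -> 0 < e ->
  exists n0, forall n, (n0 < n)%N -> t / n%:R <= 1 /\ Num.sqrt (t / n%:R) <= e.
Proof.
move=> t0 e0; exists (Num.truncn t + Num.truncn (t / e ^+ 2))%N => n nn.
have nR : 0 < n%:R :> R by rewrite ltr0n (leq_ltn_trans _ nn).
have [tn ten] : t <= n%:R /\ t / e ^+ 2 <= n%:R.
  split; apply/ltW; apply: lt_le_trans (truncnS_gt _) _; rewrite ler_nat;
  by apply: leq_ltn_trans nn; rewrite ?leq_addr ?leq_addl.
split; first by rewrite ler_pdivrMr// mul1r.
rewrite -[leRHS]ger0_norm ?(ltW e0)// -sqrtr_sqr ler_sqrt ?sqr_ge0//.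
by rewrite ler_pdivrMr// mulrC -ler_pdivrMr// exprn_gt0.
Qed.

Lemma euler_iter_cauchy t phi (e : R) : 0 <= t -> BUC phi -> 0 < e ->
  exists n0, forall n m, (n0 < n)%N -> (n0 < m)%N -> forall x,
    `|euler_iter t n phi x - euler_iter t m phi x| <= e.
Proof.
(* Two quarters for replacing the data by [g], and two for passing from [n] and from [m] to the
   common refinement [n * m]. *)
move=> t0 bphi e0; have e4 : 0 < e / 4 by rewrite divr_gt0.
have [g [K [Cg fg]]] := Cbd_dense 5 bphi e4.
have K0 : 0 <= K := le_trans (normr_ge0 _) (Cbd_bound Cg 0).
pose C := (3 * A + 1) * K * t.
have C0 : 0 <= C by rewrite !mulr_ge0// addr_ge0// mulr_ge0.
have C1 : 0 < C + 1 by rewrite ltr_wpDl.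
have [n0 n0P] := sqrt_quotient_small t0 (divr_gt0 e4 C1).
have rate n m x : (n0 < n)%N -> (0 < m)%N ->
    `|euler_iter t n g x - euler_iter t (n * m) g x| <= e / 4.
  move=> nn m0; have [tn sq] := n0P n nn.
  apply: (le_trans (euler_iter_mul x t0 (leq_ltn_trans (leq0n _) nn) m0 tn Cg)).
  apply: (le_trans (ler_wpM2l C0 sq)).
  by rewrite mulrCA ler_piMr ?(ltW e4)// ler_pdivrMr// mul1r lerDl.
exists n0 => n m nn mm x.
have ng k : `|euler_iter t k phi x - euler_iter t k g x| <= e / 4.
  exact: (mean_op_dist (euler_iter_mean_op k t0) x bphi (Cbd_BUC Cg) fg).
have := rate n m x nn (leq_ltn_trans (leq0n _) mm).
have := rate m n x mm (leq_ltn_trans (leq0n _) nn); rewrite mulnC.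
have := ng n; have := ng m.
rewrite !ler_norml => /andP[? ?] /andP[? ?] /andP[? ?] /andP[? ?].
by apply/andP; split; lra.
Qed.

(* Meaningful only for [0 <= t] and [BUC phi], where the limit exists. *)
Definition heat t phi x : R := lim (euler_iter t n phi x @[n --> \oo]).

Lemma euler_iter_cvg t phi x : 0 <= t -> BUC phi ->
  euler_iter t n phi x @[n --> \oo] --> heat t phi x.
Proof.
move=> t0 bphi; apply/cauchy_cvgP/cauchy_exP => e e0.
have e2 : 0 < e / 2 by rewrite divr_gt0.
have [n0 n0P] := euler_iter_cauchy t0 bphi e2.
exists (euler_iter t n0.+1 phi x).
suff : \forall n \near \oo, ball (euler_iter t n0.+1 phi x) e (euler_iter t n phi x) by [].
near=> n; rewrite -ball_normE /=; apply: (@le_lt_trans _ _ (e / 2)).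
  by apply: n0P => //; near: n; exact: nbhs_infty_gt.
by rewrite ltr_pdivrMr// ltr_pMr// ltr1n.
Unshelve. all: by end_near. Qed.

Lemma euler_iter_ucvg t phi (e : R) : 0 <= t -> BUC phi -> 0 < e ->
  exists n0, forall n, (n0 < n)%N -> forall x, `|euler_iter t n phi x - heat t phi x| <= e.
Proof.
move=> t0 bphi e0; have [n0 n0P] := euler_iter_cauchy t0 bphi e0.
exists n0 => n nn x.
have cv : `|euler_iter t n phi x - euler_iter t m phi x| @[m --> \oo]
    --> `|euler_iter t n phi x - heat t phi x|.
  by apply: cvg_norm; apply: cvgB; [exact: cvg_cst|exact: euler_iter_cvg].
apply: (ler_cvg_near cv); near=> m; apply: n0P => //.
by near: m; exact: nbhs_infty_gt.
Unshelve. all: by end_near. Qed.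

Lemma heat_mean_op t : 0 <= t -> mean_op (heat t).
Proof.
move=> t0; split=> [a f g bf bg x|f K x bf fK|f a x bf].
- apply/cvg_lim => //; rewrite (_ : (fun n => _) = fun n =>
      a * euler_iter t n f x + euler_iter t n g x); last first.
    by apply/funext => n; rewrite (mean_op_lin (euler_iter_mean_op n t0)).
  apply: cvgD; last exact: euler_iter_cvg.
  by apply: cvgM; [exact: cvg_cst|exact: euler_iter_cvg].
- have cv : euler_iter t n f x @[n --> \oo] --> heat t f x by exact: euler_iter_cvg.
  apply: (ler_cvg_near cv); apply: nearW => n.
  exact: (mean_op_le (euler_iter_mean_op n t0)).
- rewrite /heat (_ : (fun n => _) = fun n => euler_iter t n f (x + a))//.
  by apply/funext => n; exact: (mean_op_shift (euler_iter_mean_op n t0)).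
Qed.

Lemma heat0 phi : heat 0 phi = phi.
Proof.
apply/funext => x; apply/cvg_lim => //.
rewrite (_ : (fun n => _) = fun=> phi x); first exact: cvg_cst.
apply/funext => n; rewrite /euler_iter mul0r.
have -> : M2 0 = id :> (('rV[R]_N -> R) -> 'rV[R]_N -> R).
  by apply/funext => f; rewrite /M2 eqxx.
by elim: n => [//|n IHn]; rewrite iterS.
Qed.

(** The limit of [chernoff_time], whose [eta] tends to 0. The remainder is quadratic in [t - s] for
    [s] on either side of [t], so it yields the two-sided time derivative. *)
Lemma heat_time t s K phi x : 0 <= t -> 0 <= s -> Cbd 5 K phi ->
  `|heat t phi x - heat s phi x - (t - s) / N%:R * heat t (lap phi) x| <= K * (t - s) ^+ 2.
Proof.
move=> t0 s0 Cphi; have bphi := Cbd_BUC Cphi.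
have K0 : 0 <= K := le_trans (normr_ge0 _) (Cbd_bound Cphi 0).
have bchi := Cbd_BUC (Cbd_lap Cphi).
set d := t - s.
have cv : `|euler_iter t n phi x - euler_iter s n phi x - d / N%:R * euler_iter t n (lap phi) x|
    @[n --> \oo] --> `|heat t phi x - heat s phi x - d / N%:R * heat t (lap phi) x|.
  apply: cvg_norm; apply: cvgB; first by apply: cvgB; exact: euler_iter_cvg.
  by apply: cvgM; [exact: cvg_cst|exact: euler_iter_cvg].
apply/ler_addgt0Pr => e e0; apply: (ler_cvg_near cv).
pose C := K * ((A * (t + s) + 1 + A) * (1 + 2 * `|d|)).
have C0 : 0 <= C by rewrite !mulr_ge0 ?addr_ge0 ?mulr_ge0 ?addr_ge0.
pose e' := Num.min 1 (e / (C + 1)).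
have e'0 : 0 < e' by rewrite lt_min ltr01 divr_gt0// ltr_wpDl.
have [nt ntP] := sqrt_quotient_small t0 e'0.
have [ns nsP] := sqrt_quotient_small s0 e'0.
near=> n.
have ntn : (nt < n)%N by near: n; exact: nbhs_infty_gt.
have nsn : (ns < n)%N by near: n; exact: nbhs_infty_gt.
have n0 : (0 < n)%N by exact: leq_ltn_trans ntn.
have nR : 0 < n%:R :> R by rewrite ltr0n.
have [tn1 tne] := ntP n ntn; have [_ sne] := nsP n nsn.
have tn0 : 0 <= t / n%:R by rewrite divr_ge0.
have sn0 : 0 <= s / n%:R by rewrite divr_ge0.
have e'1 : e' <= 1 by rewrite ge_min lexx.
(* [A * (t + s) * e' / n] bounds the errors of the two one-step expansions, and [(1 + A) * e']
   bounds the increment of one step, both up to the factor [K']; one [eta] serves both hypotheses of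
   [chernoff_time]. *)
pose eta := (A * (t + s) + 1 + A) * e'.
have eta0 : 0 <= eta by rewrite !mulr_ge0 ?addr_ge0 ?mulr_ge0 ?addr_ge0// ltW.
have key := @chernoff_time R N N0 (M2 (t / n%:R)) (M2 (s / n%:R)) d eta n phi K n0 eta0
  (M2_mean_op N0 tn0) (M2_mean_op N0 sn0) _ _ Cphi x.
have small (a : R) : 0 <= a -> Num.sqrt (a / n%:R) <= e' ->
    a / n%:R * Num.sqrt (a / n%:R) <= a * e' / n%:R.
  by move=> a0 ae; rewrite [leRHS]mulrAC ler_wpM2l// divr_ge0.
apply: (le_trans (key _ _)).
- move=> K' f y Cf; have K'0 : 0 <= K' := le_trans (normr_ge0 _) (Cbd_bound Cf 0).
  have rearr (a b c l : R) : a - b - d / n%:R / N%:R * l =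
      (a - c - t / n%:R / N%:R * l) - (b - c - s / n%:R / N%:R * l).
    by rewrite /d; ring.
  rewrite (rearr _ _ (f y)); apply: (le_trans (ler_normB _ _)).
  apply: (le_trans (lerD (M2_generator N0 y tn0 Cf) (M2_generator N0 y sn0 Cf))).
  have AK0 : 0 <= A * K' by rewrite mulr_ge0.
  apply: (le_trans (lerD (ler_wpM2l AK0 (small _ t0 tne)) (ler_wpM2l AK0 (small _ s0 sne)))).
  rewrite [leLHS](_ : _ = K' * (A * (t + s) * e' / n%:R)); last by ring.
  apply: ler_wpM2l => //; apply: ler_wpM2r; first by rewrite invr_ge0.
  by apply: ler_wpM2r; [exact: ltW|rewrite -addrA lerDl addr_ge0].
- move=> K' f y Cf; have K'0 : 0 <= K' := le_trans (normr_ge0 _) (Cbd_bound Cf 0).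
  apply: (le_trans (M2_increment y tn0 Cf)); rewrite ler_wpM2l//.
  have tne2 : t / n%:R <= e'.
    rewrite -[leLHS]sqr_sqrtr// expr2 -[leRHS]mulr1 ler_pM ?sqrtr_ge0//.
    exact: le_trans tne e'1.
  have : t / n%:R * Num.sqrt (t / n%:R) <= e'.
    by rewrite -[leRHS]mul1r ler_pM ?sqrtr_ge0.
  rewrite /eta => h; rewrite !mulrDl mul1r -addrA.
  apply: ler_wpDl; first by rewrite !mulr_ge0 ?addr_ge0// ltW.
  by rewrite lerD// ler_wpM2l.
- rewrite mulrDr lerD2l /eta mulrAC !mulrA -[K * _ * _]mulrA -/C.
  apply: (@le_trans _ _ (C * (e / (C + 1)))).
    by rewrite ler_wpM2l// ge_min lexx orbT.
  by rewrite mulrCA ler_piMr ?(ltW e0)// ler_pdivrMr ?ltr_wpDl// mul1r lerDl.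
Unshelve. all: by end_near. Qed.

Lemma heat_time_lip t s K phi x : 0 <= t -> 0 <= s -> Cbd 5 K phi ->
  `|heat t phi x - heat s phi x| <= K * `|t - s| * (1 + `|t - s|).
Proof.
move=> t0 s0 Cphi; have Cchi := Cbd_lap Cphi.
rewrite -[X in `|X|](subrK ((t - s) / N%:R * heat t (lap phi) x)).
apply: (le_trans (ler_normD _ _)); rewrite addrC mulrDr mulr1 lerD//; last first.
  apply: (le_trans (heat_time x t0 s0 Cphi)).
  by rewrite -[in leLHS]real_normK ?num_real// expr2 mulrA.
rewrite normrM (le_trans (ler_wpM2l _ (mean_op_bound (heat_mean_op t0) x (Cbd_BUC Cchi) (Cbd_bound Cchi))))//.
rewrite normrM normfV [`|N%:R|]ger0_norm//.
by rewrite le_eqVlt; apply/orP; left; apply/eqP; field.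
Qed.

End heat_semigroup.

Arguments heat : simpl never.

(** * Viscosity solutions *)

Section one_dimensional_maximum.
Context {R : realType}.
Implicit Types (F G : R -> R) (l : R).

Lemma local_max_derive F l : is_derive (0 : R) (1 : R) F l ->
  (exists2 d, 0 < d & forall s, `|s| < d -> F s <= F 0) -> l = 0.
Proof.
move=> /is_deriveP dF [d d0 Fmax]; apply: contrapT => /eqP l0.
have l2 : 0 < `|l| / 2 by rewrite divr_gt0 ?normr_gt0.
have [d' d'0 d'P] := dF _ l2.
pose m := Num.min d d' / 2.
have mm : 0 < Num.min d d' by rewrite lt_min d0.
have m0 : 0 < m by rewrite divr_gt0.
have mlt : m < Num.min d d' by rewrite ltr_pdivrMr// ltr_pMr// ltr1n.
move: mlt; rewrite lt_min => /andP[md md'].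
pose h := Num.sg l * m.
have hm : `|h| = m by rewrite normrM normr_sg l0 mul1r gtr0_norm.
have := d'P h; rewrite hm => /(_ md'); rewrite add0r [h *: 1]mulr1.
have := Fmax h; rewrite hm => /(_ md) Fh.
have -> : h * l = m * `|l| by rewrite /h mulrAC -normrEsg mulrC.
rewrite ler_norml => /andP[+ _].
have : 0 < m * `|l| by rewrite mulr_gt0 ?normr_gt0.
lra.
Qed.

(** If [l > 0], then [F1] vanishes at 0 and grows at least like [l / 2 * s] to its right. By the
    mean value theorem [F] then exceeds [F 0] by at least [l / 4 * m ^ 2] at [m]. *)
Lemma local_max_derive2 F F1 l : (forall s, is_derive s (1 : R) F (F1 s)) ->
  is_derive (0 : R) (1 : R) F1 l ->
  (exists2 d, 0 < d & forall s, `|s| < d -> F s <= F 0) -> l <= 0.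
Proof.
move=> dF dF1 Fmax; rewrite leNgt; apply/negP => l0.
have F10 : F1 0 = 0 := local_max_derive (dF 0) Fmax.
have [d d0 dmax] := Fmax.
move/is_deriveP : dF1 => dF1.
have [d' d'0 d'P] := dF1 _ (divr_gt0 l0 (ltr0Sn _ 1)).
pose m := Num.min d d' / 2.
have mm : 0 < Num.min d d' by rewrite lt_min d0.
have m0 : 0 < m by rewrite divr_gt0.
have mlt : m < Num.min d d' by rewrite ltr_pdivrMr// ltr_pMr// ltr1n.
move: mlt; rewrite lt_min => /andP[md md'].
have F1ge s : 0 <= s <= m -> l / 2 * s <= F1 s.
  move=> /andP[s0 sm]; have := d'P s; rewrite ger0_norm// => /(_ (le_lt_trans sm md')).
  rewrite add0r [s *: 1]mulr1 F10 subr0 ler_norml => /andP[+ _].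
  lra.
pose G s := F s - l / 4 * s ^+ 2.
pose G1 s := F1 s - l / 4 * (s + s).
have dG s : is_derive s (1 : R) G (G1 s).
  have dsq := @is_deriveZ _ _ _ _ (l / 4) _ _ _ (is_deriveX 2 (is_derive_id s (1 : R))).
  have dsq' : is_derive s (1 : R) ((l / 4) \*: (id ^+ 2)) (l / 4 * (s + s)).
    apply: is_derive_eq dsq _; congr (_ * _).
    by rewrite /= expr1 [_ *: 1]mulr1 mulr2n mulrDl mul1r.
  exact: (is_deriveB (dF s) dsq').
have [c c01 Gm] := MVT_itv (ltW m0) (fun s _ => dG s).
have Gpos : 0 <= G m - G 0.
  rewrite Gm subr0 mulr_ge0 ?(ltW m0)// /G1 subr_ge0.
  by have := F1ge c c01; lra.
have := dmax m; rewrite gtr0_norm// => /(_ md).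
move: Gpos; rewrite /G expr0n mulr0 subr0.
have : 0 < l / 4 * m ^+ 2 by rewrite mulr_gt0 ?exprn_gt0 ?divr_gt0.
lra.
Qed.

End one_dimensional_maximum.

(** * Calculus of space-time test functions *)

Section space_time.
Context {R : realType} {N : nat}.
Notation e i := (delta_mx ord0 i : 'rV[R]_N).
Implicit Types (u v w phi : 'rV[R]_N * R -> R) (p q : 'rV[R]_N * R) (c l : R).

Lemma space_is_derive u p i l :
  is_derive p (edir R i) u l <-> is_derive p.1 (e i) (fun x => u (x, p.2)) l.
Proof.
have pE h : p + h *: edir R i = (p.1 + h *: e i, p.2).
  by case: p => x t; congr (_, _); rewrite /= ?[h *: 0]mulr0 ?addr0.
have p0 : u p = u (p.1, p.2) by case: p {pE}.
by split=> /is_deriveP H; apply/is_deriveP => eps /H[d d0 dP]; exists d => // h /dP;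
  rewrite pE p0.
Qed.

Lemma time_is_derive u p l :
  is_derive p (tdir R N) u l <-> is_derive p.2 (1 : R) (fun t => u (p.1, t)) l.
Proof.
have pE h : p + h *: tdir R N = (p.1, p.2 + h *: 1).
  by case: p => x t; congr (_, _); rewrite /= scaler0 addr0.
have p0 : u p = u (p.1, p.2) by case: p {pE}.
by split=> /is_deriveP H; apply/is_deriveP => eps /H[d d0 dP]; exists d => // h /dP;
  rewrite pE p0.
Qed.

Lemma space_time_nbhsP p (P : set ('rV[R]_N * R)) : nbhs p P <->
  exists2 d, 0 < d & forall q, `|p.1 - q.1| < d -> `|p.2 - q.2| < d -> P q.
Proof.
split=> [/nbhs_ballP[d /= d0 dP]|[d d0 dP]].
  exists d => // q q1 q2; apply: dP; split.
    by rewrite -ball_normE.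
  by rewrite -ball_normE.
apply/nbhs_ballP; exists d => //= q [].
by rewrite -!ball_normE /= => q1 q2; exact: dP.
Qed.

Lemma near_time_gt0 p : 0 < p.2 -> \forall q \near p, 0 < q.2.
Proof.
move=> p0; apply/space_time_nbhsP; exists p.2 => // q _.
by rewrite ltr_norml => /andP[_]; rewrite ltrBlDr ltrDl.
Qed.

Lemma continuous_eq_time_gt0 u v p : (forall q, 0 < q.2 -> u q = v q) -> 0 < p.2 ->
  {for p, continuous u} -> {for p, continuous v}.
Proof.
move=> uv p0 cu; suff : v @ p --> u p by rewrite uv.
apply: cvg_trans cu.
apply: near_eq_cvg; have := near_time_gt0 p0.
by apply: filterS => q q0; rewrite uv.
Qed.

(** The candidate derivatives agree with [dt] and [dx] only at positive times. Space lines keep the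
    time fixed, so this suffices for a second differentiation; positive times form an open set, so
    it suffices for continuity. *)
Lemma C21_intro u ut (ui : 'I_N -> _) (uij : 'I_N -> 'I_N -> _) :
  (forall p, 0 < p.2 -> [/\ {for p, continuous u}, is_derive p (tdir R N) u (ut p) &
     {for p, continuous ut}]) ->
  (forall p i, 0 < p.2 -> is_derive p (edir R i) u (ui i p) /\ {for p, continuous (ui i)}) ->
  (forall p i j, 0 < p.2 -> is_derive p (edir R j) (ui i) (uij i j p) /\
     {for p, continuous (uij i j)}) ->
  C21 u /\ forall p, 0 < p.2 -> dt u p = ut p /\ laplacian u p = \sum_i uij i i p.
Proof.
move=> hu hi hij.
have dtE q : 0 < q.2 -> ut q = dt u q by case/hu => _ [].
have dxE i q : 0 < q.2 -> ui i q = dx i u q by case/(hi _ i) => -[].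
have dxD i j p : 0 < p.2 -> is_derive p (edir R j) (dx i u) (uij i j p).
  move=> p0; apply: (is_derive_near_eq _ (hij p i j p0).1) => h.
  by apply: dxE; rewrite /= [h *: 0]mulr0 addr0.
have dxxE i j q : 0 < q.2 -> uij i j q = dx j (dx i u) q by case/(dxD i j).
split=> [p p0|p p0].
- have [cu [du _] cut] := hu p p0.
  have cdt := continuous_eq_time_gt0 dtE p0 cut.
  split.
    split; [exact: cu|exact: du|exact: cdt|move=> i].
    have [[d _] cd] := hi p i p0; split; first exact: d.
    exact: continuous_eq_time_gt0 (dxE i) p0 cd.
  move=> i j; have [d _] := dxD i j p p0; split; first exact: d.
  exact: continuous_eq_time_gt0 (dxxE i j) p0 (hij p i j p0).2.
- by split; [rewrite dtE|apply: eq_bigr => i _; rewrite dxxE].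
Qed.

Lemma C21_is_derive u p : C21 u -> 0 < p.2 ->
  [/\ is_derive p (tdir R N) u (dt u p),
      forall i, is_derive p (edir R i) u (dx i u p) &
      forall i j, is_derive p (edir R j) (dx i u) (dx j (dx i u) p)].
Proof.
move=> Cu p0; have [[_ du _ di] dij] := Cu p p0; split=> [|i|i j].
- exact: derivableP.
- exact: derivableP (di i).1.
- exact: derivableP (dij i j).1.
Qed.

Lemma C21_opp u : C21 u -> C21 (- u) /\
  forall p, 0 < p.2 -> dt (- u) p = - dt u p /\ laplacian (- u) p = - laplacian u p.
Proof.
move=> Cu.
have [||p i j p0|C H] := @C21_intro (- u) (fun p => - dt u p) (fun i p => - dx i u p)
  (fun i j p => - dx j (dx i u) p).
- move=> p p0; have [[cu _ ct _] _] := Cu p p0; have [du _ _] := C21_is_derive Cu p0.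
  by split; [exact: continuousN|exact: (is_deriveN du)|exact: continuousN].
- move=> p i p0; have [[_ _ _ ci] _] := Cu p p0; have [_ du _] := C21_is_derive Cu p0.
  by split; [exact: (is_deriveN (du i))|apply: continuousN; case: (ci i)].
- have [_ cij] := Cu p p0; have [_ _ du] := C21_is_derive Cu p0.
  by split; [exact: (is_deriveN (du i j))|apply: continuousN; case: (cij i j)].
- by split=> // p /H[-> ->]; split=> //; rewrite sumrN.
Qed.

(** One family for two purposes: with [be = al] and [ga = 0] it makes a local maximum strict, and
    with [be = 0] and [ga > 0] it forces decay at infinity for large space or time. *)
Definition penalty (al be ga : R) (a : 'rV[R]_N) (b : R) p : R :=
  al * (\sum_i (p.1 ord0 i - a ord0 i) ^+ 2) + (be * (p.2 - b) ^+ 2 + ga * p.2).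

Lemma is_derive_quadratic {V : normedModType R} (f : V -> R) (x v : V) l (m : R) :
  (forall h : R, f (x + h *: v) = f x + h * l + h ^+ 2 * m) -> is_derive x v f l.
Proof.
move=> fE; apply/is_deriveP => eps eps0.
have m1 : 0 < `|m| + 1 by rewrite ltr_wpDl.
exists (eps / (`|m| + 1)) => [|h hd]; first by rewrite divr_gt0.
have rearr (y : R) : y + h * l + h ^+ 2 * m - y - h * l = (h * m) * h by ring.
rewrite fE rearr normrM ler_wpM2r// normrM.
move/ltW : hd; rewrite ler_pdivlMr// mulrDr mulr1 => hle.
by apply: le_trans hle; rewrite lerDl.
Qed.

Lemma fst_coord_continuous (i : 'I_N) : continuous (fun p => p.1 ord0 i : R).
Proof.
move=> p; apply/cvgrPdist_lt => eps eps0; apply/space_time_nbhsP.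
exists eps => // q pq _; apply: le_lt_trans pq.
by have := coord_le_norm (p.1 - q.1) i; rewrite !mxE.
Qed.

Lemma snd_time_continuous : continuous (fun p => p.2 : R).
Proof.
move=> p; apply/cvgrPdist_lt => eps eps0; apply/space_time_nbhsP.
by exists eps.
Qed.

Lemma penalty_continuous al be ga a b : continuous (penalty al be ga a b).
Proof.
move=> p; apply: cvgD.
  apply: cvgM; first exact: cvg_cst.
  apply: cvg_sumr => i; apply: cvg_exprn; apply: cvgB; last exact: cvg_cst.
  exact: fst_coord_continuous.
apply: cvgD; apply: cvgM; try exact: cvg_cst; last exact: snd_time_continuous.
by apply: cvg_exprn; apply: cvgB; [exact: snd_time_continuous|exact: cvg_cst].
Qed.

Lemma penalty_time_derive al be ga a b p :
  is_derive p (tdir R N) (penalty al be ga a b) (2 * be * (p.2 - b) + ga).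
Proof.
apply: (is_derive_quadratic (m := be)) => h.
rewrite /penalty /= scaler0 addr0 [h *: 1]mulr1; ring.
Qed.

Lemma penalty_space_derive al be ga a b p i :
  is_derive p (edir R i) (penalty al be ga a b) (2 * al * (p.1 ord0 i - a ord0 i)).
Proof.
apply: (is_derive_quadratic (m := al)) => h.
rewrite /penalty /= [h *: 0]mulr0 addr0 (bigD1 i)//= [in RHS](bigD1 i)//=.
rewrite !mxE !eqxx mulr1.
have -> : \sum_(j < N | j != i) ((p.1 + h *: e i) ord0 j - a ord0 j) ^+ 2 =
    \sum_(j < N | j != i) (p.1 ord0 j - a ord0 j) ^+ 2.
  by apply: eq_bigr => j ji; rewrite !mxE eqxx (negbTE ji) /= mulr0 addr0.
ring.
Qed.

Lemma C21_add_penalty u al be ga a b : C21 u ->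
  C21 (fun p => u p + penalty al be ga a b p) /\
  forall p, 0 < p.2 ->
    dt (fun p => u p + penalty al be ga a b p) p = dt u p + (2 * be * (p.2 - b) + ga) /\
    laplacian (fun p => u p + penalty al be ga a b p) p = laplacian u p + 2 * al * N%:R.
Proof.
move=> Cu; pose P := penalty al be ga a b.
have ci i : continuous (fun p => 2 * al * (p.1 ord0 i - a ord0 i)).
  move=> p; apply: cvgM; first exact: cvg_cst.
  by apply: cvgB; [exact: fst_coord_continuous|exact: cvg_cst].
have ct : continuous (fun p : 'rV[R]_N * R => 2 * be * (p.2 - b) + ga).
  move=> p; apply: cvgD; last exact: cvg_cst.
  apply: cvgM; first exact: cvg_cst.
  by apply: cvgB; [exact: snd_time_continuous|exact: cvg_cst].
have [p p0|p i p0|p i j p0|C H] := @C21_intro (fun p => u p + P p)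
  (fun p => dt u p + (2 * be * (p.2 - b) + ga))
  (fun i p => dx i u p + 2 * al * (p.1 ord0 i - a ord0 i))
  (fun i j p => dx j (dx i u) p + 2 * al * (i == j)%:R).
- have [[cu _ cut _] _] := Cu p p0; have [du _ _] := C21_is_derive Cu p0.
  split.
  + apply: (@continuousD _ _ _ u P); [exact: cu|exact: penalty_continuous].
  + exact: (is_deriveD du (penalty_time_derive al be ga a b p)).
  + apply: (@continuousD _ _ _ (dt u) (fun p => _)); [exact: cut|exact: ct].
- have [[_ _ _ cx] _] := Cu p p0; have [_ du _] := C21_is_derive Cu p0.
  split; first exact: (is_deriveD (du i) (penalty_space_derive al be ga a b p i)).
  apply: (@continuousD _ _ _ (dx i u) (fun p => _)); [exact: (cx i).2|exact: ci].
- have [_ cxx] := Cu p p0; have [_ _ du] := C21_is_derive Cu p0.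
  split; last first.
    by apply: (@continuousD _ _ _ (dx j (dx i u)) (fun p => _)); [exact: (cxx i j).2|exact: cst_continuous].
  apply: (is_deriveD (du i j)); apply: (is_derive_quadratic (m := 0)) => h.
  by rewrite /= !mxE eqxx /=; ring.
- split=> // p p0; have [-> ->] := H p p0; split=> //.
  rewrite big_split /=; congr (_ + _).
  by under eq_bigr do rewrite eqxx mulr1; rewrite sumr_const card_ord -[LHS]mulr_natr.
Qed.

Lemma classical_visc_subsolution c u : 0 <= c -> C21 u ->
  (forall p, 0 < p.2 -> dt u p = c * laplacian u p) -> visc_subsolution c u.
Proof.
move=> c0 Cu eqn phi p Cphi p0 /space_time_nbhsP[d d0 dmax].
have [du _ _] := C21_is_derive Cu p0.
have [dphi _ _] := C21_is_derive Cphi p0.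
have pE : p = (p.1, p.2) by case: p {p0 du dphi dmax}.
have tE : dt u p = dt phi p.
  have D := is_deriveB du dphi; apply/eqP; rewrite -subr_eq0; apply/eqP.
  apply: (@local_max_derive R (fun s => (u - phi) (p + s *: tdir R N))).
    by apply: is_derive_line; rewrite scale0r addr0.
  exists d => // s sd; rewrite scale0r addr0; apply: dmax => /=.
    by rewrite scaler0 addr0 subrr normr0.
  by rewrite [s *: 1]mulr1 opprD addrA subrr sub0r normrN.
have xxE i : dx i (dx i u) p - dx i (dx i phi) p <= 0.
  have line_gt0 (s : R) : 0 < (p + s *: edir R i).2 by rewrite /= [s *: 0]mulr0 addr0.
  apply: (@local_max_derive2 R (fun s => (u - phi) (p + s *: edir R i))
    (fun s => (dx i u - dx i phi) (p + s *: edir R i))).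
  - move=> s; apply: is_derive_line.
    have [_ dui _] := C21_is_derive Cu (line_gt0 s).
    have [_ dpi _] := C21_is_derive Cphi (line_gt0 s).
    exact: is_deriveB (dui i) (dpi i).
  - apply: is_derive_line; rewrite scale0r addr0.
    have [_ _ dui] := C21_is_derive Cu p0.
    have [_ _ dpi] := C21_is_derive Cphi p0.
    exact: is_deriveB (dui i i) (dpi i i).
  - exists d => // s sd; rewrite scale0r addr0; apply: dmax => /=.
      rewrite opprD addrA subrr sub0r normrN normrZ.
      by apply: le_lt_trans sd; rewrite -[leRHS]mulr1 ler_wpM2l// norm_delta_le1.
    by rewrite [s *: 0]mulr0 addr0 subrr normr0.
rewrite -tE eqn// -mulrBr mulr_ge0_le0// /laplacian -sumrB.
by apply: sumr_le0 => i _; exact: xxE.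
Qed.

Lemma visc_subsolution_opp c u : visc_subsolution c (- u) -> visc_supersolution c u.
Proof.
move=> su phi p Cphi p0 pmin; have [Cn /(_ p p0)[tn ln]] := C21_opp Cphi.
have swap : forall a b a' b' : R, a - b <= a' - b' -> - a' - - b' <= - a - - b.
  by clear; move=> *; lra.
have flip : forall a b : R, - a - c * - b <= 0 -> 0 <= a - c * b.
  by clear; move=> a b; rewrite mulrN; lra.
have pmax : \forall q \near p, (- u) q - (- phi) q <= (- u) p - (- phi) p.
  by apply: filterS pmin => q; exact: swap.
by apply: flip; have := su _ p Cn p0 pmax; rewrite tn ln.
Qed.

Lemma visc_supersolution_opp c u : visc_supersolution c u -> visc_subsolution c (- u).
Proof.
move=> su phi p Cphi p0 pmax; have [Cn /(_ p p0)[tn ln]] := C21_opp Cphi.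
have swap : forall a b a' b' : R, - a' - b' <= - a - b -> a - - b <= a' - - b'.
  by clear; move=> *; lra.
have flip : forall a b : R, 0 <= - a - c * - b -> a - c * b <= 0.
  by clear; move=> a b; rewrite mulrN; lra.
have pmin : \forall q \near p, u p - (- phi) p <= u q - (- phi) q.
  by apply: filterS pmax => q; exact: swap.
by apply: flip; have := su _ p Cn p0 pmin; rewrite tn ln.
Qed.

End space_time.

(** * Stability under uniform limits and comparison with classical solutions *)

Section comparison.
Context {R : realType} {N : nat}.
Implicit Types (u v w phi : 'rV[R]_N * R -> R) (p q : 'rV[R]_N * R) (c : R).
Implicit Types (x a : 'rV[R]_N).

Notation upper := [set p : 'rV[R]_N * R | 0 <= p.2].

Lemma closed_ball_compact a (d : R) : compact [set x : 'rV[R]_N | `|a - x| <= d].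
Proof.
apply: bounded_closed_compact.
  exists (`|a| + d); split; first exact: num_real.
  move=> M dM x /= ax; apply: le_trans (ltW dM).
  by rewrite -[x in leLHS](subKr a) (le_trans (ler_normB _ _))// lerD2l.
have -> : [set x | `|a - x| <= d] = (fun x => `|a - x|) @^-1` [set t | t <= d] by [].
apply: closed_comp; last exact: closed_le.
move=> x _; apply/(@cvgrPdist_lt _ _ _ _ (nbhs_filter x)) => eps eps0.
have := nbhsx_ballx x eps eps0; rewrite -ball_normE.
apply: (@filterS _ _ (nbhs_filter x)) => y xy.
apply: le_lt_trans (ler_dist_dist _ _) _.
by rewrite opprB addrC addrA subrK distrC.
Qed.

Lemma sqr_norm_le_sum x : `|x| ^+ 2 <= \sum_i x ord0 i ^+ 2.
Proof. by rewrite -sqr_enorm lerXn2r ?nnegrE ?enorm_ge0// norm_le_enorm. Qed.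

Lemma penalty_ge (al d : R) a b p : 0 <= al -> 0 <= d ->
  d <= `|a - p.1| \/ d <= `|b - p.2| -> al * d ^+ 2 <= penalty al al 0 a b p.
Proof.
move=> al0 d0 dp; rewrite /penalty mul0r addr0 -mulrDr ler_wpM2l//.
have sq (s t : R) : 0 <= s -> s <= `|t| -> s ^+ 2 <= t ^+ 2.
  by move=> s0 st; rewrite -[leRHS]real_normK ?num_real// lerXn2r// nnegrE.
case: dp => dp.
  apply: (@le_trans _ _ (`|p.1 - a| ^+ 2)).
    by rewrite lerXn2r// ?nnegrE// distrC.
  apply: (le_trans (sqr_norm_le_sum _)).
  under eq_bigr do rewrite !mxE.
  by rewrite lerDl sqr_ge0.
have sum0 : 0 <= \sum_i (p.1 ord0 i - a ord0 i) ^+ 2.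
  by apply: sumr_ge0 => i _; exact: sqr_ge0.
by apply: (ler_wpDl sum0); apply: sq => //; rewrite distrC.
Qed.

Lemma laplacian_continuous phi p : C21 phi -> 0 < p.2 ->
  {for p, continuous (laplacian phi)}.
Proof.
move=> Cphi p0; apply: (cvg_sumr (F := nbhs p)) => i.
by have [_ /(_ i i)[]] := Cphi p p0.
Qed.

Lemma visc_subsolution_limit c u : 0 <= c ->
  (forall e : R, 0 < e -> exists v, [/\ visc_subsolution c v,
     forall p, 0 < p.2 -> {for p, continuous v} &
     forall p, 0 < p.2 -> `|u p - v p| <= e]) ->
  visc_subsolution c u.
Proof.
(* If [phi] violated the inequality at [p], a small quadratic penalty would keep it
   violated near [p] and make the maximum strict, so that a nearby subsolution [v]
   would have an interior maximum there. *)
move=> c0 uv phi p Cphi p0 pmax; rewrite leNgt; apply/negP => eta0.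
pose op q := dt phi q - c * laplacian phi q.
set eta := dt phi p - _ in eta0.
have cop : op q @[q --> p] --> eta.
  apply: cvgB; first by have [[_ _ ct _] _] := Cphi p p0; exact: ct.
  by apply: cvgM; [exact: cvg_cst|exact: laplacian_continuous].
have eta2 : eta / 2 < eta by rewrite ltr_pdivrMr// ltr_pMr// ltr1n.
have /space_time_nbhsP[d0 d00 d0P] :
    \forall q \near p, u q - phi q <= u p - phi p /\ eta / 2 < op q.
  have opgt : \forall q \near p, eta / 2 < op q.
    exact: (@cvgr_gt _ _ (nbhs p) (nbhs_filter p) op eta cop _ eta2).
  by near=> q; split; near: q.
pose d := Num.min d0 p.2 / 2.
have m0 : 0 < Num.min d0 p.2 by rewrite lt_min d00.
have dd : 0 < d by rewrite divr_gt0.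
have dlt : d < Num.min d0 p.2 by rewrite ltr_pdivrMr// ltr_pMr// ltr1n.
move: dlt; rewrite lt_min => /andP[dd0 dp].
pose K := [set x | `|p.1 - x| <= d] `*` [set t | `|p.2 - t| <= d].
have KP q : K q -> [/\ 0 < q.2, u q - phi q <= u p - phi p & eta / 2 < op q].
  move=> [/= q1 q2]; have [||umax opq] := d0P q.
  - exact: le_lt_trans q1 dd0.
  - exact: le_lt_trans q2 dd0.
  - split=> //; move: (le_lt_trans q2 dp); rewrite ltr_norml => /andP[_].
    by rewrite ltrBlDr ltrDl.
(* On [K] the penalty lowers the operator by at most [al * (2 * d + 2 * c * N)], from its time
   derivative and its Laplacian. Division by [D] keeps this within [eta / 2], and the added 1 keeps
   [D] positive. *)
pose D := 2 * d + 2 * c * N%:R + 1.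
have D0 : 0 <= 2 * d + 2 * c * N%:R.
  by apply: addr_ge0; [apply: mulr_ge0 => //; exact: ltW|rewrite !mulr_ge0].
have D1 : 0 < D by exact: ltr_wpDl.
pose al := eta / 2 / D.
have al0 : 0 < al by rewrite !divr_gt0.
have alD : al * (2 * d + 2 * c * N%:R) <= eta / 2.
  rewrite /al mulrAC -mulrA ler_piMr ?divr_ge0 ?(ltW eta0)//.
  by rewrite ler_pdivrMr// mul1r lerDl.
pose P := penalty al al 0 p.1 p.2.
have Pp : P p = 0.
  rewrite /P /penalty subrr expr0n mulr0 mul0r !addr0.
  by rewrite big1 ?mulr0// => i _; rewrite subrr expr0n.
(* If [u] and [v] differ by at most this, the penalty at a maximum of [f] is at most
   [al * d ^ 2 / 2], less than its values where a distance reaches [d]; so the maximum is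
   interior. *)
have e0 : 0 < al * d ^+ 2 / 4.
  by apply: divr_gt0 => //; apply: mulr_gt0 => //; exact: exprn_gt0.
have [v [sv cv uve]] := uv _ e0.
have cphi q : 0 < q.2 -> {for q, continuous phi} by move=> q0; have [[]] := Cphi q q0.
have Kp : K p by split; rewrite /= subrr normr0 ltW.
have cK : compact K.
  apply: compact_setX; first exact: closed_ball_compact.
  have -> : [set t | `|p.2 - t| <= d] = `[p.2 - d, p.2 + d]%classic.
    by apply/seteqP; split => t; rewrite /= in_itv /= distrC ler_distl.
  exact: segment_compact.
pose f q := v q - (phi q + P q).
have cf : {within K, continuous f}.
  apply: continuous_in_subspaceT => q; rewrite inE => /KP[q0 _ _].
  apply: cvgB; first exact: cv.
  by apply: cvgD; [exact: cphi|exact: penalty_continuous].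
have [q + qmax] := compact_EVT_max (ex_intro _ p Kp) cK cf.
rewrite inE => Kq; have [q0 uq opq] := KP _ Kq.
have fpq : v p - phi p <= v q - phi q - P q.
  have := qmax p; rewrite inE => /(_ Kp); rewrite /f Pp addr0.
  by move=> /le_trans; apply; rewrite opprD addrA.
have Pq : P q < al * d ^+ 2.
  rewrite ltNge; apply/negP => Pge.
  have := uve p p0; have := uve q q0; rewrite !ler_norml.
  move: uq fpq Pge e0; clear; move=> uq fpq Pge e0 /andP[? ?] /andP[? ?]; lra.
have [q1 q2] : `|p.1 - q.1| < d /\ `|p.2 - q.2| < d.
  by split; rewrite ltNge; apply/negP => h; move: Pq; rewrite ltNge => /negP; apply;
    apply: penalty_ge; rewrite ?(ltW al0) ?(ltW dd)//; [left|right].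
have nearK : \forall q' \near q, K q'.
  apply/space_time_nbhsP; exists (Num.min (d - `|p.1 - q.1|) (d - `|p.2 - q.2|)).
    by rewrite lt_min !subr_gt0 q1.
  move=> q'; rewrite !lt_min => /andP[h1 _] /andP[_ h2]; split => /=.
    rewrite -(subrKA q.1) (le_trans (ler_normD _ _))// -lerBrDl ltW//.
  rewrite -(subrKA q.2) (le_trans (ler_normD _ _))// -lerBrDl ltW//.
have [CP /(_ q q0)[tE lE]] := C21_add_penalty al al 0 p.1 p.2 Cphi.
have := sv _ q CP q0; rewrite tE lE => /(_ _)/wrap[].
  by apply: filterS nearK => q' Kq'; apply: qmax; rewrite inE.
have tq : - d <= q.2 - p.2 by move: q2; rewrite distrC ltr_norml => /andP[/ltW].
have := ler_wpM2l (ltW al0) tq.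
move: opq alD; rewrite /op; set A := dt phi q; set B := laplacian phi q.
clear; rewrite !mulrDr; move=> *.
have E1 : al * (2 * d) = 2 * (al * d) by ring.
have E2 : al * (2 * c * N%:R) = c * (2 * al * N%:R) by ring.
have E3 : 2 * al * (q.2 - p.2) = 2 * (al * (q.2 - p.2)) by ring.
lra.
Unshelve. all: by end_near. Qed.

Lemma visc_comparison c v w : 0 <= c ->
  visc_subsolution c v -> C21 w ->
  (forall p, 0 < p.2 -> dt w p = c * laplacian w p) ->
  {within upper, continuous v} -> {within upper, continuous w} ->
  (exists M, forall p, 0 <= p.2 -> v p - w p <= M) ->
  (forall x, v (x, 0) <= w (x, 0)) ->
  forall p, 0 <= p.2 -> v p <= w p.
Proof.
move=> c0 sv Cw eqw cv cw [M vwM] vw0 p1 p10; rewrite leNgt; apply/negP => wv.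
(* [al * S] is a strict supersolution growing at infinity: the maximum of
   [v - w - al * S] is attained, but cannot be at a positive time. *)
pose g : R := 2 * c * N%:R + 1.
have g1 : 1 <= g by rewrite lerDr !mulr_ge0.
pose S q := \sum_i q.1 ord0 i ^+ 2 + g * q.2 : R.
have Sge0 q : 0 <= q.2 -> 0 <= S q.
  move=> q0; rewrite addr_ge0 ?mulr_ge0 ?(le_trans ler01 g1)// sumr_ge0// => i _.
  exact: sqr_ge0.
(* Small enough for [al * S p1] to stay below the excess of [v] over [w] at [p1]. *)
pose al := (v p1 - w p1) / (S p1 + 1).
have S1 : 0 < S p1 + 1 by rewrite ltr_wpDl// Sge0.
have al0 : 0 < al by rewrite divr_gt0// subr_gt0.
pose P := penalty al 0 (al * g) (0 : 'rV[R]_N) 0.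
have PE q : P q = al * S q.
  rewrite /P /penalty /S mul0r add0r [in RHS]mulrDr [al * (g * _)]mulrA.
  congr (_ + _); congr (_ * _).
  by apply: eq_bigr => i _; rewrite mxE subr0.
pose f q := v q - (w q + P q).
have fp1 : 0 < f p1.
  rewrite /f PE opprD addrA subr_gt0 /al mulrAC ltr_pdivrMr//.
  by rewrite ltr_pM2l ?subr_gt0// ltrDl.
(* Outside the box of size [rho], both [rho >= 1] and [g >= 1] give [S >= rho], so the penalty is at
   least the bound [M] of [v - w]. *)
pose rho := 1 + `|M| / al.
have rho1 : 1 <= rho by rewrite lerDl divr_ge0// ltW.
have Mrho : M <= al * rho.
  rewrite /rho mulrDr mulr1 mulrCA divff ?gt_eqF// mulr1.
  by rewrite (le_trans (ler_norm M))// lerDr ltW.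
pose K := [set x : 'rV[R]_N | `|0 - x| <= rho] `*` `[0, rho]%classic.
have outK q : 0 <= q.2 -> ~ K q -> f q <= 0.
  move=> q0 nK; rewrite /f opprD addrA subr_le0 (le_trans (vwM q q0))//.
  rewrite (le_trans Mrho)// PE ler_wpM2l ?(ltW al0)//.
  have [q1|q1] := leP `|0 - q.1| rho.
    have q2 : rho < q.2.
      rewrite ltNge; apply/negP => q2; apply: nK; split => //=.
      by rewrite in_itv /= q0.
    have sum0 : 0 <= \sum_i q.1 ord0 i ^+ 2 by apply: sumr_ge0 => i _; exact: sqr_ge0.
    apply: (ler_wpDl sum0); apply: (le_trans (ltW q2)).
    by apply: ler_peMl.
  apply: (@le_trans _ _ (rho ^+ 2)); first by rewrite expr2 ler_peMl// (le_trans ler01).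
  apply: (@le_trans _ _ (`|q.1| ^+ 2)).
    rewrite lerXn2r// ?nnegrE ?(le_trans ler01 rho1)//.
    by move/ltW: q1; rewrite sub0r normrN.
  apply: (le_trans (sqr_norm_le_sum _)).
  by rewrite lerDl mulr_ge0// (le_trans ler01 g1).
have Kp1 : K p1.
  by apply: contrapT => /(outK _ p10); rewrite leNgt fp1.
have cK : compact K.
  by apply: compact_setX; [exact: closed_ball_compact|exact: segment_compact].
have Kupper : K `<=` upper by move=> q [_ /=]; rewrite in_itv /= => /andP[].
have cf : {within K, continuous f}.
  have cvK := continuous_subspaceW Kupper cv.
  have cwK := continuous_subspaceW Kupper cw.
  have cPK : {within K, continuous P}.
    by apply: continuous_subspaceT; exact: penalty_continuous.
  move=> q; apply: cvgB; first exact: cvK.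
  by apply: cvgD; [exact: cwK|exact: cPK].
have [q + qmax] := compact_EVT_max (ex_intro _ p1 Kp1) cK cf.
rewrite inE => Kq; have q0 := Kupper _ Kq.
have fq : 0 < f q.
  by apply: lt_le_trans fp1 _; apply: qmax; rewrite inE.
have fmax q' : 0 <= q'.2 -> f q' <= f q.
  move=> q'0; have [Kq'|/(outK _ q'0)] := pselect (K q'); first by apply: qmax; rewrite inE.
  by move=> /le_trans; apply; exact: ltW.
have {}q0 : 0 < q.2.
  move: q0; rewrite /= le_eqVlt => /predU1P[q20|//].
  move: fq; rewrite /f PE ltNge => /negP[].
  rewrite opprD addrA subr_le0 (@le_trans _ _ 0)//.
    by rewrite subr_le0; case: (q) q20 => x t /= <-.
  by rewrite mulr_ge0 ?(ltW al0)// Sge0// -q20.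
have [CP /(_ q q0)[tE lE]] := C21_add_penalty al 0 (al * g) 0 0 Cw.
have := sv _ q CP q0; rewrite tE lE eqw// => /(_ _)/wrap[].
  by apply: filterS (near_time_gt0 q0) => q' q'0; apply: fmax; exact: ltW.
set B := laplacian w q; move: al0; rewrite /g; clear => al0.
have -> : c * B + (2 * 0 * (q.2 - 0) + al * (2 * c * N%:R + 1)) - c * (B + 2 * al * N%:R) = al.
  by ring.
by rewrite leNgt al0.
Qed.

End comparison.

(** * The Cauchy problem *)

Lemma is_derive_sqr_bound {R : realType} (F : R -> R) (t l K : R) : 0 < t -> 0 <= K ->
  (forall s, 0 <= s -> `|F t - F s - (t - s) * l| <= K * (t - s) ^+ 2) ->
  is_derive t (1 : R) F l.
Proof.
move=> t0 K0 FK; apply/is_deriveP => eps eps0.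
have K1 : 0 < K + 1 by rewrite ltr_wpDl.
exists (Num.min t (eps / (K + 1))) => [|h]; first by rewrite lt_min t0 divr_gt0.
rewrite lt_min => /andP[hp he].
have h0 : 0 <= t + h.
  by move: hp; rewrite ltr_norml => /andP[hp _]; rewrite addrC -lerBlDr sub0r ltW.
have := FK (t + h) h0.
rewrite [h *: 1]mulr1 opprD addrA subrr sub0r sqrrN => hb.
have rearr (a b : R) : b - a - h * l = - (a - b - - h * l) by ring.
rewrite rearr normrN; apply: (le_trans hb).
rewrite -real_normK ?num_real// expr2 mulrA ler_wpM2r//.
apply: (@le_trans _ _ ((K + 1) * `|h|)); first by rewrite ler_wpM2r// lerDl.
by rewrite mulrC -ler_pdivlMr// ltW.
Qed.

Section heat_solution.
Context {R : realType} {N : nat}.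
Hypothesis N0 : (0 < N)%N.
Notation e i := (delta_mx ord0 i : 'rV[R]_N).
Notation upper := [set p : 'rV[R]_N * R | 0 <= p.2].
Implicit Types (phi g : 'rV[R]_N -> R) (p q : 'rV[R]_N * R) (K : R).

Definition heat_flow phi p : R := heat p.2 phi p.1.

(** For smooth data near [phi], one passes from [p] to [q] first in space, at the fixed time [p.2],
    then in time, with a Lipschitz bound that is uniform in space. Contraction transfers the
    estimate to [phi]. *)
Lemma heat_flow_uniform phi p (eps : R) : BUC phi -> 0 <= p.2 -> 0 < eps ->
  exists2 d, 0 < d & forall q, `|p.1 - q.1| < d -> `|p.2 - q.2| < d -> 0 <= q.2 ->
    `|heat_flow phi p - heat_flow phi q| < eps.
Proof.
move=> bphi p0 eps0; have e5 : 0 < eps / 5 by rewrite divr_gt0.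
have [g [K [Cg phig]]] := Cbd_dense 5 bphi e5.
have K0 : 0 <= K := le_trans (normr_ge0 _) (Cbd_bound Cg 0).
have bg := Cbd_BUC Cg.
have close q : 0 <= q.2 -> `|heat_flow phi q - heat_flow g q| <= eps / 5.
  by move=> q0; exact: (mean_op_dist (heat_mean_op N0 q0) q.1 bphi bg phig).
have /BUCP[_ /(_ _ e5)[d1 d10 d1P]] := mean_op_BUC (heat_mean_op N0 p0) bg.
pose d2 := Num.min 1 (eps / 5 / (2 * K + 1)).
have K1 : 0 < 2 * K + 1 by rewrite ltr_wpDl ?mulr_ge0.
have d20 : 0 < d2 by rewrite lt_min ltr01 !divr_gt0.
exists (Num.min d1 d2) => [|q]; first by rewrite lt_min d10.
rewrite !lt_min => /andP[q1 _] /andP[_ /andP[q21 q2]] q0.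
have := close p p0; have := close q q0.
have := d1P _ _ q1.
have : `|heat p.2 g q.1 - heat q.2 g q.1| <= eps / 5.
  apply: (le_trans (heat_time_lip N0 q.1 p0 q0 Cg)).
  have a0 := normr_ge0 (p.2 - q.2).
  apply: (@le_trans _ _ ((2 * K + 1) * `|p.2 - q.2|)).
    rewrite mulrAC ler_wpM2r//.
    rewrite (@le_trans _ _ (K * 2))//.
      by rewrite ler_wpM2l// -[2]/(1 + 1) lerD2l ltW.
    by rewrite mulrC lerDl.
  by rewrite mulrC -ler_pdivlMr// ltW.
rewrite /heat_flow; move: (heat p.2 g p.1) (heat p.2 g q.1) (heat q.2 g q.1).
move: (heat p.2 phi p.1) (heat q.2 phi q.1) eps0; clear.
move=> a b eps0 a' b'' b'; rewrite !ler_norml !ltr_norml.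
by move=> /andP[? ?] /andP[? ?] /andP[? ?] /andP[? ?]; apply/andP; split; lra.
Qed.

Lemma heat_flow_continuous phi p : BUC phi -> 0 < p.2 -> {for p, continuous (heat_flow phi)}.
Proof.
move=> bphi p0; apply/cvgrPdist_lt => eps eps0.
have [d d0 dP] := heat_flow_uniform bphi (ltW p0) eps0.
apply/space_time_nbhsP; exists (Num.min d p.2) => [|q]; first by rewrite lt_min d0.
rewrite !lt_min => /andP[q1 _] /andP[q2 q2p]; apply: dP => //.
by move: q2p; rewrite ltr_norml => /andP[_]; rewrite ltrBlDr ltrDl => /ltW.
Qed.

Lemma heat_flow_within phi : BUC phi -> {within upper, continuous (heat_flow phi)}.
Proof.
move=> bphi; apply/subspace_continuousP => p p0; apply/cvgrPdist_lt => eps eps0.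
have [d d0 dP] := heat_flow_uniform bphi p0 eps0.
by rewrite near_withinE; apply/space_time_nbhsP; exists d.
Qed.

(** Space derivatives of the flow are flows of the derivatives of the data, so the continuity of
    each derivative in space and time reduces to that of a flow with data in BUC. *)
Lemma heat_flow_classical K phi : Cbd 7 K phi ->
  C21 (heat_flow phi) /\
  forall p, 0 < p.2 -> dt (heat_flow phi) p = N%:R^-1 * laplacian (heat_flow phi) p.
Proof.
move=> Cphi; have bphi := Cbd_BUC Cphi.
pose di i := fun x => 'D_(e i) phi x; pose dij i j := fun x => 'D_(e j) (di i) x.
have Ci i : Cbd 6 K (di i) := Cbd_derive i Cphi.
have Cij i j : Cbd 5 K (dij i j) := Cbd_derive j (Ci i).
have bchi := Cbd_BUC (Cbd_lap Cphi).
have spaceD k (f : 'rV[R]_N -> R) p i : Cbd k.+1 K f -> 0 < p.2 ->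
    is_derive p (edir R i) (heat_flow f) (heat_flow (fun x => 'D_(e i) f x) p).
  move=> Cf p0; apply/space_is_derive.
  have df := Cbd_derivable (i := i) Cf.
  exact: (mean_op_is_derive (heat_mean_op N0 (ltW p0)) (Cbd_BUC Cf) df (Cbd_BUC (Cbd_derive i Cf))).
have [p p0|p i p0|p i j p0|C H] := @C21_intro R N (heat_flow phi)
  (fun p => N%:R^-1 * heat_flow (lap phi) p) (fun i => heat_flow (di i))
  (fun i j => heat_flow (dij i j)).
- split; [exact: heat_flow_continuous| |].
    have K0 : 0 <= K := le_trans (normr_ge0 _) (Cbd_bound Cphi 0).
    apply/time_is_derive; apply: (is_derive_sqr_bound p0 K0) => s s0.
    rewrite mulrA.
    exact: (heat_time N0 p.1 (ltW p0) s0 (le_Cbd (isT : 5 <= 7)%N Cphi)).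
  apply: (@cvgM _ _ _ (nbhs_filter p) (fun=> N%:R^-1)); first exact: cvg_cst.
  exact: heat_flow_continuous.
- split; first exact: spaceD Cphi p0.
  exact: heat_flow_continuous (Cbd_BUC (Ci i)) p0.
- split; first exact: spaceD (Ci i) p0.
  exact: heat_flow_continuous (Cbd_BUC (Cij i j)) p0.
- split=> // p p0; have [-> ->] := H p p0; congr (_ * _).
  have mh := heat_mean_op N0 (ltW p0).
  rewrite /heat_flow -(lap_mean_op mh (le_Cbd (isT : 2 <= 7)%N Cphi)).
  rewrite /lap; apply: eq_bigr => i _.
  rewrite (derive_mean_op i mh Cphi).
  by rewrite -[LHS]/((fun x => 'D_(e i) (heat p.2 (di i)) x) p.1) (derive_mean_op i mh (Ci i)).
Qed.

End heat_solution.

Section cauchy_problem.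
Context {R : realType} {N : nat}.
Hypothesis N0 : (0 < N)%N.
Notation upper := [set p : 'rV[R]_N * R | 0 <= p.2].
Implicit Types (f g : 'rV[R]_N -> R) (p q : 'rV[R]_N * R) (v : 'rV[R]_N * R -> R).

Let invN0 : 0 <= N%:R^-1 :> R.
Proof. by rewrite invr_ge0. Qed.

Lemma heat_flow_opp f p : BUC f -> 0 <= p.2 ->
  heat_flow (fun x => - f x) p = - heat_flow f p.
Proof.
move=> bf p0; rewrite /heat_flow -mulN1r -(mean_op_scale (heat_mean_op N0 p0) _ _ bf).
by congr heat; apply/funext => x; rewrite mulN1r.
Qed.

Lemma heat_flow_approx f (eps : R) : BUC f -> 0 < eps ->
  exists w, [/\ visc_subsolution N%:R^-1 w,
     forall p, 0 < p.2 -> {for p, continuous w} &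
     forall p, 0 < p.2 -> `|heat_flow f p - w p| <= eps].
Proof.
move=> bf eps0; have [g [K [Cg fg]]] := Cbd_dense 7 bf eps0.
have bg := Cbd_BUC Cg; have [C21g eqg] := heat_flow_classical N0 Cg.
exists (heat_flow g); split=> [|p p0|p p0].
- exact: classical_visc_subsolution.
- exact: heat_flow_continuous.
- exact: (mean_op_dist (heat_mean_op N0 (ltW p0)) p.1 bf bg fg).
Qed.

Lemma heat_flow_solution f : BUC f -> bounded_continuous_solution f (heat_flow f).
Proof.
move=> bf; have /BUCP[[K fK] _] := bf; split.
- exists K; split; first exact: num_real.
  move=> M KM p /= p0; apply: le_trans (ltW KM).
  exact: mean_op_bound (heat_mean_op N0 p0) _ _ _ bf fK.
- exact: heat_flow_within.
- by apply: visc_subsolution_limit => // e; exact: heat_flow_approx.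
- apply: visc_subsolution_opp; apply: visc_subsolution_limit => // e e0.
  have [w [sw cw fw]] := heat_flow_approx (BUC_opp bf) e0.
  exists w; split=> // p p0.
  by rewrite -[(- _) p]/(- heat_flow f p) -(heat_flow_opp bf (ltW p0)) fw.
- by move=> x; rewrite /heat_flow heat0.
Qed.

Lemma visc_subsolution_le_heat f v : BUC f -> visc_subsolution N%:R^-1 v ->
  {within upper, continuous v} -> (exists M, forall p, 0 <= p.2 -> v p <= M) ->
  (forall x, v (x, 0) <= f x) -> forall p, 0 <= p.2 -> v p <= heat_flow f p.
Proof.
move=> bf sv cv [M vM] v0 p p0; apply/ler_addgt0Pr => e e0.
have e2 : 0 < e / 2 by rewrite divr_gt0.
(* Approximating [f + e / 2] within [e / 2] gives smooth data between [f] and [f + e]. *)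
have [g [K [Cg fg]]] := Cbd_dense 7 (BUC_add bf (BUC_cst (e / 2))) e2.
have bg := Cbd_BUC Cg; have [C21g eqg] := heat_flow_classical N0 Cg.
have fleg x : f x <= g x.
  by have := fg x; rewrite ler_norml => /andP[_]; rewrite lerBlDr addrC lerD2l.
have fge x : `|f x - g x| <= e.
  rewrite distrC ger0_norm ?subr_ge0//.
  by have := fg x; rewrite ler_norml => /andP[+ _]; clear; lra.
have vg : v p <= heat_flow g p.
  apply: visc_comparison sv C21g eqg cv _ _ _ _ p0 => //.
  - exact: heat_flow_within.
  - exists (M + K) => q q0; rewrite lerD ?vM//.
    have := mean_op_bound (heat_mean_op N0 q0) q.1 bg (Cbd_bound Cg).
    by rewrite ler_norml lerNl => /andP[].
  - by move=> x; rewrite (le_trans (v0 x))// /heat_flow heat0.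
apply: (le_trans vg).
have := mean_op_dist (heat_mean_op N0 p0) p.1 bf bg fge.
by rewrite /heat_flow ler_norml => /andP[+ _]; clear; lra.
Qed.

Lemma heat_flow_unique f v : BUC f -> bounded_continuous_solution f v ->
  forall p, 0 <= p.2 -> v p = heat_flow f p.
Proof.
move=> bf [[M [_ Mv]] cv subv superv v0] p p0.
have vM q : 0 <= q.2 -> `|v q| <= M + 1 by apply: Mv; rewrite ltrDl.
apply/eqP; rewrite eq_le; apply/andP; split.
  apply: visc_subsolution_le_heat => //; last by move=> x; rewrite v0.
  by exists (M + 1) => q q0; rewrite (le_trans (ler_norm _))// vM.
rewrite -lerN2 -heat_flow_opp//.
apply: (visc_subsolution_le_heat (v := - v) (BUC_opp bf)) => //.
- exact: visc_supersolution_opp.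
- by move=> q; apply: cvgN; exact: cv.
- exists (M + 1) => q q0.
  by rewrite (le_trans (ler_norm _))// normrN vM.
- by move=> x; rewrite -[leLHS]/(- v (x, 0)) v0.
Qed.

Lemma sup_norm_ge f x : BUC f -> `|f x| <= sup_norm f.
Proof.
move=> /BUCP[[K fK] _]; apply: ub_le_sup; last by exists x.
by exists K => _ [y _ <-].
Qed.

Lemma sup_norm_le f (e : R) : (forall x, `|f x| <= e) -> sup_norm f <= e.
Proof. by move=> fe; apply: ge_sup => [|_ [x _ <-]//]; exists `|f 0|, 0. Qed.

Lemma euler_iter_BUC_cvg f (t : R) : BUC f -> 0 <= t ->
  BUC_cvg (fun n => euler_iter t n f) (heat t f).
Proof.
move=> bf t0; have bheat := mean_op_BUC (heat_mean_op N0 t0) bf.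
have biter n := mean_op_BUC (euler_iter_mean_op N0 n t0) bf.
split=> //; apply/cvgrPdist_le => e e0.
have [n0 n0P] := euler_iter_ucvg N0 t0 bf e0.
exists n0.+1 => // n /n0P dn; rewrite sub0r normrN ger0_norm ?sup_norm_le//.
exact: le_trans (normr_ge0 _) (sup_norm_ge 0 (BUC_sub (biter n) bheat)).
Qed.

Lemma BUC_cvg_pointwise (F : nat -> 'rV[R]_N -> R) g x : BUC_cvg F g ->
  F n x @[n --> \oo] --> g x.
Proof.
move=> [bF bg /cvgrPdist_le Fg]; apply/cvgrPdist_le => e /Fg.
apply: filterS => n; rewrite sub0r normrN distrC => le_e.
rewrite (le_trans _ (le_trans (ler_norm _) le_e))//.
exact: (sup_norm_ge x (BUC_sub (bF n) bg)).
Qed.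

End cauchy_problem.

(** The limits determine [u] at nonnegative times only. This is enough, since the viscosity
    conditions at a positive time look only at a neighborhood that may be taken within positive
    times. *)
Lemma eq_bounded_continuous_solution {R : realType} {N : nat} (f : 'rV[R]_N -> R)
    (u v : 'rV[R]_N * R -> R) :
  (forall p, 0 <= p.2 -> u p = v p) ->
  bounded_continuous_solution f u -> bounded_continuous_solution f v.
Proof.
move=> uv [[M [Mr Mu]] cu subu superu u0].
have near_uv (p : 'rV[R]_N * R) : 0 < p.2 -> \forall q \near p, u q = v q.
  by move=> p0; apply: filterS (near_time_gt0 p0) => q q0; apply/uv/ltW.
split.
- exists M; split=> // L ML p p0.
  by have := Mu L ML p p0; rewrite /= (uv p p0).
- apply: subspace_eq_continuous cu => p; rewrite inE => p0.
  exact: uv.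
- move=> phi p Cphi p0 pmax; apply: subu => //.
  near=> q; rewrite !(uv p (ltW p0)) (_ : u q = v q); first by near: q.
  by near: q; exact: near_uv.
- move=> phi p Cphi p0 pmax; apply: superu => //.
  near=> q; rewrite !(uv p (ltW p0)) (_ : u q = v q); first by near: q.
  by near: q; exact: near_uv.
- by move=> x; rewrite -uv.
Unshelve. all: by end_near. Qed.

Theorem theorem1p2 (R : realType) (N : nat) (hN : (1 <= N)%N)
    (u0 : 'rV[R]_N -> R) (hu0 : BUC u0) :
  [/\ (* M2 h is a linear operator from BUC to BUC *)
      (forall (h : R), 0 <= h ->
         (forall phi : 'rV[R]_N -> R, BUC phi -> BUC (M2 h phi)) /\
         (forall (a : R) (phi psi : 'rV[R]_N -> R), BUC phi -> BUC psi ->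
            forall x, M2 h (fun y => a * phi y + psi y) x
                      = a * M2 h phi x + M2 h psi x)),
      (* the limit defining u t exists *)
      (forall t : R, 0 <= t -> exists g : 'rV[R]_N -> R,
         BUC_cvg (fun n => iter n (M2 (t / n%:R)) u0) g) &
      (* u is the unique bounded continuous solution *)
      (forall u : R -> 'rV[R]_N -> R,
         (forall t : R, 0 <= t ->
            BUC_cvg (fun n => iter n (M2 (t / n%:R)) u0) (u t)) ->
         bounded_continuous_solution u0 (fun p => u p.2 p.1) /\
         (forall v : 'rV[R]_N * R -> R,
            bounded_continuous_solution u0 v ->
            forall x t, 0 <= t -> v (x, t) = u t x))].
Proof.
split=> [h h0|t t0|u ucvg].
- have mh := M2_mean_op hN h0.
  by split=> [phi|a phi psi bphi bpsi x]; [exact: mean_op_BUC|exact: mean_op_lin].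
- by exists (heat t u0); exact: euler_iter_BUC_cvg.
(* Convergence in the sup norm implies pointwise convergence, so any [u] given by the limits is the
   heat flow at nonnegative times. *)
- have uE p : 0 <= p.2 -> heat_flow u0 p = u p.2 p.1.
    move=> p0; have := BUC_cvg_pointwise (x := p.1) (ucvg p.2 p0).
    have := euler_iter_cvg hN (x := p.1) p0 hu0.
    by move=> h1 h2; exact: cvg_unique h1 h2.
  split=> [|v solv x t t0].
    exact: eq_bounded_continuous_solution uE (heat_flow_solution hN hu0).
  by rewrite (heat_flow_unique hN hu0 solv)// uE.
Qed.
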